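(* Let $M>0$ and $a,Q,e\in\mathbb R$ with $M^2=a^2+Q^2$ (the extreme Kerr-Newman case), and let $\kappa\in\mathbb Z+\frac12$. Put $$\omega:=-\frac{\kappa a+eQM}{a^2+M^2}.$$ Then for every $n\in\mathbb Z\setminus\{0\}$ with $|n|$ sufficiently large the following holds, where $H_n(m)$ denotes the radial Dirac operator with particle mass $m$ and with $\lambda=\lambda_n(m)$. (i) If $\omega(eQ+M\omega)\le0$, then $H_n(m)$ has no energy eigenvalue (for any particle mass $m\ge0$). (ii) If $\omega(eQ+M\omega)>0$, then there is a sequence $(m_N)_{N\in\mathbb N}\subseteq(|\omega|,\infty)$ such that, whenever $m\in\{m_N:N\in\mathbb N\}$, the number $\omega$ is an energy eigenvalue of $H_n(m)$. Moreover, for $N_0$ large enough, the sequence $(m_N)_{N\ge N_0}$ is monotonically decreasing and converges to $|\omega|$.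
   Context: Angular operator. For $m\ge0$, $\omega\in\mathbb R$, $\kappa\in\mathbb Z+\frac12$, let $A(m)$ be the unique self-adjoint realisation in $L^2((0,\pi);\sin\theta\,d\theta)^2$ of the differential expression $$\begin{pmatrix}-am\cos\theta&\mathcal L_-\\-\mathcal L_+&am\cos\theta\end{pmatrix},\qquad \mathcal L_\pm=\frac{d}{d\theta}+\frac{\cot\theta}2\mp\Bigl[a\omega\sin\theta+\frac{\kappa}{\sin\theta}\Bigr].$$ Its spectrum is purely discrete, consists of simple real eigenvalues and is unbounded from above and below; the eigenvalues are denoted $\lambda_n(m)$, $n\in\mathbb Z\setminus\{0\}$, enumerated in strictly increasing order in $n$, with the enumeration such that for fixed $n$ the eigenvalue depends continuously on the parameters ($m$, $a$, $\omega$) and equals $\operatorname{sign}(n)(|\kappa|-\frac12+|n|)$ when $a=0$. Radial operator. In the extreme case $r_+=r_-=M$ and $\Delta(r)=r^2-2Mr+a^2+Q^2=(r-M)^2$. Let $x=x(r)=r+2M\log(r-M)-\frac{M^2+a^2}{r-M}$, a bijection from $(M,\infty)$ onto $\mathbb R$ with $\frac{dx}{dr}=\frac{r^2+a^2}{\Delta(r)}$; let $r=r(x)$ be its inverse. $H_n(m)$ is the unique self-adjoint extension in $L^2(\mathbb R;dx)^2$ of the operator with domain $C_0^\infty(\mathbb R)^2$ given by $$\begin{pmatrix}\dfrac{mr\sqrt\Delta}{r^2+a^2}-\dfrac{a\kappa+eQr}{r^2+a^2}&-\dfrac{d}{dx}+\dfrac{\lambda\sqrt\Delta}{r^2+a^2}\\[2ex]\dfrac{d}{dx}+\dfrac{\lambda\sqrt\Delta}{r^2+a^2}&-\dfrac{mr\sqrt\Delta}{r^2+a^2}-\dfrac{a\kappa+eQr}{r^2+a^2}\end{pmatrix},\qquad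 r=r(x),\ \Delta=\Delta(r(x)),\ \lambda=\lambda_n(m).$$ A real number $\omega$ is called an energy eigenvalue of $H_n(m)$ if $\omega$ is an eigenvalue of $H_n(m)$ (with an eigenfunction in $L^2(\mathbb R;dx)^2$) and simultaneously the value $\lambda=\lambda_n(m)$ used in $H_n(m)$ is an eigenvalue of the angular operator $A(m)$ formed with this same $\omega$. *)

(* Defs.v *)
From HB Require Import structures.
From mathcomp Require Import all_boot all_order all_algebra.
From mathcomp Require Import complex.
From mathcomp Require Import all_classical all_reals all_analysis.
Set Implicit Arguments.
Unset Strict Implicit.
Unset Printing Implicit Defensive.
Import Order.TTheory GRing.Theory Num.Theory.
Import numFieldNormedType.Exports.
Local Open Scope classical_set_scope.
Local Open Scope complex_scope.
Local Open Scope ring_scope.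

(** Operators in [L^2(D; w dx)^2], for [D] a set of reals and [w] a weight that
    is positive on [D].  Elements of this complex Hilbert space are represented
    by functions [R -> R[i] * R[i]]; only their values on [D] up to null sets
    matter. *)
Definition spinor (R : realType) : Type := R -> R[i] * R[i].

Definition csqnorm (R : realType) (z : R[i]) : R :=
  complex.Re z ^+ 2 + complex.Im z ^+ 2.

Definition cintegral (R : realType) (D : set R) (f : R -> R[i]) : R[i] :=
  (\int[lebesgue_measure]_(x in D) complex.Re (f x)) +i*
  (\int[lebesgue_measure]_(x in D) complex.Im (f x)).

Definition cmeasurable (R : realType) (D : set R) (f : R -> R[i]) : Prop :=
  measurable_fun D (fun x => complex.Re (f x)) /\
  measurable_fun D (fun x => complex.Im (f x)).

Definition L2 (R : realType) (D : set R) (w : R -> R) (u : spinor R) : Prop :=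
  [/\ cmeasurable D (fun x => (u x).1),
      cmeasurable D (fun x => (u x).2) &
      (\int[lebesgue_measure]_(x in D)
         (w x * (csqnorm (u x).1 + csqnorm (u x).2))%:E < +oo)%E].

Definition inner (R : realType) (D : set R) (w : R -> R) (u v : spinor R) :
  R[i] :=
  cintegral D (fun x =>
    (w x)%:C * ((u x).1 * conjc (v x).1 + (u x).2 * conjc (v x).2)).

(** A (possibly unbounded) operator is represented by its graph. *)
Definition operator (R : realType) : Type := set (spinor R * spinor R).

Definition adjoint (R : realType) (D : set R) (w : R -> R) (T : operator R) :
  operator R :=
  [set vg | [/\ L2 D w vg.1, L2 D w vg.2 &
     forall u f, T (u, f) -> inner D w f vg.1 = inner D w u vg.2]].

(** [T = adjoint D w T] makes [T] a closed linear relation, saturated for a.e.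
    equality on [D].  If moreover [T] contains a densely defined graph, as
    below, it is single-valued up to a.e. equality, i.e. an operator. *)
Definition selfadjoint_extension (R : realType) (D : set R) (w : R -> R)
    (T0 T : operator R) : Prop :=
  T0 `<=` T /\ T = adjoint D w T.

(** The self-adjoint extension of [T0], meant for [T0] having exactly one;
    the default value [T0] is irrelevant.  Both minimal operators below are
    essentially self-adjoint (the angular one because |kappa| >= 1/2). *)
Definition the_selfadjoint_extension (R : realType) (D : set R) (w : R -> R)
    (T0 : operator R) : operator R :=
  xget T0 [set T | selfadjoint_extension D w T0 T].

Definition op_eigenvalue (R : realType) (D : set R) (T : operator R) (l : R) :
  Prop :=
  exists u : spinor R,
    ~ {ae lebesgue_measure, forall x, D x -> u x = (0, 0)} /\
    T (u, fun x => (l%:C * (u x).1, l%:C * (u x).2)).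

Definition smooth (R : realType) (f : R -> R) : Prop :=
  forall (n : nat) (x : R), derivable (derive1n n f) x 1.

Definition csmooth (R : realType) (f : R -> R[i]) : Prop :=
  smooth (fun x => complex.Re (f x)) /\ smooth (fun x => complex.Im (f x)).

Definition cderive (R : realType) (f : R -> R[i]) (x : R) : R[i] :=
  derive1 (fun t : R => complex.Re (f t)) x +i*
  derive1 (fun t : R => complex.Im (f t)) x.

(** [C_0^oo(D)^2], functions being extended by zero outside [D]. *)
Definition test_spinor (R : realType) (D : set R) (u : spinor R) : Prop :=
  [/\ csmooth (fun x => (u x).1), csmooth (fun x => (u x).2) &
      exists K : set R, [/\ compact K, K `<=` D &
        forall x, ~ K x -> u x = (0, 0)]].

Definition minimal_operator (R : realType) (D : set R)
    (tau : spinor R -> spinor R) : operator R :=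
  [set uf | test_spinor D uf.1 /\ uf.2 = tau uf.1].

Definition cot (R : realType) (t : R) : R := cos t / sin t.

(** [Lang 1] is L_+ and [Lang (-1)] is L_-. *)
Definition Lang (R : realType) (s a omega kappa : R) (f : R -> R[i]) (t : R) :
  R[i] :=
  cderive f t + (cot t / 2)%:C * f t
  - (s * (a * omega * sin t + kappa / sin t))%:C * f t.

Definition angular_expr (R : realType) (m a omega kappa : R) (u : spinor R) :
  spinor R :=
  fun t =>
    ((- (a * m * cos t))%:C * (u t).1
       + Lang (-1) a omega kappa (fun s => (u s).2) t,
     - Lang 1 a omega kappa (fun s => (u s).1) t
       + (a * m * cos t)%:C * (u t).2).

Definition angular_domain (R : realType) : set R :=
  [set t | 0 < t < pi].

Definition angular_operator (R : realType) (m a omega kappa : R) :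
  operator R :=
  the_selfadjoint_extension (@angular_domain R) (@sin R)
    (minimal_operator (@angular_domain R) (angular_expr m a omega kappa)).

(** [lam n m a omega] is the [n]-th eigenvalue, [n <> 0], of the angular
    operator; the values at [n = 0] and for [m < 0] are irrelevant. *)
Definition angular_enumeration (R : realType) (kappa : R)
    (lam : int -> R -> R -> R -> R) : Prop :=
  [/\ forall m a omega : R, 0 <= m ->
        forall i j : int, i != 0 -> j != 0 -> i < j ->
          lam i m a omega < lam j m a omega,
      forall m a omega : R, 0 <= m ->
        forall l : R,
          op_eigenvalue (@angular_domain R) (angular_operator m a omega kappa) l
          <-> exists2 n : int, n != 0 & l = lam n m a omega,
      forall n : int, n != 0 ->
        {within [set p : R * R * R | 0 <= p.1.1],
           continuous (fun p : R * R * R => lam n p.1.1 p.1.2 p.2)} &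
      forall (n : int) (m omega : R), n != 0 -> 0 <= m ->
        lam n m 0 omega = (sgz n)%:~R * (`|kappa| - 1 / 2 + `|n|%:~R)].

Definition Delta (R : realType) (M a Q r : R) : R :=
  r ^+ 2 - 2 * M * r + a ^+ 2 + Q ^+ 2.

Definition tortoise (R : realType) (M a r : R) : R :=
  r + 2 * M * ln (r - M) - (M ^+ 2 + a ^+ 2) / (r - M).

(** The inverse of the bijection [tortoise M a] from (M, +oo) onto [R]. *)
Definition inv_tortoise (R : realType) (M a x : R) : R :=
  xget 0 [set r | M < r /\ tortoise M a r = x].

Definition radial_expr (R : realType) (M a Q e kappa m lambda : R)
    (u : spinor R) : spinor R :=
  fun x =>
    let r := inv_tortoise M a x in
    let d := r ^+ 2 + a ^+ 2 in
    let sD := Num.sqrt (Delta M a Q r) in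
    let V := (a * kappa + e * Q * r) / d in
    ((m * r * sD / d - V)%:C * (u x).1
       + (- cderive (fun y => (u y).2) x + (lambda * sD / d)%:C * (u x).2),
     (cderive (fun y => (u y).1) x + (lambda * sD / d)%:C * (u x).1)
       + (- (m * r * sD / d) - V)%:C * (u x).2).

Definition radial_operator (R : realType) (M a Q e kappa m lambda : R) :
  operator R :=
  the_selfadjoint_extension [set: R] (fun=> 1)
    (minimal_operator [set: R] (radial_expr M a Q e kappa m lambda)).

(** [lambda] is the parameter of the radial operator; for H_n(m) it is
    [lam n m a omega], with the same [omega] as the candidate eigenvalue. *)
Definition energy_eigenvalue (R : realType) (M a Q e kappa m lambda omega : R) :
  Prop :=
  op_eigenvalue [set: R] (radial_operator M a Q e kappa m lambda) omega /\
  op_eigenvalue (@angular_domain R) (angular_operator m a omega kappa) lambda.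

(* Main.v *)
(* In the coordinate [rho = r - M] the radial equation is a first-order system
   whose coefficients are, up to the factor [drho/dx], quadratic polynomials in
   [rho] divided by [rho^2].  If the energy [o] differs from [omega], the
   leading term [(o - omega) / rho^2] at the horizon makes the energy form
   [<u, S u>], which has an integrable relative derivative, definite there, so
   no solution is square-integrable; for [o = omega] and [m < |omega|] the same
   happens at infinity.  At [o = omega] the system reads
   [u' = (A0 + A1 / rho) u], with regular singularity [+- s] at the horizon,
   [s^2 = lambda^2 + (m M)^2 - be^2], and rate [k^2 = m^2 - omega^2] at infinity.
   With [be = eta + omega M] and [eta = e Q + M omega], a quadratic form
   in [u] is monotone along solutions when [omega eta <= 0], and it tends to 0
   along sequences at both ends; hence [u = 0] (for [s^2 < 1/4] a Lyapunov form excludes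
   square-integrability at the horizon directly).  When
   [omega eta / k - M k - s = N] is a positive integer there is a solution
   [rho^s exp(- k rho)] times a polynomial of degree [N]; the left-hand side
   blows up as [m] decreases to [|omega|], and the intermediate value theorem
   gives the masses [m_N].

   This needs [s >= 1], i.e. [|lambda_n|] large.  For the angular operator, the
   variation-of-constants kernels are bounded because [|kappa| >= 1/2], and
   Bessel's inequality for orthogonal eigenfunctions then bounds the number of
   eigenvalues in a bounded interval.

   Only weak information on the operators is used: an eigenfunction of a
   self-adjoint extension is a weak, hence classical, solution; and the radial
   minimal operator has a symmetric adjoint, which is therefore its unique
   self-adjoint extension. *)

Require Import Defs.
From HB Require Import structures.
From mathcomp Require Import all_boot all_order all_algebra.
From mathcomp Require Import complex.
From mathcomp Require Import all_classical all_reals all_analysis.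
From mathcomp Require Import measurable_realfun.
From mathcomp Require Import ring lra.
Import Order.TTheory GRing.Theory Num.Theory.
Import numFieldNormedType.Exports.
Local Open Scope classical_set_scope.
Local Open Scope ring_scope.
Set Implicit Arguments.
Unset Strict Implicit.
Unset Printing Implicit Defensive.

(** * Derivatives and smooth cutoffs *)

Section Calculus.
Variable R : realType.
Implicit Types (f g : R -> R) (x : R).

(** The coefficients are real, so the real and imaginary parts of an eigenfunction solve the same
    real system, and the analysis deals with pairs of real functions. For [u' = Y u] with trace-free
    [Y], the form det(u, X u) has derivative det(u, (X' + [X, Y]) u). With [X] proportional to [Y]
    only the derivatives of the coefficients survive: this is the energy form. At the critical
    energy [X] is a combination of diag(1, -1) and [A0], tuned so that the cross term linear in rho
    cancels. The threshold 1/4 for s^2 comes from dx ~ drho / rho^2 at the horizon: a solution of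
    size rho^s is square-integrable there only for s > 1/2. The polynomial solution is explicit
    because [A0 + k] has rank one, which collapses the two-component recursion to a scalar one. The
    order of the choices matters: n is fixed before the masses, while lambda_n depends on m.
    Largeness of lambda_n is asked only at m = |omega|; continuity in m carries s >= 1 to the masses
    near |omega|, which is where the blow-up produces the m_N. *)

Definition hasder f x (d : R) : Prop := is_derive x (1 : R) f d.

Lemma hasder_eq f x d d' : hasder f x d -> d = d' -> hasder f x d'.
Proof. by move=> h <-. Qed.

Lemma hasder_cst (c : R) x : hasder (fun=> c) x 0.
Proof. exact: is_derive_cst. Qed.

Lemma hasder_id x : hasder (fun y => y) x 1.
Proof. exact: is_derive_id. Qed.

Lemma hasderD f g x d d' : hasder f x d -> hasder g x d' ->
  hasder (fun y => f y + g y) x (d + d').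
Proof. exact: is_deriveD. Qed.

Lemma hasderN f x d : hasder f x d -> hasder (fun y => - f y) x (- d).
Proof. exact: is_deriveN. Qed.

Lemma hasderM f g x d d' : hasder f x d -> hasder g x d' ->
  hasder (fun y => f y * g y) x (d * g x + f x * d').
Proof.
move=> hf hg; have this := @is_deriveM _ _ f g x 1 d d' hf hg.
by apply: (@hasder_eq (fun y => f y * g y) _ _ _ this); rewrite /GRing.scale /= addrC (mulrC d).
Qed.

Lemma hasderV f x d : hasder f x d -> f x != 0 ->
  hasder (fun y => (f y)^-1) x (- d / f x ^+ 2).
Proof.
move=> hf f0; have this := @is_deriveV _ f x d 1 f0 hf.
by apply: (@hasder_eq (fun y => (f y)^-1) _ _ _ this); rewrite /GRing.scale /= mulrC mulrN mulNr.
Qed.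

Lemma hasder_comp f g x d d' : hasder f (g x) d -> hasder g x d' ->
  hasder (fun y => f (g y)) x (d * d').
Proof. by move=> hf hg; have := @is_derive1_comp _ f g x d d' hf hg. Qed.

Lemma hasder_expR x : hasder (@expR R) x (expR x).
Proof. exact: is_derive_expR. Qed.

Lemma hasderX f x d n : hasder f x d ->
  hasder (fun y => f y ^+ n) x (n%:R * f x ^+ n.-1 * d).
Proof.
move=> hf; elim: n => [|n IH].
  by under eq_fun do rewrite expr0; apply: hasder_eq (hasder_cst _ _) _; rewrite !mul0r.
under eq_fun do rewrite exprS.
apply: (hasder_eq (hasderM hf IH)).
case: n IH => [|n] _ /=; first by rewrite !expr0 !mul0r !mulr0 addr0 mulr1 !mul1r.
by rewrite mulrS exprS; ring.
Qed.

Lemma hasder_derive f x d : hasder f x d -> derivable f x 1 /\ f^`()%classic x = d.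
Proof. by case=> h1 h2; split => //; rewrite derive1E. Qed.

Lemma derivable_hasder f x : derivable f x 1 -> hasder f x (f^`()%classic x).
Proof. by move=> h; apply: DeriveDef => //; rewrite derive1E. Qed.

Lemma hasder_uniq f x d d' : hasder f x d -> hasder f x d' -> d = d'.
Proof. by move=> /hasder_derive[_ <-] /hasder_derive[_ <-]. Qed.

Lemma hasder_continuous f x d : hasder f x d -> {for x, continuous f}.
Proof. by case=> h _; apply: differentiable_continuous; apply/derivable1_diffP. Qed.

Lemma hasder_near f g x d : {near x, f =1 g} -> hasder f x d -> hasder g x d.
Proof.
move=> fg [h1 h2]; apply: DeriveDef.
  exact: near_eq_derivable fg h1.
by rewrite -h2; apply: near_eq_derive; near=> y; apply/esym; near: y; exact: fg.
Unshelve. all: end_near. Qed.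

(** Serves at the flat point of the cutoff functions, where only a quadratic estimate of the
    remainder is at hand. *)
Lemma hasder_quad f x d (K : R) :
  (forall h, `|f (x + h) - f x - d * h| <= K * h ^+ 2) -> hasder f x d.
Proof.
move=> hK; have K0 : 0 <= K.
  by have := le_trans (normr_ge0 _) (hK 1); rewrite expr1n mulr1.
have c : h^-1 *: ((f \o shift x) (h *: 1) - f x) @[h --> 0^'] --> d.
  apply/cvgrPdist_le => e e0; near=> h.
  have h0 : h != 0 by near: h; exact: nbhs_dnbhs_neq.
  rewrite /= /GRing.scale /= mulr1 [h + x]addrC.
  have -> : d - h^-1 * (f (x + h) - f x) = - (h^-1 * (f (x + h) - f x - d * h)).
    by field.
  rewrite normrN normrM normfV ler_pdivrMl ?normr_gt0 //.
  apply: le_trans (hK h) _; rewrite expr2.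
  have : `|h| <= e / (K + 1).
    near: h; apply: dnbhs0_le; rewrite divr_gt0 // ltr_wpDl //.
  rewrite ler_pdivlMr ?ltr_wpDl // => h1.
  have -> : h * h = `|h| * `|h| by rewrite -normrM ger0_norm // -expr2 sqr_ge0.
  rewrite mulrCA ler_wpM2l // mulrC; apply: le_trans h1.
  by rewrite ler_wpM2l // lerDl.
apply: DeriveDef; first by apply/cvg_ex; exists d.
exact: cvg_lim c.
Unshelve. all: end_near. Qed.

Lemma hasder_within_continuous f (df : R -> R) a b :
  (forall x, a <= x <= b -> hasder f x (df x)) -> {within `[a, b], continuous f}.
Proof.
move=> h; apply: continuous_in_subspaceT => x; rewrite inE /= in_itv /= => xab.
exact: hasder_continuous (h _ xab).
Qed.

Lemma hasder_MVT f (df : R -> R) a b : a <= b ->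
  (forall x, a <= x <= b -> hasder f x (df x)) ->
  exists2 c, a <= c <= b & f b - f a = df c * (b - a).
Proof.
move=> ab h; case: (@MVT_segment R f df a b ab).
- by move=> x; rewrite in_itv /= => /andP[x1 x2]; apply: h; rewrite !ltW.
- exact: hasder_within_continuous h.
- by move=> c; rewrite in_itv /= => cab e; exists c.
Qed.

Lemma hasder_ge0_le f (df : R -> R) a b : a <= b ->
  (forall x, a <= x <= b -> hasder f x (df x)) ->
  (forall x, a <= x <= b -> 0 <= df x) -> f a <= f b.
Proof.
move=> ab h h0; case: (hasder_MVT ab h) => c cab e.
by rewrite -subr_ge0 e mulr_ge0 ?h0 // subr_ge0.
Qed.

Lemma hasder_gt0_lt f (df : R -> R) a b : a < b ->
  (forall x, a <= x <= b -> hasder f x (df x)) ->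
  (forall x, a <= x <= b -> 0 < df x) -> f a < f b.
Proof.
move=> ab h h0; case: (hasder_MVT (ltW ab) h) => c cab e.
by rewrite -subr_gt0 e mulr_gt0 ?h0 // subr_gt0.
Qed.

End Calculus.

(** * Smoothness classes and a smooth step function *)

Section Smooth.
Variable R : realType.
Implicit Types (f g : R -> R) (x : R) (n : nat).

(** The recursion takes the derivative of the function itself, so that closure under products,
    inverses and affine substitution is a plain induction on the order, with [hasder] supplying each
    derivative. *)
Fixpoint Ck n f : Prop :=
  if n is n'.+1 then (forall x, derivable f x 1) /\ Ck n' (f^`()%classic) else True.

Lemma smoothP f : smooth f <-> forall n, Ck n f.
Proof.
split.
  move=> + n; elim: n f => [//|n IH] f sf /=; split; first by move=> x; exact: (sf 0%N x).
  by apply: IH => k x; have := sf k.+1 x; rewrite derive1Sn.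
move=> h n x; elim: n f h => [|n IH] f h; first by have [] := h 1%N.
rewrite derive1Sn; apply: IH => k; by have [] := h k.+1.
Qed.

Lemma CkS n f : Ck n.+1 f -> Ck n f.
Proof. by elim: n f => [//|n IH] f [h1 h2]; split => //; exact: IH. Qed.

Lemma Ck_hasder n f (df : R -> R) : (forall x, hasder f x (df x)) -> Ck n df -> Ck n.+1 f.
Proof.
move=> h c; split; first by move=> x; have [] := hasder_derive (h x).
suff -> : f^`()%classic = df by [].
by apply/funext => x; have [] := hasder_derive (h x).
Qed.

Lemma Ck_derivE n f : Ck n.+1 f -> exists df : R -> R, (forall x, hasder f x (df x)) /\ Ck n df.
Proof. by case=> h1 h2; exists (f^`()%classic); split=> // x; exact: derivable_hasder. Qed.

Lemma Ck_cst n (c : R) : Ck n (fun=> c).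
Proof.
elim: n c => [//|n IH] c; apply: (@Ck_hasder n _ (fun=> 0)) => //.
by move=> x; exact: hasder_cst.
Qed.

Lemma CkD n f g : Ck n f -> Ck n g -> Ck n (fun x => f x + g x).
Proof.
elim: n f g => [//|n IH] f g /Ck_derivE[df [hf cf]] /Ck_derivE[dg [hg cg]].
apply: (@Ck_hasder n _ (fun x => df x + dg x)); last exact: IH.
by move=> x; exact: hasderD.
Qed.

Lemma CkM n f g : Ck n f -> Ck n g -> Ck n (fun x => f x * g x).
Proof.
elim: n f g => [//|n IH] f g cf cg.
have [df [hf c1]] := Ck_derivE cf; have [dg [hg c2]] := Ck_derivE cg.
apply: (@Ck_hasder n _ (fun x => df x * g x + f x * dg x)).
  by move=> x; exact: hasderM.
by apply: CkD; apply: IH => //; exact: CkS.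
Qed.

Lemma CkN n f : Ck n f -> Ck n (fun x => - f x).
Proof.
move=> /(CkM (Ck_cst n (-1))).
by congr (Ck n _); apply/funext => x; rewrite mulN1r.
Qed.

Lemma CkB n f g : Ck n f -> Ck n g -> Ck n (fun x => f x - g x).
Proof. by move=> cf cg; apply: CkD => //; exact: CkN. Qed.

Lemma CkV n f : (forall x, f x != 0) -> Ck n f -> Ck n (fun x => (f x)^-1).
Proof.
move=> f0; elim: n => [//|n IH] cf; have [df [hf c1]] := Ck_derivE cf.
apply: (@Ck_hasder n _ (fun x => - df x * ((f x)^-1 * (f x)^-1))).
  by move=> x; rewrite -invfM -expr2; exact: hasderV.
by apply: CkM; [exact: CkN|apply: CkM; apply: IH; exact: CkS].
Qed.

Lemma Ck_aff n f (a b : R) : Ck n f -> Ck n (fun x => f (a * x + b)).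
Proof.
elim: n f => [//|n IH] f /Ck_derivE[df [hf cf]].
apply: (@Ck_hasder n _ (fun x => df (a * x + b) * a)); last first.
  by apply: CkM; [exact: IH|exact: Ck_cst].
move=> x; apply: (@hasder_comp _ _ (fun y => a * y + b)); first exact: hf.
apply: hasder_eq (hasderD (hasderM (hasder_cst a x) (hasder_id x)) (hasder_cst b x)) _.
by rewrite mul0r add0r addr0 mulr1.
Qed.

(** Differentiating exp(-1/x) x^(-k) gives a combination of members with larger [k]; the family is
    stable under derivation and one induction makes all its members smooth. *)
Definition flat (k : nat) x : R := if 0 < x then expR (- x^-1) * x^-1 ^+ k else 0.

(** The term of order [k + 2] in the series of exp(1/x) already beats x^(-k) by two powers of x,
    which is what differentiability at 0 needs. *)
Lemma flat_bound k x : 0 < x -> `|flat k x| <= (k.+2)`!%:R * x ^+ 2.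
Proof.
move=> x0; rewrite /flat x0 ger0_norm; last first.
  by rewrite mulr_ge0 ?expR_ge0 // exprn_ge0 // invr_ge0 ltW.
have h : x^-1 ^+ k.+2 / (k.+2)`!%:R <= expR x^-1.
  have := @expR_ge1Dxn R x^-1 k.+1; rewrite invr_ge0 ltW // => /(_ isT).
  by apply: le_trans; rewrite lerDr.
rewrite ler_pdivrMr ?ltr0n ?fact_gt0 // in h.
have -> : x^-1 ^+ k = x^-1 ^+ k.+2 * x ^+ 2.
  by rewrite -addn2 exprD -mulrA -exprMn mulVf ?gt_eqF // expr1n mulr1.
rewrite expRN mulrA ler_wpM2r ?exprn_ge0 ?(ltW x0) // mulrC ler_pdivrMr ?expR_gt0 //.
by rewrite mulrC.
Qed.

Lemma hasder_flat k x : hasder (flat k) x (flat k.+2 x - k%:R * flat k.+1 x).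
Proof.
case: (ltgtP x 0) => x0.
- have -> : flat k.+2 x - k%:R * flat k.+1 x = 0.
    by rewrite /flat !(lt_gtF x0) mulr0 subr0.
  apply: (@hasder_near _ (fun=> 0)); last exact: hasder_cst.
  near=> y; rewrite /flat lt_gtF //; near: y; exact: lt_nbhsl.
- apply: (@hasder_near _ (fun y => expR (- y^-1) * y^-1 ^+ k)).
    near=> y; rewrite /flat ifT //; near: y; exact: lt_nbhsr.
  have xn : x != 0 by rewrite gt_eqF.
  have dV := hasderV (hasder_id x) xn.
  apply: hasder_eq (hasderM (@hasder_comp _ expR (fun y => - y^-1) _ _ _ (hasder_expR _) (hasderN dV)) (hasderX k dV)) _.
  rewrite /flat x0 -!exprVn; case: k => [|k] /=; last by rewrite !exprS; ring.
  by rewrite !exprS !expr0; ring.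
- rewrite x0 /flat ltxx mulr0 subr0.
  apply: (@hasder_quad _ _ _ _ (k.+2)`!%:R) => h.
  rewrite add0r mul0r subr0 ltxx subr0 -/(flat k h).
  have [h0|h0] := ltP 0 h; first exact: flat_bound.
  by rewrite /flat ltNge h0 /= normr0 mulr_ge0 // sqr_ge0.
Unshelve. all: end_near. Qed.

Lemma Ck_flat n k : Ck n (flat k).
Proof.
elim: n k => [//|n IH] k; apply: Ck_hasder (hasder_flat k) _.
by apply: CkB => //; apply: CkM => //; exact: Ck_cst.
Qed.

Lemma flat_ge0 k x : 0 <= flat k x.
Proof.
rewrite /flat; case: ifPn => // x0.
by rewrite mulr_ge0 ?expR_ge0 // exprn_ge0 // invr_ge0 ltW.
Qed.

Lemma flat0_gt0 x : 0 < x -> 0 < flat 0 x.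
Proof. by move=> x0; rewrite /flat x0 expr0 mulr1 expR_gt0. Qed.

Lemma flat0_le0 x : x <= 0 -> flat 0 x = 0.
Proof. by rewrite /flat ltNge => ->. Qed.

(** The denominator is positive because [x] and [1 - x] are never both nonpositive; the quotient
    rises from 0 to 1 across [0, 1]. *)
Definition step x : R := flat 0 x / (flat 0 x + flat 0 (1 - x)).

Lemma step_den x : 0 < flat 0 x + flat 0 (1 - x).
Proof.
have [x0|x0] := ltP 0 x; first by rewrite ltr_pwDl ?flat0_gt0 ?flat_ge0.
by rewrite ltr_wpDl ?flat_ge0 // flat0_gt0 // subr_gt0 (le_lt_trans x0).
Qed.

Lemma Ck_step n : Ck n step.
Proof.
apply: CkM; first exact: Ck_flat.
apply: CkV => [x|]; first by rewrite gt_eqF // step_den.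
apply: CkD; first exact: Ck_flat.
have -> : (fun x : R => flat 0 (1 - x)) = (fun x => flat 0 (-1 * x + 1)).
  by apply/funext => x; congr flat; ring.
by apply: Ck_aff; exact: Ck_flat.
Qed.

Lemma step_le0 x : x <= 0 -> step x = 0.
Proof. by move=> x0; rewrite /step flat0_le0 // mul0r. Qed.

Lemma step_ge1 x : 1 <= x -> step x = 1.
Proof.
move=> x1; rewrite /step [flat 0 (1 - x)]flat0_le0 ?subr_le0 // addr0 divff //.
by rewrite gt_eqF // flat0_gt0 // (lt_le_trans ltr01).
Qed.

Lemma step_ge0 x : 0 <= step x.
Proof. by rewrite mulr_ge0 ?flat_ge0 // invr_ge0 ltW // step_den. Qed.

Lemma step_le1 x : step x <= 1.
Proof. by rewrite /step ler_pdivrMr ?step_den // mul1r lerDl flat_ge0. Qed.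

End Smooth.

(** * Real-valued integrals *)

Section RealIntegration.
Variable R : realType.
Notation mu := (@lebesgue_measure R).
Implicit Types (D E : set R) (f g h : R -> R) (a b c : R).

Definition rint D f : Prop := mu.-integrable D (EFin \o f).

Lemma rint_measurable D f : rint D f -> measurable_fun D f.
Proof. by move=> /measurable_int /measurable_EFinP. Qed.

Lemma rint_le D f g : measurable D -> measurable_fun D f ->
  (forall x, D x -> `|f x| <= g x) -> rint D g -> rint D f.
Proof.
move=> mD mf h; apply: le_integrable => //; first exact/measurable_EFinP.
by move=> x Dx; rewrite /= lee_fin; apply: le_trans (h _ Dx) (ler_norm _).
Qed.

Lemma rint_ext D f g : measurable D -> (forall x, D x -> f x = g x) -> rint D f -> rint D g.
Proof.
by move=> mD h; apply: eq_integrable => // x; rewrite inE => Dx /=; rewrite h.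
Qed.

Lemma rintS D E f : measurable D -> measurable E -> E `<=` D -> rint D f -> rint E f.
Proof. by move=> mD mE h; exact: integrableS. Qed.

Lemma rintD D f g : measurable D -> rint D f -> rint D g -> rint D (fun x => f x + g x).
Proof. by move=> mD hf hg; exact: (@integrableD _ _ R mu D mD _ _ hf hg). Qed.

Lemma rintN D f : measurable D -> rint D f -> rint D (fun x => - f x).
Proof. by move=> mD hf; apply: (@eq_integrable _ _ R mu D mD _ _ _ (@integrableN _ _ R mu D _ hf)) => x _ /=; rewrite EFinN. Qed.

Lemma rintB D f g : measurable D -> rint D f -> rint D g -> rint D (fun x => f x - g x).
Proof. by move=> mD hf hg; apply: rintD => //; exact: rintN. Qed.

Lemma rintZ D (k : R) f : measurable D -> rint D f -> rint D (fun x => k * f x).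
Proof. by move=> mD hf; apply: (@eq_integrable _ _ R mu D mD _ _ _ (@integrableZl _ _ R mu D mD k _ hf)) => x _ /=; rewrite EFinM. Qed.

Lemma rint0 D : rint D (fun=> 0).
Proof. exact: integrable0. Qed.

Lemma rint_sum D (I : Type) (s : seq I) (F : I -> R -> R) : measurable D ->
  (forall i, rint D (F i)) -> rint D (fun x => \sum_(i <- s) F i x).
Proof.
move=> mD h; elim: s => [|i s IH].
  by apply: (rint_ext mD) (rint0 D) => x _; rewrite big_nil.
by apply: (rint_ext mD) (rintD mD (h i) IH) => x _; rewrite big_cons.
Qed.

Lemma rint_norm D f : measurable D -> rint D f -> rint D (fun x => `|f x|).
Proof. by move=> mD h; exact: integrable_norm. Qed.

Lemma rint_bounded D f h (K : R) : measurable D -> measurable_fun D h ->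
  (forall x, D x -> `|h x| <= K) -> rint D f -> rint D (fun x => h x * f x).
Proof.
move=> mD mh hK fi.
apply: (@rint_le _ _ (fun x => K * `|f x|)) => //.
- by apply: measurable_funM => //; exact: rint_measurable.
- by move=> x Dx; rewrite normrM ler_wpM2r // hK.
- by apply: rintZ => //; exact: rint_norm.
Qed.

Lemma rint_cst D (k : R) : measurable D -> (mu D < +oo)%E -> rint D (fun=> k).
Proof.
move=> mD Dfin; apply: measurable_bounded_integrable => //.
by exists `|k|; split=> // ? h ? ?; exact: ltW.
Qed.

Lemma sq_prod_le (x y : R) : `|x * y| <= x ^+ 2 + y ^+ 2.
Proof. by rewrite ler_norml; apply/andP; split; nra. Qed.

Lemma rint_mul D f g : measurable D -> measurable_fun D f -> measurable_fun D g ->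
  rint D (fun x => f x ^+ 2) -> rint D (fun x => g x ^+ 2) -> rint D (fun x => f x * g x).
Proof.
move=> mD mf mg f2 g2; apply: (@rint_le _ _ (fun x => f x ^+ 2 + g x ^+ 2)) => //.
- exact: measurable_funM.
- by move=> x _; exact: sq_prod_le.
- exact: rintD.
Qed.

Lemma rint_L1loc D f : measurable D -> (mu D < +oo)%E -> measurable_fun D f ->
  rint D (fun x => f x ^+ 2) -> rint D f.
Proof.
move=> mD Dfin mf f2; apply: (@rint_le _ _ (fun x => 1 + f x ^+ 2)) => //.
  by move=> x _; rewrite ler_norml; apply/andP; split; nra.
by apply: rintD => //; exact: rint_cst.
Qed.

Lemma itv_fin a b : (mu `[a, b] < +oo)%E.
Proof. by rewrite lebesgue_measure_itv /=; case: ifP => // _; rewrite -EFinB ltry. Qed.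

Lemma rint_cont a b f : {within `[a, b], continuous f} -> rint `[a, b] f.
Proof.
by move=> cf; apply: continuous_compact_integrable => //; exact: segment_compact.
Qed.

Lemma rint_contf a b f : (forall x, a <= x <= b -> {for x, continuous f}) -> rint `[a, b] f.
Proof.
move=> cf; apply: rint_cont; apply: continuous_in_subspaceT => x.
by rewrite inE /= in_itv /=; exact: cf.
Qed.

Definition RI D f : R := \int[mu]_(x in D) f x.

Lemma RI_ext D f g : (forall x, D x -> f x = g x) -> RI D f = RI D g.
Proof. by move=> h; apply: eq_Rintegral => x; rewrite inE; exact: h. Qed.

Lemma RID D f g : measurable D -> rint D f -> rint D g ->
  RI D (fun x => f x + g x) = RI D f + RI D g.
Proof. by move=> mD hf hg; exact: (@RintegralD _ _ R mu D f g mD hf hg). Qed.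

Lemma RIB D f g : measurable D -> rint D f -> rint D g ->
  RI D (fun x => f x - g x) = RI D f - RI D g.
Proof. by move=> mD hf hg; exact: (@RintegralB _ _ R mu D f g mD hf hg). Qed.

Lemma RIZ D (k : R) f : measurable D -> rint D f -> RI D (fun x => k * f x) = k * RI D f.
Proof. by move=> mD h; exact: (@RintegralZl _ _ R mu D f k mD h). Qed.

Lemma RI0 D : RI D (fun=> 0) = 0.
Proof. by rewrite /RI /Rintegral integral0. Qed.

Lemma RIN D f : measurable D -> rint D f -> RI D (fun x => - f x) = - RI D f.
Proof.
move=> mD h; rewrite -mulN1r -RIZ //; apply: RI_ext => x _; by rewrite mulN1r.
Qed.

Lemma RI_sum D (I : Type) (s : seq I) (F : I -> R -> R) : measurable D ->
  (forall i, rint D (F i)) -> RI D (fun x => \sum_(i <- s) F i x) = \sum_(i <- s) RI D (F i).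
Proof.
move=> mD h; elim: s => [|i s IH].
  by rewrite big_nil -[RHS](RI0 D); apply: RI_ext => x _; rewrite big_nil.
rewrite big_cons -IH -RID //; last exact: rint_sum.
by apply: RI_ext => x _; rewrite big_cons.
Qed.

Lemma RI_le D f g : measurable D -> rint D f -> rint D g ->
  (forall x, D x -> f x <= g x) -> RI D f <= RI D g.
Proof. by move=> mD hf hg h; exact: (@le_Rintegral _ _ R mu D f g mD hf hg h). Qed.

Lemma RI_ge0 D f : (forall x, D x -> 0 <= f x) -> 0 <= RI D f.
Proof. by move=> h; exact: Rintegral_ge0. Qed.

Lemma RI_norm D f : measurable D -> rint D f -> `|RI D f| <= RI D (fun x => `|f x|).
Proof. by move=> mD hf; exact: (@le_normr_Rintegral _ _ R mu D f mD hf). Qed.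

Lemma RI_norm_le D f g : measurable D -> rint D f -> rint D g ->
  (forall x, D x -> `|f x| <= g x) -> `|RI D f| <= RI D g.
Proof.
move=> mD fi gi h; apply: le_trans (RI_norm mD fi) _.
by apply: RI_le => //; exact: rint_norm.
Qed.

Lemma RI_cst a b (k : R) : a <= b -> RI `[a, b] (fun=> k) = k * (b - a).
Proof.
move=> ab; rewrite /RI Rintegral_cst //.
have -> : fine (mu `[a, b]%classic) = (if (a%:E < b%:E)%E then b - a else 0).
  by rewrite lebesgue_measure_itv /=; case: ifP.
case: ifPn => //=; rewrite lte_fin -leNgt => ba.
have -> : b = a by apply/eqP; rewrite eq_le ab ba.
by rewrite subrr mulr0.
Qed.

Lemma RI_sub D E f : measurable D -> measurable E -> E `<=` D ->
  (forall x, D x -> ~ E x -> f x = 0) -> RI D f = RI E f.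
Proof.
move=> mD mE ED h; have -> : RI E f = RI (D `&` E) f by rewrite setIidr.
rewrite /RI Rintegral_mkcondr; apply: RI_ext => x Dx.
by rewrite patchE; case: ifPn => //; rewrite notin_setE => /h ->.
Qed.

Lemma RI_mono D E f : measurable D -> measurable E -> E `<=` D -> rint D f ->
  (forall x, D x -> 0 <= f x) -> RI E f <= RI D f.
Proof.
move=> mD mE ED fi f0; have -> : RI E f = RI (D `&` E) f by rewrite setIidr.
rewrite /RI Rintegral_mkcondr; apply: RI_le => //.
  have : mu.-integrable D ((EFin \o f) \_ E).
    by apply/(integrable_restrict mu mE mD); rewrite setIidr //; exact: (rintS mD mE ED fi).
  by rewrite restrict_EFin.
by move=> x Dx; rewrite patchE; case: ifPn => // _; exact: f0.
Qed.

Lemma RI_itv_split a b c f : a <= b -> b <= c -> rint `[a, c] f ->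
  RI `[a, c] f = RI `[a, b] f + RI `[b, c] f.
Proof.
move=> ab bc fi; have := @Rintegral_itvB R f (BLeft a) (BRight c) b fi.
rewrite !bnd_simp => /(_ ab bc) h.
rewrite /RI -(@Rintegral_itv_obnd_cbnd R b (BRight c) f).
  by rewrite -h addrC subrK.
by apply: rintS fi => // x /=; rewrite !in_itv /= => /andP[h1 ->]; rewrite (le_trans ab (ltW h1)).
Qed.

Lemma RI_FTC f F a b : a <= b ->
  (forall x, a <= x <= b -> hasder F x (f x)) -> (forall x, a <= x <= b -> {for x, continuous f}) ->
  RI `[a, b] f = F b - F a.
Proof.
move=> + dF cf; rewrite le_eqVlt => /orP[/eqP <-|ab].
  by rewrite /RI set_itv1 Rintegral_set1 subrr.
have h x : a <= x <= b -> {for x, continuous F} by move=> /dF; exact: hasder_continuous.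
rewrite /RI /Rintegral (@continuous_FTC2 R f F a b ab) //.
- by apply: continuous_in_subspaceT => x; rewrite inE /= in_itv /=; exact: cf.
- split.
  + by move=> x; rewrite in_itv /= => /andP[x1 x2]; have [] := hasder_derive (dF x _); rewrite ?ltW.
  + by apply: cvg_at_right_filter; apply: h; rewrite lexx ltW.
  + by apply: cvg_at_left_filter; apply: h; rewrite lexx ltW.
- move=> x; rewrite in_itv /= => /andP[x1 x2].
  by have [] := hasder_derive (dF x _); rewrite ?ltW.
Qed.

End RealIntegration.

(** * Weak derivatives *)

Section WeakDerivative.
Variable R : realType.
Notation mu := (@lebesgue_measure R).
Implicit Types (D : set R) (f y h : R -> R) (a b e r : R).

Lemma segment_bounded f a b : (forall x, a <= x <= b -> {for x, continuous f}) ->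
  exists2 K, 0 <= K & forall x, a <= x <= b -> `|f x| <= K.
Proof.
move=> cf; have [ba|ab] := ltP b a.
  by exists 0 => // x /andP[x1 x2]; have := lt_le_trans ba (le_trans x1 x2); rewrite ltxx.
have cn : {within `[a, b], continuous (fun x => `|f x|)}.
  apply: continuous_in_subspaceT => x; rewrite inE /= in_itv /= => xab.
  by apply: cvg_norm; exact: cf.
have [c _ hc] := EVT_max ab cn.
by exists `|f c| => // x xab; apply: hc; rewrite in_itv.
Qed.

Definition testfn D f : Prop := smooth f /\
  exists K : set R, [/\ compact K, K `<=` D & forall x, ~ K x -> f x = 0].

Lemma testfn_hasder D f : testfn D f -> exists df : R -> R,
  [/\ forall x, hasder f x (df x), continuous df, smooth df & testfn D df].
Proof.
case=> sf [K [cK KD f0]]; exists (f^`()%classic).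
have d1 x : hasder f x (f^`()%classic x) by apply: derivable_hasder; exact: (sf 0%N x).
have sd : smooth (f^`()%classic).
  by move=> n x; have := sf n.+1 x; rewrite derive1Sn.
split=> //.
  by move=> x; have := derivable_hasder (sd 0%N x); rewrite derive1n0; exact: hasder_continuous.
split=> //; exists K; split=> // x nK.
have : hasder f x 0; last exact: hasder_uniq.
apply: (@hasder_near _ (fun=> 0)); last exact: hasder_cst.
have oK : open (~` K) by apply: closed_openC; apply: compact_closed => //; exact: Rhausdorff.
near=> z; rewrite f0 //; near: z; exact: open_nbhs_nbhs.
Unshelve. all: end_near. Qed.

(** The derivative of [step] is a bounded kernel of mass one on [0, 1]; rescaled, it is the
    one-sided mollifier used below. *)
Lemma dstep_ex : exists dstep : R -> R, exists K : R,
  [/\ 0 <= K, forall x, hasder (@step R) x (dstep x), continuous dstep,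
     forall x, `|dstep x| <= K & forall x, ~~ (0 <= x <= 1) -> dstep x = 0].
Proof.
pose d := (@step R)^`()%classic.
have c2 : Ck 2 (@step R) by exact: Ck_step.
have dd x : hasder (@step R) x (d x) by apply: derivable_hasder; case: c2.
have cd : continuous d.
  by move=> x; case: c2 => _ [h _]; have := derivable_hasder (h x); exact: hasder_continuous.
have d0 x : ~~ (0 <= x <= 1) -> d x = 0.
  rewrite negb_and -!ltNge => /orP[x0|x1].
    have : hasder (@step R) x 0; last exact: hasder_uniq.
    apply: (@hasder_near _ (fun=> 0)); last exact: hasder_cst.
    near=> z; rewrite step_le0 //; near: z; exact: lt_le_nbhsl.
  have : hasder (@step R) x 0; last exact: hasder_uniq.
  apply: (@hasder_near _ (fun=> 1)); last exact: hasder_cst.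
  near=> z; rewrite step_ge1 //; near: z; exact: lt_le_nbhsr.
have [K K0 hK] := @segment_bounded d 0 1 (fun x _ => cd x).
exists d, K; split=> // x; have [/hK //|/d0 ->] := boolP (0 <= x <= 1).
by rewrite normr0.
Unshelve. all: end_near. Qed.

(** The mean over [a, a + r] is dominated by the average over the ball of radius [2 * r], which has
    measure [4 * r]; hence the [e / 4]. *)
Lemma lebesgue_pt_right f a e : locally_integrable setT f -> lebesgue_pt f a -> 0 < e ->
  exists2 d, 0 < d & forall r, 0 < r < d -> RI `[a, a + r] (fun x => `|f x - f a|) <= e * r.
Proof.
move=> lf la e0; have e40 : 0 < e / 4 by rewrite divr_gt0.
have h : \forall r \near (0:R)^'+, (davg f a r < (e / 4)%:E)%E.
  have := la; rewrite /lebesgue_pt => /fine_cvgP[hfin hc].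
  have := hc; move/cvgrPdist_lt => /(_ _ e40) hd.
  near=> r; have fr : davg f a r \is a fin_num by near: r.
  rewrite -(fineK fr) lte_fin; apply: le_lt_trans (ler_norm _) _.
  by have : `|0 - fine (davg f a r)| < e / 4 by [near: r]; rewrite sub0r normrN.
move: h; rewrite near_withinE => /nbhs_ballP[d d0 hd].
exists (d / 2); first by rewrite divr_gt0.
move=> r /andP[r0 rd]; have r20 : 0 < 2 * r by rewrite mulr_gt0.
have := hd (2 * r); rewrite /ball /= sub0r normrN gtr0_norm // => /(_ _ r20).
have rd2 : 2 * r < d by rewrite mulrC -ltr_pdivlMr.
move=> /(_ rd2).
rewrite /davg /iavg lebesgue_measure_ball; last exact: ltW.
have fball : rint (ball a (2 * r)) (fun x => f x - f a).
  have sub : ball a (2 * r) `<=` `[a - 2 * r, a + 2 * r]%classic.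
    move=> x; rewrite ball_itv /= !in_itv /= => /andP[x1 x2]; by rewrite !ltW.
  apply: (@rintS _ `[a - 2 * r, a + 2 * r]%classic) => //; first exact: measurable_ball.
  apply: rintB => //; last by apply: rint_cst => //; exact: itv_fin.
  case: lf => mf _ /(_ `[a - 2 * r, a + 2 * r]%classic) hh.
  apply/integrableP; split; last by apply: hh => //; exact: segment_compact.
  by apply/measurable_EFinP; exact: measurable_funS mf.
rewrite [X in (_ * X)%E](_ : _ = (RI (ball a (2 * r)) (fun x => `|f x - f a|))%:E); last first.
  rewrite /RI /Rintegral fineK //.
  exact: (@integrable_fin_num _ _ R mu _ (measurable_ball _ _) _ (rint_norm (measurable_ball _ _) fball)).
rewrite inver mulrn_eq0 /= gt_eqF //= -EFinM lte_fin.
rewrite mulrC ltr_pdivrMr ?mulrn_wgt0 // => hlt.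
have mb : measurable (ball a (2 * r)) by exact: measurable_ball.
apply: le_trans (_ : RI (ball a (2 * r)) (fun x => `|f x - f a|) <= _); last first.
  apply: le_trans (ltW hlt) _; rewrite -mulr_natr; lra.
apply: RI_mono => //; last exact: rint_norm.
move=> x; rewrite ball_itv /= !in_itv /= => /andP[x1 x2]; apply/andP; split; lra.
Unshelve. all: end_near. Qed.

Lemma RI_small f a b e : a < b -> rint `[a, b] f -> 0 < e ->
  exists2 d, 0 < d & forall r, 0 < r < d -> RI `[a, a + r] (fun x => `|f x|) < e.
Proof.
move=> ab fi e0.
have := parameterized_integral_near_left ab e0 (rint_norm (measurable_itv _) fi).
move=> /nbhs_ballP[d d0 hd]; exists d => // r /andP[r0 rd].
have := hd (a + r); rewrite /ball /= opprD addNKr normrN gtr0_norm // lerDl (ltW r0).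
move=> /(_ rd isT); apply: le_lt_trans; rewrite /parameterized_integral.
exact: ler_norm.
Qed.

Section Kernel.
Variables (dstep : R -> R) (K : R).
Hypotheses (K0 : 0 <= K) (hd : forall x, hasder (@step R) x (dstep x))
  (cd : continuous dstep) (dK : forall x, `|dstep x| <= K)
  (d0 : forall x, ~~ (0 <= x <= 1) -> dstep x = 0).

Lemma kernel_hasder a (e : R) x : hasder (fun x => step (e^-1 * (x - a))) x
  (e^-1 * dstep (e^-1 * (x - a))).
Proof.
apply: hasder_eq (@hasder_comp _ _ (fun x => e^-1 * (x - a)) x _ _ (hd _) _) _; last exact: mulrC.
apply: hasder_eq (hasderM (hasder_cst _ _) (hasderD (hasder_id _) (hasder_cst _ _))) _.
by rewrite mul0r add0r addr0 mulr1.
Qed.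

Lemma kernel_continuous a (e : R) : continuous (fun x => e^-1 * dstep (e^-1 * (x - a))).
Proof.
move=> x; apply: cvgM; first exact: cvg_cst.
apply: (@continuous_comp _ _ _ (fun x => e^-1 * (x - a)) dstep); last exact: cd.
by apply: cvgM; [exact: cvg_cst|apply: cvgB; [exact: cvg_id|exact: cvg_cst]].
Qed.

(** The kernel has integral one, so the difference is a weighted integral of [f x - f a] with weight
    at most [K / r]. *)
Lemma kernel_mean f a r e : 0 < r -> 0 <= e -> rint `[a, a + r] f ->
  RI `[a, a + r] (fun x => `|f x - f a|) <= e * r ->
  `|RI `[a, a + r] (fun x => r^-1 * dstep (r^-1 * (x - a)) * f x) - f a| <= K * e.
Proof.
move=> r0 e0 fi hr.
have m : measurable `[a, a + r]%classic by [].
have bk x : `|r^-1 * dstep (r^-1 * (x - a))| <= r^-1 * K.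
  by rewrite normrM gtr0_norm ?invr_gt0 // ler_pM2l ?invr_gt0.
have mk : measurable_fun `[a, a + r]%classic (fun x => r^-1 * dstep (r^-1 * (x - a))).
  by apply: measurable_funTS; apply: continuous_measurable_fun; exact: kernel_continuous.
have i1 : RI `[a, a + r] (fun x => r^-1 * dstep (r^-1 * (x - a))) = 1.
  rewrite (@RI_FTC _ _ (fun x => step (r^-1 * (x - a)))).
  - by rewrite addrAC subrr add0r mulVf ?gt_eqF // mulr0 step_ge1 // step_le0 // subr0.
  - by rewrite lerDl ltW.
  - by move=> x _; exact: kernel_hasder.
  - by move=> x _; exact: kernel_continuous.
have ki : rint `[a, a + r] (fun x => r^-1 * dstep (r^-1 * (x - a))).
  by apply: rint_contf => x _; exact: kernel_continuous.
have fa : rint `[a, a + r] (fun x => f x - f a).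
  by apply: rintB => //; apply: rint_cst => //; exact: itv_fin.
have -> : f a = RI `[a, a + r] (fun x => f a * (r^-1 * dstep (r^-1 * (x - a)))).
  by rewrite RIZ // i1 mulr1.
rewrite -RIB //; last 2 first.
- exact: (rint_bounded m mk (fun x _ => bk x)).
- exact: rintZ.
apply: le_trans (_ : RI `[a, a + r] (fun x => r^-1 * K * `|f x - f a|) <= _); last first.
  rewrite RIZ //; last exact: rint_norm.
  apply: le_trans (ler_wpM2l _ hr) _; first by rewrite mulr_ge0 // invr_ge0 ltW.
  by rewrite le_eqVlt; apply/orP; left; apply/eqP; field; rewrite gt_eqF.
apply: RI_norm_le => //.
- apply: rintB => //; last exact: rintZ.
  exact: (rint_bounded m mk (fun x _ => bk x)).
- by apply: rintZ => //; exact: rint_norm.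
- move=> x _; rewrite [f a * _]mulrC -mulrBr normrM.
  by apply: ler_wpM2r.
Qed.

Lemma kernel_out a r x : 0 < r -> ~ (a <= x <= a + r) -> r^-1 * dstep (r^-1 * (x - a)) = 0.
Proof.
move=> r0 h; rewrite d0 ?mulr0 //; apply/negP => /andP[h1 h2]; apply: h.
rewrite pmulr_rge0 ?invr_gt0 // subr_ge0 in h1.
by rewrite h1 /= -lerBlDl; move: h2; rewrite ler_pdivrMl // mulr1.
Qed.

End Kernel.

Lemma cutoff_testfn D a b r : a <= b -> 0 < r -> `[a, b + r] `<=` D ->
  testfn D (fun x => step (r^-1 * (x - a)) - step (r^-1 * (x - b))).
Proof.
move=> ab r0 sub; split.
  apply/smoothP => n; apply: CkB.
    rewrite (_ : (fun _ => _) = (fun x : R => step (r^-1 * x + - (r^-1 * a)))).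
      by apply: Ck_aff; exact: Ck_step.
    by apply/funext => x; rewrite mulrBr.
  rewrite (_ : (fun _ => _) = (fun x : R => step (r^-1 * x + - (r^-1 * b)))).
    by apply: Ck_aff; exact: Ck_step.
  by apply/funext => x; rewrite mulrBr.
exists `[a, b + r]%classic; split=> //; first exact: segment_compact.
move=> x /= /negP; rewrite in_itv /= negb_and -!ltNge => /orP[xa|xb].
  rewrite !step_le0 ?subrr // pmulr_rle0 ?invr_gt0 // subr_le0; lra.
rewrite !step_ge1 ?subrr // ler_pdivlMl //; lra.
Qed.

(** The test function rises from 0 to 1 on [a, a + r] and falls back to 0 on [b, b + r]. Its
    derivative is a difference of two mollifiers, which reproduce [y a] and [y b] at Lebesgue
    points, while its product with [h] tends to the integral over [a, b] by absolute continuity of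
    the integral. *)
Lemma weak_AC D y h a b :
  open D -> measurable D -> (forall x z, D x -> D z -> `[x, z] `<=` D) ->
  locally_integrable setT (y \_ D) -> (forall x z, D x -> D z -> rint `[x, z] h) ->
  (forall f df, testfn D f -> (forall x, hasder f x (df x)) ->
     RI D (fun x => df x * y x) = - RI D (fun x => f x * h x)) ->
  D a -> D b -> a < b -> lebesgue_pt (y \_ D) a -> lebesgue_pt (y \_ D) b ->
  y b - y a = RI `[a, b] h.
Proof.
move=> oD mD iD ly hi wk Da Db ab la lb.
have [dstep [K [K0 hd cd dK d0]]] := dstep_ex.
(* Each of the two mollified values costs [K * e], each of the two flanks of the cutoff costs
   [e]. *)
suff main e : 0 < e -> `|y b - y a - RI `[a, b] h| <= (2 * K + 2) * e.
  have K2 : 0 < 2 * K + 2 by rewrite ltr_wpDl // mulr_ge0.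
  apply/eqP; rewrite -subr_eq0 -normr_le0; apply/ler_addgt0Pr => e e0.
  rewrite add0r; apply: le_trans (main (e / (2 * K + 2)) _) _; first exact: divr_gt0.
  by rewrite mulrCA divff ?gt_eqF // mulr1.
move=> e0.
(* Room inside [D] for the descending flank, which lies to the right of [b]. *)
have [q q0 hq] : exists2 q, 0 < q & D (b + q).
  have /nbhs_ballP[q q0 hq] := open_nbhs_nbhs (conj oD Db).
  exists (q / 2); first by rewrite divr_gt0.
  apply: hq; rewrite /ball /= opprD addNKr normrN gtr0_norm ?divr_gt0 //.
  by rewrite ltr_pdivrMr // ltr_pMr // ltr1n.
have [d1 d10 h1] := lebesgue_pt_right ly la e0.
have [d2 d20 h2] := lebesgue_pt_right ly lb e0.
have [d3 d30 h3] := RI_small ab (hi _ _ Da Db) e0.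
have [d4 d40 h4] := @RI_small h b (b + q) e (ltr_pwDr q0 (lexx b)) (hi _ _ Db hq) e0.
pose m := Num.min (Num.min (Num.min d1 d2) (Num.min d3 d4)) (Num.min q (b - a)).
have m0 : 0 < m by rewrite !lt_min d10 d20 d30 d40 q0 subr_gt0 ab.
pose r := m / 2; have r0 : 0 < r by rewrite divr_gt0.
have : r < m by rewrite ltr_pdivrMr // ltr_pMr // ltr1n.
rewrite !lt_min => /andP[/andP[/andP[r1 r2] /andP[r3 r4]] /andP[rq rba]].
have Dab : `[a, b + r] `<=` D.
  move=> x xab; apply: (iD a (b + q)) => //; move: xab => /=; rewrite !in_itv /= => /andP[-> /=] h'.
  by apply: le_trans h' _; rewrite lerD2l ltW.
have Dbr : D (b + r) by apply: Dab => /=; rewrite in_itv /= lexx andbT; lra.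
pose f x := step (r^-1 * (x - a)) - step (r^-1 * (x - b)).
pose ka x := r^-1 * dstep (r^-1 * (x - a)); pose kb x := r^-1 * dstep (r^-1 * (x - b)).
have df x : hasder f x (ka x - kb x).
  by apply: hasderD; [|apply: hasderN]; exact: kernel_hasder.
have bf : testfn D f by apply: cutoff_testfn => //; exact: ltW.
have yi : rint `[a, b + r] y.
  have : rint `[a, b + r] (y \_ D).
    case: ly => my _ /(_ `[a, b + r]%classic) hy; apply/integrableP; split.
      by apply/measurable_EFinP; exact: measurable_funS my.
    by apply: hy => //; exact: segment_compact.
  by apply: rint_ext => // x xab; rewrite patchE mem_set //; exact: Dab.
have mK c : measurable_fun `[a, b + r]%classic (fun x => r^-1 * dstep (r^-1 * (x - c))).
  by apply: measurable_funTS; apply: continuous_measurable_fun; exact: kernel_continuous.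
have bk c x : `|r^-1 * dstep (r^-1 * (x - c))| <= r^-1 * K.
  by rewrite normrM gtr0_norm ?invr_gt0 // ler_pM2l ?invr_gt0.
have ri c : rint `[a, b + r] (fun x => r^-1 * dstep (r^-1 * (x - c)) * y x).
  exact: (@rint_bounded _ _ _ _ (r^-1 * K) _ (mK c) (fun x _ => bk c x) yi).
have sub1 : `[a, a + r]%classic `<=` `[a, b + r]%classic.
  by move=> x /=; rewrite !in_itv /= => /andP[-> /=] h'; apply: le_trans h' _; rewrite lerD2r ltW.
have sub2 : `[b, b + r]%classic `<=` `[a, b + r]%classic.
  by move=> x /=; rewrite !in_itv /= => /andP[h' ->]; rewrite andbT (le_trans (ltW ab)).
have := wk f _ bf df.
rewrite (@RI_sub _ D `[a, b + r]) //; last first.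
  move=> x Dx /= /negP; rewrite in_itv /= => nx.
  rewrite /ka /kb !(kernel_out d0 r0) ?subrr ?mul0r // => hx; case/negP: nx; clear -hx ab r0; lra.
rewrite (_ : RI _ _ = RI `[a, a + r] (fun x => ka x * y x) - RI `[b, b + r] (fun x => kb x * y x)); last first.
  rewrite -(@RI_sub _ `[a, b + r] `[a, a + r] (fun x => ka x * y x)) //; last first.
    by move=> x _ /=; rewrite in_itv /= => nx; rewrite /ka (kernel_out d0 r0) ?mul0r.
  rewrite -(@RI_sub _ `[a, b + r] `[b, b + r] (fun x => kb x * y x)) //; last first.
    by move=> x _ /=; rewrite in_itv /= => nx; rewrite /kb (kernel_out d0 r0) ?mul0r.
  rewrite -RIB //; last 2 first.
  - exact: ri.
  - exact: ri.
  by apply: RI_ext => x _; rewrite mulrBl.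
have ea c : D c -> (forall x, c <= x <= c + r -> D x) -> `[c, c + r]%classic `<=` `[a, b + r]%classic ->
    RI `[c, c + r] (fun x => `|(y \_ D) x - (y \_ D) c|) <= e * r ->
    `|RI `[c, c + r] (fun x => r^-1 * dstep (r^-1 * (x - c)) * y x) - y c| <= K * e.
  move=> Dc Dx sub hh.
  apply: (kernel_mean K0 hd cd dK r0 (ltW e0)); first exact: (rintS _ _ sub yi).
  rewrite (_ : RI _ _ = RI `[c, c + r] (fun x => `|(y \_ D) x - (y \_ D) c|)) //.
  by apply: RI_ext => x /=; rewrite in_itv /= => xc; rewrite !patchE !mem_set //; exact: Dx.
have e1 : `|RI `[a, a + r] (fun x => ka x * y x) - y a| <= K * e.
  apply: ea => //; last by apply: h1; rewrite r0.
  by move=> x xa; apply: Dab; apply: sub1 => /=; rewrite in_itv.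
have e2 : `|RI `[b, b + r] (fun x => kb x * y x) - y b| <= K * e.
  apply: ea => //; last by apply: h2; rewrite r0.
  by move=> x xa; apply: Dab; apply: sub2 => /=; rewrite in_itv.
have hi1 : rint `[a, b + r] h by exact: hi.
have step1 (x : R) : `|step x| <= 1 by rewrite ger0_norm ?step_ge0 // step_le1.
have cs c : continuous (fun x => step (r^-1 * (x - c))).
  by move=> x; exact: hasder_continuous (kernel_hasder hd c r x).
have ms c (E : set R) : measurable E -> measurable_fun E (fun x => step (r^-1 * (x - c))).
  by move=> mE; apply: measurable_funTS; apply: continuous_measurable_fun; exact: cs.
rewrite (@RI_sub _ D `[a, b + r] (fun x => f x * h x)) //; last first.
  move=> x Dx /= /negP; rewrite in_itv /= negb_and -!ltNge /f => /orP[xa|xb].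
    clear -xa ab r0; rewrite !step_le0 ?subrr ?mul0r // pmulr_rle0 ?invr_gt0 // subr_le0; lra.
  clear -xb ab r0; rewrite !step_ge1 ?subrr ?mul0r // ler_pdivlMl //; lra.
have hsa : rint `[a, b + r] (fun x => (step (r^-1 * (x - a)) - 1) * h x).
  apply: (@rint_bounded _ _ _ _ 2) => //.
    by apply: measurable_funB => //; exact: ms.
  move=> x _; apply: le_trans (ler_normB _ _) _; rewrite normr1; have := step1 (r^-1 * (x - a)); clear; lra.
have hsb : rint `[a, b + r] (fun x => step (r^-1 * (x - b)) * h x).
  by apply: (@rint_bounded _ _ _ _ 1) => //; exact: ms.
have -> : RI `[a, b + r] (fun x => f x * h x) = RI `[a, b] h +
   (RI `[a, a + r] (fun x => (step (r^-1 * (x - a)) - 1) * h x) +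
    RI `[b, b + r] (fun x => (1 - step (r^-1 * (x - b))) * h x)).
  rewrite -(@RI_sub _ `[a, b + r] `[a, a + r] (fun x => (step (r^-1 * (x - a)) - 1) * h x)) //; last first.
    move=> x /=; rewrite !in_itv /= => /andP[x1 x2] /negP; rewrite x1 /= -ltNge => x3.
    clear -x3 r0; rewrite step_ge1 ?subrr ?mul0r // ler_pdivlMl //; lra.
  have -> : RI `[b, b + r] (fun x => (1 - step (r^-1 * (x - b))) * h x) =
            RI `[b, b + r] h - RI `[a, b + r] (fun x => step (r^-1 * (x - b)) * h x).
    rewrite (@RI_sub _ `[a, b + r] `[b, b + r] (fun x => step (r^-1 * (x - b)) * h x)) //; last first.
      move=> x /=; rewrite !in_itv /= => /andP[x1 x2] /negP; rewrite x2 andbT -ltNge => x3.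
      clear -x3 r0; rewrite step_le0 ?mul0r // pmulr_rle0 ?invr_gt0 // subr_le0; lra.
    rewrite -RIB //; last 2 first.
    - exact: (rintS _ _ sub2 hi1).
    - exact: (rintS _ _ sub2 hsb).
    by apply: RI_ext => x _; rewrite mulrBl mul1r.
  rewrite (_ : RI `[a, b + r] (fun x => f x * h x) = RI `[a, b + r] h +
    RI `[a, b + r] (fun x => (step (r^-1 * (x - a)) - 1) * h x) -
    RI `[a, b + r] (fun x => step (r^-1 * (x - b)) * h x)); last first.
    rewrite -RID // -RIB //; last exact: rintD.
    by apply: RI_ext => x _; rewrite /f; ring.
  rewrite (@RI_itv_split _ a b (b + r)) ?ltW // ?ltrDl //.
  ring.
have e3 : `|RI `[a, a + r] (fun x => (step (r^-1 * (x - a)) - 1) * h x)| <= e.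
  apply: le_trans (_ : _ <= RI `[a, a + r] (fun x => `|h x|)) _; last by apply/ltW/h3; rewrite r0.
  apply: RI_norm_le => //; first exact: (rintS _ _ sub1 hsa).
    by apply: rint_norm => //; exact: (rintS _ _ sub1 hi1).
  move=> x _; rewrite normrM ler_piMl // ler_norml.
  by have := step_ge0 (r^-1 * (x - a)); have := step_le1 (r^-1 * (x - a)); clear; lra.
have e4 : `|RI `[b, b + r] (fun x => (1 - step (r^-1 * (x - b))) * h x)| <= e.
  apply: le_trans (_ : _ <= RI `[b, b + r] (fun x => `|h x|)) _; last by apply/ltW/h4; rewrite r0.
  have hb : rint `[b, b + r] h by exact: (rintS _ _ sub2 hi1).
  apply: RI_norm_le => //; last 2 first.
  - exact: rint_norm.
  - move=> x _; rewrite normrM ler_piMl // ler_norml.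
    by have := step_ge0 (r^-1 * (x - b)); have := step_le1 (r^-1 * (x - b)); clear; lra.
  apply: rint_ext (rintB _ hb (rintS _ _ sub2 hsb)) => // x _.
  by rewrite mulrBl mul1r.
move: e1 e2 e3 e4; rewrite !ler_norml.
set A1 := RI _ _; set A2 := RI _ _; set A3 := RI _ _; set A4 := RI _ _; set A5 := RI _ _.
move=> /andP[y1 y2] /andP[y3 y4] /andP[y5 y6] /andP[y7 y8] eq0; clear -y1 y2 y3 y4 y5 y6 y7 y8 eq0.
by apply/andP; split; lra.
Qed.

End WeakDerivative.

(** * Absolutely continuous functions and their product rule *)

Section AbsolutelyContinuous.
Variable R : realType.
Notation mu := (@lebesgue_measure R).
Implicit Types (D : set R) (f g h k y Y Z : R -> R) (a b c e r x z : R).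

Lemma aeS (P P' : R -> Prop) : (forall x, P x -> P' x) ->
  (\forall x \ae mu, P x) -> (\forall x \ae mu, P' x).
Proof.
move=> PQ [N [mN N0 hN]]; exists N; split=> // x /= nQ.
by apply: hN => /= Px; apply: nQ; exact: PQ.
Qed.

Lemma aeI (P P' : R -> Prop) : (\forall x \ae mu, P x) -> (\forall x \ae mu, P' x) ->
  (\forall x \ae mu, P x /\ P' x).
Proof.
move=> h1 h2; apply: negligibleS (negligibleU h1 h2) => x /= /not_andP[|]; by [left|right].
Qed.

Lemma ae_exists (P : R -> Prop) a b : a < b -> (\forall x \ae mu, P x) ->
  exists2 x, a < x < b & P x.
Proof.
move=> ab [N [mN N0 hN]]; apply: contrapT => nex.
have sub : `]a, b[%classic `<=` N.
  move=> x /=; rewrite in_itv /= => xab; apply: hN => /= Px; apply: nex; by exists x.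
have : (mu `]a, b[ <= mu N)%E by apply: le_measure => //; rewrite inE.
by rewrite N0 lebesgue_measure_itv /= lte_fin ab -EFinB lee_fin leNgt subr_gt0 ab.
Qed.

Lemma RI_ae D f g : measurable D -> measurable_fun D f -> measurable_fun D g ->
  (\forall x \ae mu, D x -> f x = g x) -> RI D f = RI D g.
Proof.
move=> mD mf mg h; rewrite /RI /Rintegral; congr fine.
apply: ae_eq_integral => //; [exact/measurable_EFinP|exact/measurable_EFinP|].
by apply: aeS h => x h Dx; rewrite h.
Qed.

Lemma rint_ae D f g : measurable D -> measurable_fun D g ->
  (\forall x \ae mu, D x -> f x = g x) -> rint D f -> rint D g.
Proof.
move=> mD mg h fi; have mf := rint_measurable fi.
move/integrableP: fi => [_ fi]; apply/integrableP; split; first exact/measurable_EFinP.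
rewrite (@ge0_ae_eq_integral _ _ R mu D _ (fun x => `|(f x)%:E|%E)) //.
- by apply: measurableT_comp => //; exact/measurable_EFinP.
- by apply: measurableT_comp => //; exact/measurable_EFinP.
- by apply: aeS h => x h Dx /=; rewrite h.
Qed.

Lemma RI_unif h a b e : rint `[a, b] h -> 0 < e -> exists2 d, 0 < d &
  forall x z, a <= x -> x <= z -> z <= b -> z - x < d -> RI `[x, z] (fun x => `|h x|) < e.
Proof.
move=> hi e0.
have hi' : mu.-integrable setT (EFin \o (h \_ `[a, b])).
  by rewrite -restrict_EFin; apply/integrable_restrict => //=; rewrite setTI.
have [d [d0 hd]] := integral_normr_continuous hi' e0.
exists d => // x z ax xz zb zxd.
have : (mu `[x, z] < d%:E)%E.
  by rewrite lebesgue_measure_itv /= lte_fin; case: ifPn => _; rewrite -?EFinB lte_fin.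
move=> /(hd _ (measurable_itv _)); apply: le_lt_trans.
rewrite le_eqVlt; apply/orP; left; apply/eqP; apply: RI_ext => t /=.
rewrite in_itv /= => /andP[t1 t2]; rewrite patchE mem_set //= in_itv /=.
by rewrite (le_trans ax t1) (le_trans t2 zb).
Qed.

(** The density [h] is carried along instead of a derivative, because it matters only up to null
    sets and is merely integrable on the segments of [D]. *)
Definition abscont D Y h : Prop := (forall x z, D x -> D z -> rint `[x, z] h) /\
  (forall x z, D x -> D z -> x <= z -> Y z - Y x = RI `[x, z] h).

Definition segment_closed D : Prop := forall x z, D x -> D z -> `[x, z] `<=` D.

Lemma abscont_exists D y h : open D -> measurable D -> D !=set0 -> segment_closed D ->
  locally_integrable setT (y \_ D) -> (forall x z, D x -> D z -> rint `[x, z] h) ->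
  (forall f df, testfn D f -> (forall x, hasder f x (df x)) ->
     RI D (fun x => df x * y x) = - RI D (fun x => f x * h x)) ->
  exists Y, abscont D Y h /\ (\forall x \ae mu, D x -> Y x = y x).
Proof.
move=> oD mD [p Dp] iD ly hi wk.
have lp := lebesgue_differentiation ly.
have [q q0 Dq] : exists2 q, 0 < q & D (p + q).
  have /nbhs_ballP[q q0 hq] := open_nbhs_nbhs (conj oD Dp).
  exists (q / 2); first by rewrite divr_gt0.
  apply: hq; rewrite /ball /= opprD addNKr normrN gtr0_norm ?divr_gt0 //.
  by rewrite ltr_pdivrMr // ltr_pMr // ltr1n.
have [c /andP[c1 c2] lc] := ae_exists (ltr_pwDr q0 (lexx p)) lp.
have Dc : D c by apply: (iD p (p + q)) => //=; rewrite in_itv /= !ltW.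
pose Y x := y c + (if c <= x then RI `[c, x] h else - RI `[x, c] h).
exists Y; split.
  split=> // x z Dx Dz xz; rewrite /Y.
  case: (leP c x) => cx.
    rewrite (le_trans cx xz) (RI_itv_split cx xz (hi _ _ Dc Dz)).
    ring.
  case: (leP c z) => cz.
    rewrite (RI_itv_split (ltW cx) cz (hi _ _ Dx Dz)); ring.
  rewrite (RI_itv_split xz (ltW cz) (hi _ _ Dx Dc)); ring.
apply: aeS lp => x lx Dx; rewrite /Y.
case: (ltgtP c x) => cx.
- by rewrite -(weak_AC oD mD iD ly hi wk Dc Dx cx lc lx) addrC subrK.
- by rewrite -(weak_AC oD mD iD ly hi wk Dx Dc cx lx lc) opprB addrC subrK.
- by rewrite -cx /RI set_itv1 Rintegral_set1 addr0.
Qed.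

Lemma open_near_itv D x : open D -> D x -> exists2 r, 0 < r & forall z, x - r <= z <= x + r -> D z.
Proof.
move=> oD Dx; have /nbhs_ballP[q q0 hq] := open_nbhs_nbhs (conj oD Dx).
exists (q / 2); first by rewrite divr_gt0.
move=> z /andP[z1 z2]; apply: hq; rewrite /ball /= ltr_norml.
have : 0 < q by []. move=> {}q0; apply/andP; split; lra.
Qed.

Lemma near_dist x e : 0 < e -> \forall z \near x, `|x - z| < e.
Proof. by move=> e0; exact: (@nbhsx_ballx _ _ x e e0). Qed.

Lemma abscont_continuous D Y h : open D -> abscont D Y h -> forall x, D x -> {for x, continuous Y}.
Proof.
move=> oD [hi hY] x Dx; have [r r0 hr] := open_near_itv oD Dx.
apply/cvgrPdist_lt => e e0.
have Da : D (x - r) by apply: hr; rewrite lexx /=; lra.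
have Db : D (x + r) by apply: hr; rewrite lexx andbT; lra.
have [d d0 hd] := RI_unif (hi _ _ Da Db) e0.
near=> z; have zr : `|x - z| < Num.min d r by near: z; apply: near_dist; rewrite lt_min d0.
move: zr; rewrite lt_min => /andP[zd]; rewrite ltr_norml => /andP[z1 z2].
have Dz : D z by apply: hr; apply/andP; split; lra.
case: (leP x z) => xz.
  rewrite distrC hY //; apply: le_lt_trans (RI_norm _ (hi _ _ Dx Dz)) _ => //.
  apply: hd => //; [lra|lra|]; by move: zd; rewrite distrC ger0_norm // subr_ge0.
rewrite hY ?ltW //; apply: le_lt_trans (RI_norm _ (hi _ _ Dz Dx)) _ => //.
by apply: hd; [lra|exact: ltW|lra|]; move: zd; rewrite ger0_norm // subr_ge0 ltW.
Unshelve. all: end_near. Qed.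

Lemma abscont_ae D Y h k : segment_closed D -> abscont D Y h ->
  (forall x z, D x -> D z -> measurable_fun `[x, z] k) ->
  (\forall x \ae mu, D x -> h x = k x) -> abscont D Y k.
Proof.
move=> iD [hi hY] mk hk.
have hk' x z : D x -> D z -> \forall t \ae mu, `[x, z]%classic t -> h t = k t.
  by move=> Dx Dz; apply: aeS hk => t ht xz; apply: ht; exact: (iD x z).
split=> x z Dx Dz; first by apply: (@rint_ae _ h) => //; [exact: mk|exact: hk'|exact: hi].
move=> xz; rewrite hY //; apply: RI_ae => //; [exact: rint_measurable (hi _ _ Dx Dz)|exact: mk|exact: hk'].
Qed.

Lemma abscont_hasder D Y h : open D -> abscont D Y h -> forall x, D x -> {for x, continuous h} ->
  hasder Y x (h x).
Proof.
move=> oD [hi hY] x Dx ch; have [r r0 hr] := open_near_itv oD Dx.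
have Da : D (x - r) by apply: hr; rewrite lexx /=; lra.
have Db : D (x + r) by apply: hr; rewrite lexx andbT; lra.
have ax : x - r < x by lra.
have xu : x < x + r by lra.
have [d1 d2] := continuous_FTC1_closed xu (hi _ _ Da Db) ax ch.
have hF : hasder (fun z => RI `[x - r, z] h) x (h x) by rewrite -d2; exact: derivable_hasder.
apply: (@hasder_near _ (fun z => Y (x - r) + RI `[x - r, z] h)).
  near=> z; have zr : `|x - z| < r by near: z; exact: near_dist.
  move: zr; rewrite ltr_norml => /andP[z1 z2].
  rewrite -hY //; [by rewrite addrC subrK|by apply: hr; lra|lra].
by apply: hasder_eq (hasderD (hasder_cst _ _) hF) _; rewrite add0r.
Unshelve. all: end_near. Qed.

Lemma rint_contM f g a b : (forall x, a <= x <= b -> {for x, continuous f}) ->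
  rint `[a, b] g -> rint `[a, b] (fun x => f x * g x).
Proof.
move=> cf gi; have [K K0 hK] := segment_bounded cf.
apply: (@rint_bounded _ _ _ _ K) => //.
apply: subspace_continuous_measurable_fun => //.
by apply: continuous_in_subspaceT => x; rewrite inE /= in_itv /=; exact: cf.
Qed.

(** The densities are only integrable, so the product cannot be differentiated pointwise. On a piece
    so short that the integrals of [|h|] and [|k|] over it stay below [e], the increment of the
    product agrees with the claimed integral up to [e] times the integral of [|h| + |k|]; these
    errors add up to [e * G a b]. *)
Lemma abscontM D Y Z h k : open D -> segment_closed D -> abscont D Y h -> abscont D Z k ->
  abscont D (fun x => Y x * Z x) (fun x => Z x * h x + Y x * k x).
Proof.
move=> oD iD aY aZ.
have cY := abscont_continuous oD aY; have cZ := abscont_continuous oD aZ.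
case: aY aZ => [hi hY] [ki hZ].
have i1 x z : D x -> D z -> rint `[x, z] (fun x => Z x * h x).
  by move=> Dx Dz; apply: rint_contM (hi _ _ Dx Dz) => t t1; apply: cZ; exact: (iD x z).
have i2 x z : D x -> D z -> rint `[x, z] (fun x => Y x * k x).
  by move=> Dx Dz; apply: rint_contM (ki _ _ Dx Dz) => t t1; apply: cY; exact: (iD x z).
have i3 x z : D x -> D z -> rint `[x, z] (fun x => Z x * h x + Y x * k x).
  by move=> Dx Dz; apply: rintD; [|exact: i1|exact: i2].
split=> // a b Da Db; rewrite le_eqVlt => /orP[/eqP <-|ab].
  by rewrite subrr /RI set_itv1 Rintegral_set1.
have in_ab x : a <= x -> x <= b -> D x by move=> h1 h2; apply: (iD a b) => //=; rewrite in_itv /= h1.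
pose G x z := RI `[x, z] (fun t => `|h t| + `|k t|).
have Gi x z : D x -> D z -> rint `[x, z] (fun t => `|h t| + `|k t|).
  by move=> Dx Dz; apply: rintD => //; apply: rint_norm => //; [exact: hi|exact: ki].
suff main e : 0 < e -> `|Y b * Z b - Y a * Z a - RI `[a, b] (fun x => Z x * h x + Y x * k x)| <= e * G a b.
  have G0 : 0 <= G a b by apply: RI_ge0 => x _; exact: addr_ge0.
  apply/eqP; rewrite -subr_eq0 -normr_le0; apply/ler_addgt0Pr => e e0.
  rewrite add0r; apply: le_trans (main (e / (G a b + 1)) _) _.
    by rewrite divr_gt0 // ltr_wpDl.
  rewrite -mulrA ler_piMr ?(ltW e0) // mulrC ler_pdivrMr ?ltr_wpDl // mul1r; lra.
move=> e0.
have [d1 d10 h1] := RI_unif (hi _ _ Da Db) e0.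
have [d2 d20 h2] := RI_unif (ki _ _ Da Db) e0.
have loc x z : a <= x -> x <= z -> z <= b -> z - x < d1 -> z - x < d2 ->
    `|Y z * Z z - Y x * Z x - RI `[x, z] (fun x => Z x * h x + Y x * k x)| <= e * G x z.
  move=> ax xz zb zd1 zd2; have Dx := in_ab _ ax (le_trans xz zb).
  have Dz := in_ab _ (le_trans ax xz) zb.
  (* Discrete product rule, with [Z] frozen at the left end and [Y] at the right end. *)
  have -> : Y z * Z z - Y x * Z x = RI `[x, z] (fun t => Z x * h t + Y z * k t).
    rewrite RID //; [|by apply: rintZ => //; exact: hi|by apply: rintZ => //; exact: ki].
    rewrite !RIZ //; [|exact: ki|exact: hi].
    rewrite -hY // -hZ //; ring.
  have ic : rint `[x, z] (fun t => Z x * h t + Y z * k t).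
    by apply: rintD => //; apply: rintZ => //; [exact: hi|exact: ki].
  rewrite -RIB //; last exact: i3.
  rewrite /G -RIZ //; last exact: Gi.
  apply: RI_norm_le => //; [apply: rintB => //; exact: i3|apply: rintZ => //; exact: Gi|].
  move=> t /=; rewrite in_itv /= => /andP[xt tz].
  have Dt := in_ab _ (le_trans ax xt) (le_trans tz zb).
  have -> : Z x * h t + Y z * k t - (Z t * h t + Y t * k t) = (Y z - Y t) * k t - (Z t - Z x) * h t by ring.
  apply: le_trans (ler_normB _ _) _; rewrite !normrM mulrDr addrC.
  apply: lerD; apply: ler_wpM2r => //.
    rewrite hZ //; apply: le_trans (RI_norm _ (ki _ _ Dx Dt)) _ => //.
    by apply/ltW/h2 => //; lra.
  rewrite hY //; apply: le_trans (RI_norm _ (hi _ _ Dt Dz)) _ => //.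
  by apply/ltW/h1 => //; lra.
(* Enough equal pieces for the mesh [s] to lie below both moduli. *)
pose n := (Num.trunc ((b - a) / Num.min d1 d2)).+1.
have d0 : 0 < Num.min d1 d2 by rewrite lt_min d10.
have n0 : (0 : R) < n%:R by rewrite ltr0n.
pose s := (b - a) / n%:R.
have s0 : 0 < s by rewrite divr_gt0 // subr_gt0.
have : s < Num.min d1 d2.
  rewrite ltr_pdivrMr // mulrC -ltr_pdivrMr //.
  by apply: truncnS_gt.
rewrite lt_min => /andP[sd1 sd2].
have nb : a + n%:R * s = b by rewrite mulrC divfK ?gt_eqF // addrC subrK.
suff ind i : (i <= n)%N -> `|Y (a + i%:R * s) * Z (a + i%:R * s) - Y a * Z a -
    RI `[a, a + i%:R * s] (fun x => Z x * h x + Y x * k x)| <= e * G a (a + i%:R * s).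
  by have := ind n (leqnn n); rewrite nb.
elim: i => [_|i IH lin].
  rewrite mul0r addr0 subrr /G /RI !set_itv1 !Rintegral_set1 subrr normr0 mulr0 //.
have p1 : a <= a + i%:R * s by rewrite lerDl mulr_ge0 // ltW.
have p2 : a + i%:R * s <= a + i.+1%:R * s by rewrite lerD2l; apply: ler_wpM2r; [exact: ltW|rewrite ler_nat].
have p3 : a + i.+1%:R * s <= b by rewrite -nb lerD2l; apply: ler_wpM2r; [exact: ltW|rewrite ler_nat].
have p4 : a + i.+1%:R * s - (a + i%:R * s) = s by rewrite -natr1; ring.
have D1 := in_ab _ p1 (le_trans p2 p3); have D2 := in_ab _ (le_trans p1 p2) p3.
have := loc _ _ p1 p2 p3; rewrite p4 => /(_ sd1 sd2).
have := IH (ltnW lin).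
rewrite /G (RI_itv_split p1 p2 (i3 _ _ Da D2)) (RI_itv_split p1 p2 (Gi _ _ Da D2)).
rewrite !ler_norml => /andP[A1 A2] /andP[A3 A4]; rewrite mulrDr; clear -A1 A2 A3 A4.
by apply/andP; split; lra.
Qed.

Lemma abscontB D Y Z h k : abscont D Y h -> abscont D Z k ->
  abscont D (fun x => Y x - Z x) (fun x => h x - k x).
Proof.
move=> [hi hY] [ki hZ]; split=> x z Dx Dz; first by apply: rintB => //; [exact: hi|exact: ki].
by move=> xz; rewrite RIB // -?hY -?hZ //; [ring|exact: hi|exact: ki].
Qed.

End AbsolutelyContinuous.

Local Open Scope complex_scope.

(** * Integrals over the whole line *)

Section WholeLine.
Variable R : realType.
Notation mu := (@lebesgue_measure R).
Implicit Types (f g h w W : R -> R) (a b c e r x z A : R).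
Notation T := [set: R].

Lemma RI_patch (E : set R) f : measurable E -> RI E f = RI T (f \_ E).
Proof. by move=> mE; rewrite /RI [LHS]Rintegral_mkcond. Qed.

Lemma rint_patch (E : set R) f : measurable E -> rint E f -> rint T (f \_ E).
Proof.
move=> mE fi; have : mu.-integrable T ((EFin \o f) \_ E).
  by apply/(integrable_restrict mu mE measurableT); rewrite setTI.
by rewrite restrict_EFin.
Qed.

Lemma RI_setT_lb g e : rint T g ->
  (forall L, 0 < L -> exists c, forall x, c <= x <= c + L -> e <= `|g x|) -> e <= 0.
Proof.
move=> gi h; rewrite leNgt; apply/negP => e0.
have gn := rint_norm measurableT gi.
(* On an interval of this length the bound [e <= |g|] would produce [e] more than the total
   integral. *)
pose L := RI T (fun x => `|g x|) / e + 1.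
have L0 : 0 < L by rewrite ltr_wpDl // divr_ge0 ?(ltW e0) //; apply: RI_ge0.
have [c hc] := h _ L0.
have : RI T (fun x => `|g x|) < e * L.
  by rewrite /L mulrDr mulrCA divff ?gt_eqF // !mulr1 ltrDl.
rewrite ltNge => /negP; apply.
have An : c <= c + L by rewrite lerDl ltW.
have -> : e * L = RI `[c, c + L] (fun=> e) by rewrite RI_cst // addrC addKr.
apply: le_trans (_ : RI `[c, c + L] (fun x => `|g x|) <= _).
  apply: RI_le => //.
  - by apply: rint_cst => //; exact: itv_fin.
  - exact: (rintS _ _ _ gn).
by apply: RI_mono.
Qed.

Lemma rint_small_right g A e : rint T g -> 0 < e -> exists2 x, A <= x & `|g x| < e.
Proof.
move=> gi e0; apply: contrapT => h; suff : e <= 0 by rewrite leNgt e0.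
apply: (RI_setT_lb gi) => L L0; exists A => x /andP[Ax _].
by rewrite leNgt; apply/negP => hx; apply: h; exists x.
Qed.

Lemma rint_small_left g A e : rint T g -> 0 < e -> exists2 x, x <= A & `|g x| < e.
Proof.
move=> gi e0; apply: contrapT => h; suff : e <= 0 by rewrite leNgt e0.
apply: (RI_setT_lb gi) => L L0; exists (A - L) => x; rewrite subrK => /andP[_ Ax].
by rewrite leNgt; apply/negP => hx; apply: h; exists x.
Qed.

Lemma RI_tail w e : rint T w -> 0 < e -> exists A, 0 < A /\
  forall a b, a <= - A -> A <= b -> `|RI T w - RI `[a, b] w| <= e.
Proof.
move=> wi e0.
have wn := rint_norm measurableT wi.
pose F (n : nat) : set R := `[- n%:R, n%:R]%classic.
have mF n : measurable (F n) by exact: measurable_itv.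
have ndF : nondecreasing_seq F.
  move=> m n mn; apply/subsetPset => x; rewrite /F /= !in_itv /= => /andP[x1 x2].
  have mn' : (m%:R : R) <= n%:R by rewrite ler_nat.
  apply/andP; split; last exact: le_trans x2 mn'.
  by apply: le_trans x1; rewrite lerN2.
have UF : \bigcup_n F n = T.
  apply/seteqP; split=> // x _; exists (Num.trunc `|x|).+1 => //.
  have := truncnS_gt `|x|; rewrite /F /= in_itv /= ltr_norml => /andP[h1 h2].
  by rewrite !ltW.
have wi' n : rint (F n) (fun x => `|w x|) by exact: (rintS measurableT (mF n) (@subsetT _ _) wn).
have cv : (\int[mu]_(x in F i) (`|w x|)%:E)%E @[i --> \oo] --> (\int[mu]_(x in \bigcup_i F i) (`|w x|)%:E)%E.
  apply: ge0_nondecreasing_set_cvg_integral => //.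
  by move=> n; apply/measurable_EFinP; exact: rint_measurable (wi' n).
have UF0 : RI (\bigcup_n F n) (fun x => `|w x|) = RI T (fun x => `|w x|) by rewrite UF.
have {cv UF0} cv : (RI (F n) (fun x => `|w x|)) @[n --> \oo] --> RI T (fun x => `|w x|).
  rewrite -UF0; apply: fine_cvg; rewrite /RI /Rintegral fineK; last first.
    rewrite UF; exact: (@integrable_fin_num _ _ R mu _ measurableT _ wn).
  exact: cv.
move/cvgrPdist_lt : cv => /(_ _ e0) [N _ hN].
have := hN N.+1 (leqnSn N); rewrite /= => hN1.
have p0 : (0 : R) < N.+1%:R by rewrite ltr0n.
exists N.+1%:R; split => // a b aN Nb.
have mab : measurable `[a, b]%classic by exact: measurable_itv.
have sub : F N.+1 `<=` `[a, b]%classic.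
  by move=> x; rewrite /F /= !in_itv /= => /andP[x1 x2]; rewrite (le_trans aN x1) (le_trans x2 Nb).
have wp : rint T (w \_ `[a, b]) by apply: rint_patch => //; exact: (rintS measurableT mab (@subsetT _ _) wi).
have np : rint T ((fun t => `|w t|) \_ `[a, b]) by apply: rint_patch => //; exact: (rintS measurableT mab (@subsetT _ _) wn).
have h1 : RI (F N.+1) (fun x => `|w x|) <= RI `[a, b] (fun x => `|w x|).
  by apply: RI_mono => //; exact: (rintS measurableT).
have -> : RI T w - RI `[a, b] w = RI T (fun x => w x - (w \_ `[a, b]) x).
  rewrite RIB //.
  by rewrite [in LHS](@RI_patch _ w mab).
apply: le_trans (_ : _ <= RI T (fun x => `|w x| - ((fun t => `|w t|) \_ `[a, b]) x)) _.
  apply: RI_norm_le => //.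
  - exact: rintB.
  - exact: rintB.
  - move=> x _; rewrite !patchE; case: ifPn => _; by rewrite ?subrr ?normr0 ?subr0.
rewrite RIB //.
rewrite -(@RI_patch _ (fun t => `|w t|) mab).
apply: le_trans (_ : _ <= RI T (fun x => `|w x|) - RI (F N.+1) (fun x => `|w x|)) _.
  by rewrite lerD2l lerN2.
by apply: ltW; apply: le_lt_trans hN1; exact: ler_norm.
Qed.

(* The boundary terms of [W] vanish along suitable sequences because [W] is integrable. *)
Lemma RI_abscont_eq0 W w : abscont T W w -> rint T W -> rint T w -> RI T w = 0.
Proof.
move=> [_ hW] Wi wi; apply/eqP; rewrite -normr_le0; apply/ler_addgt0Pr => e e0.
rewrite add0r; have e3 : 0 < e / 3 by rewrite divr_gt0.
have [A [A0 hA]] := RI_tail wi e3.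
have [b Ab hb] := rint_small_right A Wi e3.
have [a Aa ha] := rint_small_left (- A) Wi e3.
have := hA _ _ Aa Ab; rewrite -hW //; last by lra.
move: hb ha; rewrite !ltr_norml !ler_norml => /andP[? ?] /andP[? ?] /andP[? ?].
by apply/andP; split; lra.
Qed.

Lemma cont_compact_rint w a b : continuous w -> (forall x, ~~ (a <= x <= b) -> w x = 0) -> rint T w.
Proof.
move=> cw w0; have -> : w = w \_ `[a, b].
  apply/funext => x; rewrite patchE; case: ifPn => // xab; rewrite w0 //.
  by apply/negP => h; move: xab; rewrite notin_setE /= in_itv /=; apply.
by apply: rint_patch => //; apply: rint_contf => x _; exact: cw.
Qed.

End WholeLine.

(** * Adjoints of Dirac operators *)

Section ComplexParts.
Variable R : realType.
Implicit Types (z t : R[i]) (k : R) (b : bool).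

(** A boolean index for the two real coordinates: as the operators have real coefficients, every
    argument runs once over [b]. *)
Definition part b z : R := if b then complex.Im z else complex.Re z.

Definition cpart b k : R[i] := if b then 0 +i* k else k +i* 0.

Lemma partD b z t : part b (z + t) = part b z + part b t.
Proof. by case: b z t => -[? ?] [? ?]. Qed.

Lemma partN b z : part b (- z) = - part b z.
Proof. by case: b z => -[? ?]. Qed.

Lemma partZ b k z : part b (k%:C * z) = k * part b z.
Proof. by case: b z => -[? ?] /=; ring. Qed.

Lemma part_inj z t : (forall b, part b z = part b t) -> z = t.
Proof. by case: z t => [a1 b1] [a2 b2] h; have := h true; have := h false => /= -> ->. Qed.

Lemma part_cderive b (f : R -> R[i]) x : part b (cderive f x) = (fun y => part b (f y))^`()%classic x.
Proof. by case: b. Qed.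

Lemma cmeasurableP (D : set R) (f : R -> R[i]) :
  cmeasurable D f <-> forall b, measurable_fun D (fun x => part b (f x)).
Proof. by split=> [[h1 h2] []//|h]; split; [exact: (h false)|exact: (h true)]. Qed.

Lemma csqnorm_part z : csqnorm z = part false z ^+ 2 + part true z ^+ 2.
Proof. by []. Qed.

Lemma part_le_csqnorm b z : part b z ^+ 2 <= csqnorm z.
Proof. by case: b; rewrite csqnorm_part ?lerDl ?lerDr sqr_ge0. Qed.

Lemma csqnorm_ge0 z : 0 <= csqnorm z.
Proof. by rewrite addr_ge0 ?sqr_ge0. Qed.

End ComplexParts.

Section L2parts.
Variable R : realType.
Notation mu := (@lebesgue_measure R).
Implicit Types (u v : spinor R) (D : set R) (w : R -> R).

Definition comp1 b u x : R := part b (u x).1.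
Definition comp2 b u x : R := part b (u x).2.

Lemma L2_comp D w u : measurable D -> measurable_fun D w -> (forall x, D x -> 0 <= w x) -> L2 D w u ->
  forall b, [/\ measurable_fun D (comp1 b u), measurable_fun D (comp2 b u),
     rint D (fun x => w x * comp1 b u x ^+ 2) & rint D (fun x => w x * comp2 b u x ^+ 2)].
Proof.
move=> mD mw w0 [/cmeasurableP m1 /cmeasurableP m2 fi] b.
have m1' := m1 b; have m2' := m2 b.
have mc1 : measurable_fun D (fun x => csqnorm (u x).1).
  by apply: measurable_funD; apply: measurable_funX; [exact: (m1 false)|exact: (m1 true)].
have mc2 : measurable_fun D (fun x => csqnorm (u x).2).
  by apply: measurable_funD; apply: measurable_funX; [exact: (m2 false)|exact: (m2 true)].
have ui : rint D (fun x => w x * (csqnorm (u x).1 + csqnorm (u x).2)).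
  apply/integrableP; split.
    by apply/measurable_EFinP; apply: measurable_funM => //; exact: measurable_funD.
  apply: le_lt_trans fi; rewrite le_eqVlt; apply/orP; left; apply/eqP; apply: eq_integral => x.
  by rewrite inE => Dx; rewrite /= ger0_norm // mulr_ge0 ?w0 // addr_ge0 // csqnorm_ge0.
split=> //; apply: rint_le ui => //.
- by apply: measurable_funM => //; exact: measurable_funX.
- move=> x Dx; rewrite ger0_norm; last by rewrite mulr_ge0 ?w0 ?sqr_ge0.
  apply: ler_wpM2l; first exact: w0.
  by apply: le_trans (part_le_csqnorm b _) _; rewrite lerDl csqnorm_ge0.
- by apply: measurable_funM => //; exact: measurable_funX.
- move=> x Dx; rewrite ger0_norm; last by rewrite mulr_ge0 ?w0 ?sqr_ge0.
  apply: ler_wpM2l; first exact: w0.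
  by apply: le_trans (part_le_csqnorm b _) _; rewrite lerDr csqnorm_ge0.
Qed.

Lemma L2_intro D w u : measurable D -> measurable_fun D w -> (forall x, D x -> 0 <= w x) ->
  (forall b, [/\ measurable_fun D (comp1 b u), measurable_fun D (comp2 b u),
     rint D (fun x => w x * comp1 b u x ^+ 2) & rint D (fun x => w x * comp2 b u x ^+ 2)]) ->
  L2 D w u.
Proof.
move=> mD mw w0 h; split.
- by apply/cmeasurableP => b; have [] := h b.
- by apply/cmeasurableP => b; have [] := h b.
- have [_ _ i1 i2] := h false; have [_ _ i3 i4] := h true.
  have ui : rint D (fun x => (w x * comp1 false u x ^+ 2 + w x * comp1 true u x ^+ 2) +
     (w x * comp2 false u x ^+ 2 + w x * comp2 true u x ^+ 2)).
    by apply: rintD => //; exact: rintD.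
  move/integrableP: ui => [_]; apply: le_lt_trans.
  rewrite le_eqVlt; apply/orP; left; apply/eqP; apply: eq_integral => x; rewrite inE => Dx /=.
  have t0 (y : R) : 0 <= w x * y ^+ 2 by rewrite mulr_ge0 ?sqr_ge0 ?w0.
  rewrite ger0_norm; last by rewrite !addr_ge0.
  by congr (_%:E); rewrite /csqnorm; ring.
Qed.

Lemma part_inner D w u v : measurable D ->
  (forall b b', [/\ rint D (fun x => w x * (comp1 b u x * comp1 b' v x)) &
                    rint D (fun x => w x * (comp2 b u x * comp2 b' v x))]) ->
  let S b b' := RI D (fun x => w x * (comp1 b u x * comp1 b' v x)) +
                RI D (fun x => w x * (comp2 b u x * comp2 b' v x)) in
  inner D w u v = (S false false + S true true) +i* (S true false - S false true).
Proof.
move=> mD h S; rewrite /inner /cintegral; congr (_ +i* _).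
- have [h1 h2] := h false false; have [h3 h4] := h true true.
  rewrite /S -(RID mD h1 h2) -(RID mD h3 h4) -RID //; [|exact: rintD|exact: rintD].
  apply: RI_ext => x _; rewrite /comp1 /comp2 /=.
  by case: (u x) => -[? ?] [? ?]; case: (v x) => -[? ?] [? ?] /=; ring.
- have [h1 h2] := h true false; have [h3 h4] := h false true.
  rewrite /S -(RID mD h1 h2) -(RID mD h3 h4) -RIB //; [|exact: rintD|exact: rintD].
  apply: RI_ext => x _; rewrite /comp1 /comp2 /=.
  by case: (u x) => -[? ?] [? ?]; case: (v x) => -[? ?] [? ?] /=; ring.
Qed.

End L2parts.

Section DiracOperator.
Variable R : realType.
Notation mu := (@lebesgue_measure R).
Notation T := [set: R].
Notation one := (fun=> 1 : R).
Variables (B11 B12 B22 : R -> R) (K : R).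
Hypotheses (c11 : continuous B11) (c12 : continuous B12) (c22 : continuous B22).
Hypotheses (b11 : forall x, `|B11 x| <= K) (b12 : forall x, `|B12 x| <= K) (b22 : forall x, `|B22 x| <= K).
Implicit Types (u v g : spinor R) (f h : R -> R) (b : bool).

Definition dirac_op (u : spinor R) : spinor R := fun x =>
  ((B11 x)%:C * (u x).1 + (- cderive (fun y => (u y).2) x + (B12 x)%:C * (u x).2),
   (cderive (fun y => (u y).1) x + (B12 x)%:C * (u x).1) + (B22 x)%:C * (u x).2).

Notation T0 := (minimal_operator T dirac_op).
Notation T1 := (adjoint T one T0).

Lemma dirac_comp1 b u x : comp1 b (dirac_op u) x =
  B11 x * comp1 b u x + (- (comp2 b u)^`()%classic x + B12 x * comp2 b u x).
Proof. by rewrite /comp1 /comp2 /= !partD partN !partZ part_cderive. Qed.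

Lemma dirac_comp2 b u x : comp2 b (dirac_op u) x =
  (comp1 b u)^`()%classic x + B12 x * comp1 b u x + B22 x * comp2 b u x.
Proof. by rewrite /comp1 /comp2 /= !partD !partZ part_cderive. Qed.

Definition ccont f : Prop := continuous f /\ exists a c : R, forall x, ~~ (a <= x <= c) -> f x = 0.

Lemma ccont_rint f : ccont f -> rint T f.
Proof. by case=> cf [a [c h]]; exact: cont_compact_rint h. Qed.

Lemma ccontM f h : continuous h -> ccont f -> ccont (fun x => h x * f x).
Proof.
move=> ch [cf [a [c e]]]; split; first by move=> x; apply: cvgM; [exact: ch|exact: cf].
by exists a, c => x xac; rewrite e // mulr0.
Qed.

Lemma ccontD f h : ccont f -> ccont h -> ccont (fun x => f x + h x).
Proof.
move=> [cf [a [c e]]] [ch [a' [c' e']]]; split; first by move=> x; apply: cvgD; [exact: cf|exact: ch].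
exists (Num.min a a'), (Num.max c c') => x.
rewrite negb_and -!ltNge !(lt_min, gt_max) => /orP[/andP[h1 h2]|/andP[h1 h2]]; rewrite e ?e' ?add0r //.
all: by rewrite negb_and -!ltNge ?h1 ?h2 ?orbT.
Qed.

Lemma ccontN f : ccont f -> ccont (fun x => - f x).
Proof.
move=> hf; have c1 : continuous ((fun=> -1) : R -> R) by move=> x; exact: cvg_cst.
have := ccontM c1 hf; rewrite (_ : (fun x => -1 * f x) = (fun x => - f x)) //.
by apply/funext => x; rewrite mulN1r.
Qed.

Lemma ccont_measurable f : ccont f -> measurable_fun T f.
Proof. by case=> cf _; exact: continuous_measurable_fun. Qed.

Lemma ccont_sq f : ccont f -> rint T (fun x => f x ^+ 2).
Proof. by move=> h; exact: (ccont_rint (ccontM h.1 h)). Qed.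

Lemma ccont_mulL2 f h : ccont f -> measurable_fun T h -> rint T (fun x => h x ^+ 2) ->
  rint T (fun x => f x * h x).
Proof. by move=> cf mh h2; apply: rint_mul => //; [exact: ccont_measurable|exact: ccont_sq]. Qed.

Lemma compact_itv (A : set R) : compact A -> exists a c : R, A `<=` `[a, c].
Proof.
move=> /compact_bounded[M [_ hM]]; exists (- (M + 1)), (M + 1) => x Ax /=; rewrite in_itv /=.
by rewrite -ler_norml; apply: hM => //; rewrite ltrDl.
Qed.

Lemma testfn_ccont f : testfn T f -> ccont f.
Proof.
move=> tf; split; first by have [df [h _ _ _]] := testfn_hasder tf; move=> x; exact: hasder_continuous (h x).
case: tf => _ [A [/compact_itv[a [c sub]] _ h]]; exists a, c => x xac; apply: h => /sub /=.
by rewrite in_itv /=; exact/negP.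
Qed.

Lemma smooth0 : smooth (fun=> 0 : R).
Proof. by apply/smoothP => n; exact: Ck_cst. Qed.

Lemma test_comp u : test_spinor T u -> forall b, testfn T (comp1 b u) /\ testfn T (comp2 b u).
Proof.
case=> s1 s2 [A [cA _ h]] b; split; split.
- by case: b; [exact: s1.2|exact: s1.1].
- by exists A; split=> // x /h e; rewrite /comp1 e; case: b.
- by case: b; [exact: s2.2|exact: s2.1].
- by exists A; split=> // x /h e; rewrite /comp2 e; case: b.
Qed.

Lemma csmooth_cpart b f : smooth f -> csmooth (fun x => cpart b (f x)).
Proof.
move=> sf; case: b; split.
- by change (smooth (fun=> 0 : R)); exact: smooth0.
- by change (smooth f).
- by change (smooth f).
- by change (smooth (fun=> 0 : R)); exact: smooth0.
Qed.

Lemma test_spinor1 (D : set R) b f : testfn D f -> test_spinor D (fun x => (cpart b (f x), 0)).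
Proof.
case=> sf [A [cA AD h]]; split.
- exact: csmooth_cpart.
- by split; exact: smooth0.
- by exists A; split=> // x /h ->; case: b.
Qed.

Lemma test_spinor2 (D : set R) b f : testfn D f -> test_spinor D (fun x => (0, cpart b (f x))).
Proof.
case=> sf [A [cA AD h]]; split.
- by split; exact: smooth0.
- exact: csmooth_cpart.
- by exists A; split=> // x /h ->; case: b.
Qed.

Lemma cderive0 x : cderive (fun=> 0 : R[i]) x = 0.
Proof. by rewrite /cderive derive1_cst. Qed.

Lemma cderive_cpart b f x (d : R) : hasder f x d -> cderive (fun y => cpart b (f y)) x = cpart b d.
Proof. by move=> /hasder_derive[_ e]; case: b; rewrite /cderive /= derive1_cst e. Qed.

Lemma cpartD b (k l : R) : cpart b (k + l) = cpart b k + cpart b l.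
Proof. by case: b; rewrite /cpart /=; congr (_ +i* _); rewrite addr0. Qed.

Lemma cpartN b (k : R) : cpart b (- k) = - cpart b k.
Proof. by case: b; rewrite /cpart /=; congr (_ +i* _); rewrite oppr0. Qed.

Lemma cpartZ b (k l : R) : cpart b (k * l) = k%:C * cpart b l.
Proof. by case: b; rewrite /cpart /=; congr (_ +i* _); ring. Qed.

(** Testing with a purely real or purely imaginary scalar and keeping the real part of the inner
    product isolates a single real coordinate of the other factor. *)
Lemma Re_cpart (w p q : R) b (z t : R[i]) :
  complex.Re (w%:C * (cpart b p * conjc z + cpart b q * conjc t)) = w * (p * part b z + q * part b t).
Proof. by case: b z t => -[? ?] [? ?] /=; ring. Qed.

Lemma sq_locint f : measurable_fun T f -> rint T (fun x => f x ^+ 2) -> locally_integrable T f.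
Proof.
move=> mf f2; split=> //; first exact: openT.
move=> A _ cA; have [a [c sub]] := compact_itv cA.
have mA : measurable A by exact: compact_measurable.
have h : rint `[a, c] f.
  apply: rint_L1loc => //; first exact: itv_fin.
    exact: measurable_funS mf.
  exact: (rintS measurableT _ _ f2).
by have /integrableP[_] := rintS (measurable_itv _) mA sub h.
Qed.

Lemma L2T_comp u : L2 T one u -> forall b, [/\ measurable_fun T (comp1 b u), measurable_fun T (comp2 b u),
  rint T (fun x => comp1 b u x ^+ 2) & rint T (fun x => comp2 b u x ^+ 2)].
Proof.
move=> h b; have [//||//|m1 m2 i1 i2] := L2_comp _ _ _ h b.
  exact: measurable_cst.
split=> //; [move: i1|move: i2]; by under eq_fun do rewrite mul1r.
Qed.

Lemma L2_seg f (a c : R) : measurable_fun T f -> rint T (fun x => f x ^+ 2) -> rint `[a, c] f.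
Proof.
move=> mf f2; apply: rint_L1loc => //; first exact: itv_fin.
  exact: measurable_funS mf.
exact: (rintS measurableT _ _ f2).
Qed.

Lemma cont_mulL2 h f (a c : R) : continuous h -> measurable_fun T f -> rint T (fun x => f x ^+ 2) ->
  rint `[a, c] (fun x => h x * f x).
Proof. by move=> ch mf f2; apply: rint_contM; [move=> x _; exact: ch|exact: L2_seg]. Qed.

Lemma segment_closedT : segment_closed T.
Proof. by []. Qed.

(** The equation [g = dirac_op v] solved for the derivatives of the two components, read through
    absolutely continuous representatives of one real coordinate of [v]. *)
Definition weakly b v g Y1 Y2 : Prop :=
  [/\ abscont T Y1 (fun x => comp2 b g x - (B12 x * comp1 b v x + B22 x * comp2 b v x)),
     abscont T Y2 (fun x => (B11 x * comp1 b v x + B12 x * comp2 b v x) - comp1 b g x),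
     (\forall x \ae mu, T x -> Y1 x = comp1 b v x) &
     (\forall x \ae mu, T x -> Y2 x = comp2 b v x)].

(** Test spinors with a single nonzero entry decouple the two equations: the second entry yields the
    weak derivative of the first component of [v], the first entry that of the second component. *)
Lemma adjoint_weakly v g : T1 (v, g) -> forall b, exists Y1 Y2 : R -> R, weakly b v g Y1 Y2.
Proof.
case=> /= Lv Lg hadj b.
have [mv1 mv2 iv1 iv2] := L2T_comp Lv b; have [mg1 mg2 ig1 ig2] := L2T_comp Lg b.
have [Y1 [a1 e1]] : exists Y1, abscont T Y1 (fun x => comp2 b g x - (B12 x * comp1 b v x + B22 x * comp2 b v x)) /\
    (\forall x \ae mu, T x -> Y1 x = comp1 b v x).
  apply: abscont_exists => //.
  - exact: openT.
  - by exists 0.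
  - by rewrite patch_setT; exact: sq_locint.
  - by move=> x z _ _; apply: rintB => //; [exact: L2_seg|apply: rintD => //; exact: cont_mulL2].
  move=> f df tf hf; have [df' [hf' _ _ tdf]] := testfn_hasder tf.
  have edf : df' = df by apply/funext => x; exact: hasder_uniq (hf' x) (hf x).
  rewrite {df' hf'}edf in tdf; have cf := testfn_ccont tf; have cdf := testfn_ccont tdf.
  pose u : spinor R := fun x => (0, cpart b (f x)).
  have du x : dirac_op u x = (cpart b (- df x + B12 x * f x), cpart b (B22 x * f x)).
    rewrite /dirac_op /u /= cderive0 (cderive_cpart b (hf x)) !mulr0 !add0r.
    by rewrite cpartD cpartN !cpartZ.
  have := hadj u (dirac_op u) (conj (test_spinor2 b tf) erefl).
  move=> /(congr1 (@complex.Re R)) /= eq1.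
  have i1 := ccont_mulL2 cdf mv1 iv1.
  have i2 := ccont_mulL2 (ccontM c12 cf) mv1 iv1.
  have i3 := ccont_mulL2 (ccontM c22 cf) mv2 iv2.
  have i4 := ccont_mulL2 cf mg2 ig2.
  have e1 : RI T (fun x => - (df x * comp1 b v x) + (B12 x * f x * comp1 b v x + B22 x * f x * comp2 b v x))
     = RI T (fun x => f x * comp2 b g x).
    transitivity (RI T (fun x => complex.Re (1%:C * ((dirac_op u x).1 * conjc (v x).1 + (dirac_op u x).2 * conjc (v x).2)))).
      apply: RI_ext => x _; rewrite du Re_cpart /comp1 /comp2 /=; ring.
    transitivity (RI T (fun x => complex.Re (1%:C * ((u x).1 * conjc (g x).1 + (u x).2 * conjc (g x).2)))); first exact: eq1.
    apply: RI_ext => x _; have -> : (u x).1 = cpart b 0 by case: (b).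
    rewrite Re_cpart /comp1 /comp2 /=; ring.
  have j1 : rint T (fun x => - (df x * comp1 b v x)) by exact: rintN.
  have j2 : rint T (fun x => B12 x * f x * comp1 b v x + B22 x * f x * comp2 b v x) by exact: rintD.
  move: e1; rewrite RID // RIN // => e1.
  have -> : RI T (fun x => f x * (comp2 b g x - (B12 x * comp1 b v x + B22 x * comp2 b v x))) =
    RI T (fun x => f x * comp2 b g x) - RI T (fun x => B12 x * f x * comp1 b v x + B22 x * f x * comp2 b v x).
    by rewrite -RIB //; apply: RI_ext => x _; ring.
  rewrite -e1; ring.
have [Y2 [a2 e2]] : exists Y2, abscont T Y2 (fun x => (B11 x * comp1 b v x + B12 x * comp2 b v x) - comp1 b g x) /\
    (\forall x \ae mu, T x -> Y2 x = comp2 b v x).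
  apply: abscont_exists => //.
  - exact: openT.
  - by exists 0.
  - by rewrite patch_setT; exact: sq_locint.
  - by move=> x z _ _; apply: rintB => //; [apply: rintD => //; exact: cont_mulL2|exact: L2_seg].
  move=> f df tf hf; have [df' [hf' _ _ tdf]] := testfn_hasder tf.
  have edf : df' = df by apply/funext => x; exact: hasder_uniq (hf' x) (hf x).
  rewrite {df' hf'}edf in tdf; have cf := testfn_ccont tf; have cdf := testfn_ccont tdf.
  pose u : spinor R := fun x => (cpart b (f x), 0).
  have du x : dirac_op u x = (cpart b (B11 x * f x), cpart b (df x + B12 x * f x)).
    rewrite /dirac_op /u /= cderive0 (cderive_cpart b (hf x)) !mulr0 oppr0 !addr0.
    by rewrite cpartD !cpartZ.
  have := hadj u (dirac_op u) (conj (test_spinor1 b tf) erefl).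
  move=> /(congr1 (@complex.Re R)) /= eq1.
  have i1 := ccont_mulL2 cdf mv2 iv2.
  have i2 := ccont_mulL2 (ccontM c11 cf) mv1 iv1.
  have i3 := ccont_mulL2 (ccontM c12 cf) mv2 iv2.
  have i4 := ccont_mulL2 cf mg1 ig1.
  have e2 : RI T (fun x => df x * comp2 b v x + (B11 x * f x * comp1 b v x + B12 x * f x * comp2 b v x))
     = RI T (fun x => f x * comp1 b g x).
    transitivity (RI T (fun x => complex.Re (1%:C * ((dirac_op u x).1 * conjc (v x).1 + (dirac_op u x).2 * conjc (v x).2)))).
      apply: RI_ext => x _; rewrite du Re_cpart /comp1 /comp2 /=; ring.
    transitivity (RI T (fun x => complex.Re (1%:C * ((u x).1 * conjc (g x).1 + (u x).2 * conjc (g x).2)))); first exact: eq1.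
    apply: RI_ext => x _; have -> : (u x).2 = cpart b 0 by case: (b).
    rewrite Re_cpart /comp1 /comp2 /=; ring.
  have j2 : rint T (fun x => B11 x * f x * comp1 b v x + B12 x * f x * comp2 b v x) by exact: rintD.
  move: e2; rewrite RID // => e2.
  have -> : RI T (fun x => f x * (B11 x * comp1 b v x + B12 x * comp2 b v x - comp1 b g x)) =
    RI T (fun x => B11 x * f x * comp1 b v x + B12 x * f x * comp2 b v x) - RI T (fun x => f x * comp1 b g x).
    by rewrite -RIB //; apply: RI_ext => x _; ring.
  rewrite -e2; ring.
by exists Y1, Y2.
Qed.

Lemma L2_mul f h : measurable_fun T f -> measurable_fun T h -> rint T (fun x => f x ^+ 2) ->
  rint T (fun x => h x ^+ 2) -> rint T (fun x => f x * h x).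
Proof. by move=> mf mh; exact: rint_mul. Qed.

(** The difference of the two sides is the integral of the density of the Wronskian [Y1 Z2 - Y2 Z1],
    the coefficient terms cancelling by symmetry of the matrix. The Wronskian is itself a
    combination of products of square-integrable functions, hence integrable on the line, and
    [RI_abscont_eq0] removes its boundary terms. *)
Lemma weakly_green v g z k b b' Y1 Y2 Z1 Z2 : L2 T one v -> L2 T one g -> L2 T one z -> L2 T one k ->
  weakly b v g Y1 Y2 -> weakly b' z k Z1 Z2 ->
  RI T (fun x => comp1 b g x * comp1 b' z x) + RI T (fun x => comp2 b g x * comp2 b' z x) =
  RI T (fun x => comp1 b v x * comp1 b' k x) + RI T (fun x => comp2 b v x * comp2 b' k x).
Proof.
move=> Lv Lg Lz Lk [aY1 aY2 eY1 eY2] [aZ1 aZ2 eZ1 eZ2].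
have [mv1 mv2 iv1 iv2] := L2T_comp Lv b; have [mg1 mg2 ig1 ig2] := L2T_comp Lg b.
have [mz1 mz2 iz1 iz2] := L2T_comp Lz b'; have [mk1 mk2 ik1 ik2] := L2T_comp Lk b'.
pose w x := (comp1 b g x * comp1 b' z x + comp2 b g x * comp2 b' z x) -
  (comp1 b v x * comp1 b' k x + comp2 b v x * comp2 b' k x).
have i1 := L2_mul mg1 mz1 ig1 iz1; have i2 := L2_mul mg2 mz2 ig2 iz2.
have i3 := L2_mul mv1 mk1 iv1 ik1; have i4 := L2_mul mv2 mk2 iv2 ik2.
have wi : rint T w by apply: rintB => //; exact: rintD.
apply/eqP; rewrite -subr_eq0 -!RID // -RIB //; [|exact: rintD|exact: rintD].
apply/eqP; change (RI T w = 0).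
have aW := abscontB (@abscontM R T _ _ _ _ openT segment_closedT aY1 aZ2) (@abscontM R T _ _ _ _ openT segment_closedT aY2 aZ1).
have {}aW : abscont T (fun x => Y1 x * Z2 x - Y2 x * Z1 x) w.
  apply: (abscont_ae segment_closedT aW).
    by move=> x y _ _; exact: measurable_funS (rint_measurable wi).
  apply: aeS (aeI (aeI eY1 eY2) (aeI eZ1 eZ2)) => x [[h1 h2] [h3 h4]] _.
  rewrite h1 // h2 // h3 // h4 // /w; ring.
apply: (RI_abscont_eq0 aW) => //.
have j : rint T (fun x => comp1 b v x * comp2 b' z x - comp2 b v x * comp1 b' z x).
  by apply: rintB => //; exact: L2_mul.
apply: rint_ae j => //.
  by apply: continuous_measurable_fun => x; exact: (abscont_continuous openT aW).
apply: aeS (aeI (aeI eY1 eY2) (aeI eZ1 eZ2)) => x [[h1 h2] [h3 h4]] _.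
by rewrite h1 // h2 // h3 // h4.
Qed.

Lemma part_innerT u v : L2 T one u -> L2 T one v ->
  let S b b' := RI T (fun x => comp1 b u x * comp1 b' v x) +
                RI T (fun x => comp2 b u x * comp2 b' v x) in
  inner T one u v = (S false false + S true true) +i* (S true false - S false true).
Proof.
move=> Lu Lv S; have e (f : R -> R) : (fun x : R => 1 * f x) = f by apply/funext => x; rewrite mul1r.
rewrite part_inner //; first by rewrite /S !e.
move=> b b'; rewrite !e.
have [mv1 mv2 iv1 iv2] := L2T_comp Lu b; have [mg1 mg2 ig1 ig2] := L2T_comp Lv b'.
by split; exact: L2_mul.
Qed.

Lemma adjoint_symmetric : T1 `<=` adjoint T one T1.
Proof.
move=> [v g] h1; case: (h1) => /= Lv Lg _; split=> //= u f h2; case: (h2) => /= Lu Lf _.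
rewrite !part_innerT //; have w1 := adjoint_weakly h1; have w2 := adjoint_weakly h2.
have S b b' : RI T (fun x => comp1 b f x * comp1 b' v x) + RI T (fun x => comp2 b f x * comp2 b' v x) =
  RI T (fun x => comp1 b u x * comp1 b' g x) + RI T (fun x => comp2 b u x * comp2 b' g x).
  have [Y1 [Y2 hY]] := w2 b; have [Z1 [Z2 hZ]] := w1 b'.
  exact: weakly_green hY hZ.
by rewrite !S.
Qed.

(* Integration by parts against test functions: the Wronskian has compact support. *)
Lemma C1_green (y1 y2 z1 z2 dz1 dz2 : R -> R) : testfn T y1 -> testfn T y2 ->
  (forall x, hasder z1 x (dz1 x)) -> (forall x, hasder z2 x (dz2 x)) ->
  continuous dz1 -> continuous dz2 ->
  let k1 x := B11 x * z1 x + (- dz2 x + B12 x * z2 x) in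
  let k2 x := dz1 x + B12 x * z1 x + B22 x * z2 x in
  RI T (fun x => (B11 x * y1 x + (- y2^`()%classic x + B12 x * y2 x)) * z1 x) +
  RI T (fun x => (y1^`()%classic x + B12 x * y1 x + B22 x * y2 x) * z2 x) =
  RI T (fun x => y1 x * k1 x) + RI T (fun x => y2 x * k2 x).
Proof.
move=> t1 t2 hz1 hz2 cz1 cz2 k1 k2.
have [d1 [h1 cd1 _ td1]] := testfn_hasder t1; have [d2 [h2 cd2 _ td2]] := testfn_hasder t2.
have e1 x : y1^`()%classic x = d1 x by have [] := hasder_derive (h1 x).
have e2 x : y2^`()%classic x = d2 x by have [] := hasder_derive (h2 x).
have c1 := testfn_ccont t1; have c2 := testfn_ccont t2.
have cc1 := testfn_ccont td1; have cc2 := testfn_ccont td2.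
have cZ1 : continuous z1 by move=> x; exact: hasder_continuous (hz1 x).
have cZ2 : continuous z2 by move=> x; exact: hasder_continuous (hz2 x).
have ck1 : continuous k1.
  move=> x; apply: cvgD; first by apply: cvgM; [exact: c11|exact: cZ1].
  by apply: cvgD; [apply: cvgN; exact: cz2|apply: cvgM; [exact: c12|exact: cZ2]].
have ck2 : continuous k2.
  move=> x; apply: cvgD; last by apply: cvgM; [exact: c22|exact: cZ2].
  by apply: cvgD; [exact: cz1|apply: cvgM; [exact: c12|exact: cZ1]].
have r (f : R -> R) (h : R -> R) : continuous h -> ccont f -> ccont (fun x => f x * h x).
  move=> ch cf; have := ccontM ch cf; congr ccont; by apply/funext => x; rewrite mulrC.
pose f1 x := B11 x * y1 x + (- d2 x + B12 x * y2 x).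
pose f2 x := d1 x + B12 x * y1 x + B22 x * y2 x.
have cf1 : ccont f1.
  by apply: ccontD; [exact: ccontM|apply: ccontD; [exact: ccontN|exact: ccontM]].
have cf2 : ccont f2 by apply: ccontD; [apply: ccontD => //; exact: ccontM|exact: ccontM].
rewrite (_ : RI T _ = RI T (fun x => f1 x * z1 x)); last by apply: RI_ext => x _; rewrite e2.
rewrite (_ : RI T (fun x => (_ + B22 x * y2 x) * z2 x) = RI T (fun x => f2 x * z2 x)); last first.
  by apply: RI_ext => x _; rewrite e1.
have j1 := ccont_rint (r _ _ cZ1 cf1); have j2 := ccont_rint (r _ _ cZ2 cf2).
have j3 := ccont_rint (r _ _ ck1 c1); have j4 := ccont_rint (r _ _ ck2 c2).
pose w x := (f1 x * z1 x + f2 x * z2 x) - (y1 x * k1 x + y2 x * k2 x).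
have cw : ccont w.
  apply: ccontD; first by apply: ccontD; exact: r.
  by apply: ccontN; apply: ccontD; exact: r.
apply/eqP; rewrite -subr_eq0 -!RID // -RIB //; [|exact: rintD|exact: rintD].
apply/eqP; change (RI T w = 0).
apply: (@RI_abscont_eq0 _ (fun x => y1 x * z2 x - y2 x * z1 x)).
- split; first by move=> x z _ _; apply: rint_contf => t _; exact: cw.1.
  move=> x z _ _ xz; rewrite (@RI_FTC _ w (fun x => y1 x * z2 x - y2 x * z1 x)) //; last first.
    by move=> t _; exact: cw.1.
  move=> t _; apply: hasder_eq (hasderD (hasderM (h1 t) (hz2 t)) (hasderN (hasderM (h2 t) (hz1 t)))) _.
  rewrite /w /f1 /f2 /k1 /k2; ring.
- by apply: ccont_rint; apply: ccontD; [exact: r|apply: ccontN; exact: r].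
- exact: ccont_rint.
Qed.

Lemma ccont_L2 u : (forall b, ccont (comp1 b u) /\ ccont (comp2 b u)) -> L2 T one u.
Proof.
move=> h; apply: L2_intro; [exact: measurableT|exact: measurable_cst|by move=> *; exact: ler01|].
move=> b; have [c1 c2] := h b; split; try exact: ccont_measurable.
- by under eq_fun do rewrite mul1r; exact: ccont_sq.
- by under eq_fun do rewrite mul1r; exact: ccont_sq.
Qed.

Lemma test_L2 u : test_spinor T u -> L2 T one u /\ L2 T one (dirac_op u).
Proof.
move=> tu; have tc := test_comp tu; split; apply: ccont_L2 => b; have [t1 t2] := tc b.
  by split; exact: testfn_ccont.
have [d1 [h1 cd1 _ td1]] := testfn_hasder t1; have [d2 [h2 cd2 _ td2]] := testfn_hasder t2.
have e1 : (comp1 b u)^`()%classic = d1 by apply/funext => x; have [] := hasder_derive (h1 x).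
have e2 : (comp2 b u)^`()%classic = d2 by apply/funext => x; have [] := hasder_derive (h2 x).
have c1 := testfn_ccont t1; have c2 := testfn_ccont t2.
have cc1 := testfn_ccont td1; have cc2 := testfn_ccont td2.
split.
- rewrite (_ : comp1 b (dirac_op u) = (fun x => B11 x * comp1 b u x + (- d2 x + B12 x * comp2 b u x))).
    by apply: ccontD; [exact: ccontM|apply: ccontD; [exact: ccontN|exact: ccontM]].
  by apply/funext => x; rewrite dirac_comp1 e2.
- rewrite (_ : comp2 b (dirac_op u) = (fun x => d1 x + B12 x * comp1 b u x + B22 x * comp2 b u x)).
    by apply: ccontD; [apply: ccontD => //; exact: ccontM|exact: ccontM].
  by apply/funext => x; rewrite dirac_comp2 e1.
Qed.

(** A criterion for membership in the domain of the adjoint that fits both test spinors and the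
    explicit eigenfunctions constructed later. *)
Lemma C1_adjoint v g : L2 T one v -> L2 T one g ->
  (forall b, exists d1 d2 : R -> R, [/\ forall x, hasder (comp1 b v) x (d1 x),
      forall x, hasder (comp2 b v) x (d2 x), continuous d1, continuous d2 &
      forall x, comp1 b g x = B11 x * comp1 b v x + (- d2 x + B12 x * comp2 b v x) /\
                comp2 b g x = d1 x + B12 x * comp1 b v x + B22 x * comp2 b v x]) ->
  T1 (v, g).
Proof.
move=> Lv Lg hv; split=> //= u f [/= tu ->].
have [Lu Lf] := test_L2 tu; rewrite !part_innerT //.
have S b b' : RI T (fun x => comp1 b (dirac_op u) x * comp1 b' v x) + RI T (fun x => comp2 b (dirac_op u) x * comp2 b' v x) =
  RI T (fun x => comp1 b u x * comp1 b' g x) + RI T (fun x => comp2 b u x * comp2 b' g x).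
  have [d1 [d2 [h1 h2 cd1 cd2 e]]] := hv b'; have [t1 t2] := test_comp tu b.
  have := C1_green t1 t2 h1 h2 cd1 cd2 => /= G.
  rewrite (_ : RI T (fun x => comp1 b (dirac_op u) x * _) = RI T (fun x => (B11 x * comp1 b u x +
    (- (comp2 b u)^`()%classic x + B12 x * comp2 b u x)) * comp1 b' v x)); last first.
    by apply: RI_ext => x _; rewrite dirac_comp1.
  rewrite (_ : RI T (fun x => comp2 b (dirac_op u) x * _) = RI T (fun x => ((comp1 b u)^`()%classic x +
    B12 x * comp1 b u x + B22 x * comp2 b u x) * comp2 b' v x)); last first.
    by apply: RI_ext => x _; rewrite dirac_comp2.
  rewrite G; congr (_ + _); apply: RI_ext => x _; by have [E1 E2] := e x; rewrite ?E1 ?E2.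
by rewrite !S.
Qed.

Lemma minimal_sub_adjoint : T0 `<=` T1.
Proof.
move=> [u f] [/= tu ->]; have [Lu Lf] := test_L2 tu; apply: C1_adjoint => // b.
have [t1 t2] := test_comp tu b.
have [d1 [h1 cd1 _ td1]] := testfn_hasder t1; have [d2 [h2 cd2 _ td2]] := testfn_hasder t2.
exists d1, d2; split=> // x; rewrite dirac_comp1 dirac_comp2.
by have [_ ->] := hasder_derive (h1 x); have [_ ->] := hasder_derive (h2 x).
Qed.

Lemma adjointS (D : set R) (w : R -> R) (A B : operator R) : A `<=` B -> adjoint D w B `<=` adjoint D w A.
Proof. by move=> AB [v g] [h1 h2 h3]; split=> // u f /AB; exact: h3. Qed.

(** Taking adjoints reverses inclusions. From [T0 <= T1] and symmetry of [T1], the operator [T1]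
    equals its adjoint. Any self-adjoint [S] above [T0] lies below [T1], and taking adjoints once
    more puts [T1] below [S]. *)
Lemma dirac_selfadjoint : the_selfadjoint_extension T one T0 = T1.
Proof.
have s1 : selfadjoint_extension T one T0 T1.
  split; first exact: minimal_sub_adjoint.
  apply/seteqP; split; first exact: adjoint_symmetric.
  by apply: adjointS; exact: minimal_sub_adjoint.
have : selfadjoint_extension T one T0 (the_selfadjoint_extension T one T0).
  by apply: (@xgetPex _ T0 [set S | selfadjoint_extension T one T0 S]); exists T1.
case=> s2 s3; apply/seteqP; split; first by rewrite {1}s3; exact: adjointS.
case: (s1) => _ ->; rewrite s3; apply: adjointS; rewrite s3; exact: adjointS.
Qed.

End DiracOperator.

(** * Gronwall inequalities *)

Section Gronwall.
Variable R : realType.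
Implicit Types (N h dN dh f : R -> R) (a b x : R).

Lemma gronwall_ge N h dN dh a b : a <= b ->
  (forall x, a <= x <= b -> hasder N x (dN x)) -> (forall x, a <= x <= b -> hasder h x (dh x)) ->
  (forall x, a <= x <= b -> 0 <= dN x + dh x * N x) ->
  N a * expR (h a) <= N b * expR (h b).
Proof.
move=> ab hN hh h0.
apply: (@hasder_ge0_le _ (fun x => N x * expR (h x)) (fun x => (dN x + dh x * N x) * expR (h x))) => //.
  move=> x xab; apply: hasder_eq (hasderM (hN x xab) (hasder_comp (hasder_expR _) (hh x xab))) _; ring.
by move=> x xab; rewrite mulr_ge0 ?h0 // expR_ge0.
Qed.

Lemma gronwall_le N h dN dh a b : a <= b ->
  (forall x, a <= x <= b -> hasder N x (dN x)) -> (forall x, a <= x <= b -> hasder h x (dh x)) ->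
  (forall x, a <= x <= b -> dN x + dh x * N x <= 0) ->
  N b * expR (h b) <= N a * expR (h a).
Proof.
move=> ab hN hh h0.
have := @gronwall_ge (fun x => - N x) h (fun x => - dN x) dh a b ab _ hh.
rewrite !mulNr lerN2; apply; first by move=> x xab; exact: hasderN (hN x xab).
by move=> x xab; have := h0 x xab; rewrite mulrN; lra.
Qed.

(** Uniqueness for linear systems: the functions N exp(c x) and N exp(-c x) are monotone in opposite
    directions, so a zero of [N] would propagate to both sides. *)
Lemma gronwall_cst N dN (c : R) : (forall x, hasder N x (dN x)) -> (forall x, 0 <= N x) ->
  (forall x, `|dN x| <= c * N x) -> (exists x, N x != 0) -> forall x, 0 < N x.
Proof.
move=> hN N0 hc [z Nz] x; rewrite lt_neqAle N0 andbT; apply/eqP => Nx.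
have pz : 0 < N z by rewrite lt_neqAle eq_sym Nz N0.
have hl (k t : R) : hasder (fun t => k * t) t k.
  by apply: hasder_eq (hasderM (hasder_cst k t) (hasder_id t)) _; rewrite mul0r add0r mulr1.
have hc' t : - (c * N t) <= dN t <= c * N t by rewrite -ler_norml.
case: (leP x z) => xz.
  have : N z * expR (- c * z) <= N x * expR (- c * x).
    apply: (@gronwall_le N (fun t => - c * t) dN (fun=> - c)) => // t _.
    by have := hc' t; lra.
  by rewrite -Nx mul0r leNgt mulr_gt0 ?expR_gt0.
have : N z * expR (c * z) <= N x * expR (c * x).
  apply: (@gronwall_ge N (fun t => c * t) dN (fun=> c)) => // [|t _]; first exact: ltW.

  by have := hc' t; lra.
by rewrite -Nx mul0r leNgt mulr_gt0 ?expR_gt0.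
Qed.

End Gronwall.

(** * Eigenfunctions as classical real solutions *)

Section Eigenfunctions.
Variable R : realType.
Notation mu := (@lebesgue_measure R).
Notation T := [set: R].
Notation one := (fun=> 1 : R).
Variables (B11 B12 B22 : R -> R) (K : R).
Hypotheses (c11 : continuous B11) (c12 : continuous B12) (c22 : continuous B22).
Hypotheses (b11 : forall x, `|B11 x| <= K) (b12 : forall x, `|B12 x| <= K) (b22 : forall x, `|B22 x| <= K).

(** Continuity of the coefficients makes the weak solution differentiable. One of the two real
    coordinates is not almost everywhere zero, and uniqueness turns this into a solution vanishing
    nowhere. *)
Lemma dirac_eigenfunction (u : spinor R) (om : R) :
  adjoint T one (minimal_operator T (dirac_op B11 B12 B22)) (u, fun x => (om%:C * (u x).1, om%:C * (u x).2)) ->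
  ~ {ae mu, forall x, T x -> u x = (0, 0)} ->
  exists y1 y2 : R -> R,
  [/\ forall x, hasder y1 x (- B12 x * y1 x + (om - B22 x) * y2 x),
      forall x, hasder y2 x ((B11 x - om) * y1 x + B12 x * y2 x),
      rint T (fun x => y1 x ^+ 2 + y2 x ^+ 2) &
      forall x, 0 < y1 x ^+ 2 + y2 x ^+ 2].
Proof.
move=> hT nz.
pose g : spinor R := fun x => (om%:C * (u x).1, om%:C * (u x).2).
have Lu : L2 T one u by case: hT.
have hW := adjoint_weakly c11 c12 c22 hT.
have sol b : exists y1 y2 : R -> R,
  [/\ forall x, hasder y1 x (- B12 x * y1 x + (om - B22 x) * y2 x),
      forall x, hasder y2 x ((B11 x - om) * y1 x + B12 x * y2 x),
      rint T (fun x => y1 x ^+ 2 + y2 x ^+ 2),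
      (\forall x \ae mu, T x -> y1 x = comp1 b u x) & (\forall x \ae mu, T x -> y2 x = comp2 b u x)].
  have [Y1 [Y2 [a1 a2 e1 e2]]] := hW b.
  have C1 : continuous Y1 by move=> x; exact: (abscont_continuous openT a1).
  have C2 : continuous Y2 by move=> x; exact: (abscont_continuous openT a2).
  have cc1 : continuous (fun x => - B12 x * Y1 x + (om - B22 x) * Y2 x).
    move=> x; apply: cvgD; apply: cvgM; [apply: cvgN; exact: c12|exact: C1| |exact: C2].
    by apply: cvgB; [exact: cvg_cst|exact: c22].
  have cc2 : continuous (fun x => (B11 x - om) * Y1 x + B12 x * Y2 x).
    move=> x; apply: cvgD; apply: cvgM; [|exact: C1|exact: c12|exact: C2].
    by apply: cvgB; [exact: c11|exact: cvg_cst].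
  have a1' : abscont T Y1 (fun x => - B12 x * Y1 x + (om - B22 x) * Y2 x).
    apply: (abscont_ae (@segment_closedT R) a1).
      by move=> x z _ _; apply: measurable_funTS; exact: continuous_measurable_fun.
    apply: aeS (aeI e1 e2) => x [h1 h2] _; rewrite h1 // h2 // /comp2 /comp1 /= partZ; ring.
  have a2' : abscont T Y2 (fun x => (B11 x - om) * Y1 x + B12 x * Y2 x).
    apply: (abscont_ae (@segment_closedT R) a2).
      by move=> x z _ _; apply: measurable_funTS; exact: continuous_measurable_fun.
    apply: aeS (aeI e1 e2) => x [h1 h2] _; rewrite h1 // h2 // /comp2 /comp1 /= partZ; ring.
  exists Y1, Y2; split=> //.
  - by move=> x; exact: (abscont_hasder openT a1' I (cc1 x)).
  - by move=> x; exact: (abscont_hasder openT a2' I (cc2 x)).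
  - have [mu1 mu2 i1 i2] := L2T_comp Lu b.
    apply: rint_ae (rintD measurableT i1 i2) => //.
      apply: continuous_measurable_fun => x; apply: cvgD; rewrite expr2; apply: cvgM; by [exact: C1|exact: C2].
    by apply: aeS (aeI e1 e2) => x [h1 h2] _; rewrite h1 // h2.
have [b nzb] : exists b, ~ (\forall x \ae mu, T x -> comp1 b u x = 0 /\ comp2 b u x = 0).
  apply: contrapT => h; apply: nz.
  have hh b : \forall x \ae mu, T x -> comp1 b u x = 0 /\ comp2 b u x = 0.
    by apply: contrapT => h2; apply: h; exists b.
  apply: aeS (aeI (hh false) (hh true)) => x [h1 h2] _.
  have [h11 h12] := h1 I; have [h21 h22] := h2 I.
  rewrite [u x]surjective_pairing; congr pair; apply: part_inj => -[].
  - exact: h21.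
  - exact: h11.
  - exact: h22.
  - exact: h12.
have [y1 [y2 [hy1 hy2 yi e1 e2]]] := sol b.
exists y1, y2; split=> //.
pose dN x := 2 * y1 x * (- B12 x * y1 x + (om - B22 x) * y2 x) + 2 * y2 x * ((B11 x - om) * y1 x + B12 x * y2 x).
(* The spectral parameter cancels in the derivative of the squared norm; what remains, 2 B12 (y2^2 -
   y1^2) + 2 (B11 - B22) y1 y2, is at most [4 * K] times that norm. *)
apply: (@gronwall_cst _ _ dN (4 * K)).
- move=> x; apply: hasder_eq (hasderD (hasderX 2 (hy1 x)) (hasderX 2 (hy2 x))) _.
  by rewrite /dN /= !expr1.
- by move=> x; rewrite addr_ge0 // sqr_ge0.
- move=> x; rewrite /dN.
  have := b11 x; have := b12 x; have := b22 x; rewrite !ler_norml.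
  set p := B11 x; set q := B12 x; set r := B22 x; set s := y1 x; set t := y2 x.
  move=> /andP[h1 h2] /andP[h3 h4] /andP[h5 h6].
  have -> : 2 * s * (- q * s + (om - r) * t) + 2 * t * ((p - om) * s + q * t) =
     2 * q * (t ^+ 2 - s ^+ 2) + 2 * (p - r) * (s * t) by ring.
  have st1 : 0 <= (s + t) ^+ 2 by exact: sqr_ge0.
  have st2 : 0 <= (s - t) ^+ 2 by exact: sqr_ge0.
  have s2 := sqr_ge0 s; have t2 := sqr_ge0 t.
  apply/andP; split; nra.
- apply: contrapT => hn; apply: nzb; apply: aeS (aeI e1 e2) => x [h1 h2] _.
  rewrite -h1 // -h2 //; have /eqP : y1 x ^+ 2 + y2 x ^+ 2 = 0.
    by apply/eqP; apply: contrapT => /negP h; apply: hn; exists x.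
  by rewrite paddr_eq0 ?sqr_ge0 // !sqrf_eq0 => /andP[/eqP -> /eqP ->].
Qed.

End Eigenfunctions.

(** * The radial operator *)

Section Tortoise.
Variable R : realType.
Variables (M a : R).
Hypothesis M0 : 0 < M.
Implicit Types (x r s : R).

Lemma tortoise_hasder r : M < r -> hasder (tortoise M a) r ((r ^+ 2 + a ^+ 2) / (r - M) ^+ 2).
Proof.
move=> Mr; have p : 0 < r - M by rewrite subr_gt0.
have hs : hasder (fun r => r - M) r 1.
  by apply: hasder_eq (hasderD (hasder_id r) (hasder_cst (- M) r)) _; rewrite addr0.
have hl : hasder (fun r => ln (r - M)) r ((r - M)^-1 * 1).
  apply: (@hasder_comp _ (@ln R) (fun r => r - M)) => //.
  exact: is_derive1_ln.
have hv := hasderV hs (lt0r_neq0 p).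
apply: hasder_eq (hasderD (hasderD (hasder_id r) (hasderM (hasder_cst (2 * M) r) hl))
  (hasderN (hasderM (hasder_cst (M ^+ 2 + a ^+ 2) r) hv))) _.
by field; rewrite gt_eqF.
Qed.

Lemma d_gt0 r : M < r -> 0 < r ^+ 2 + a ^+ 2.
Proof.
by move=> Mr; rewrite ltr_pwDl ?sqr_ge0 // exprn_gt0 // (lt_trans M0).
Qed.

Lemma tortoise_lt r s : M < r -> r < s -> tortoise M a r < tortoise M a s.
Proof.
move=> Mr rs; apply: (@hasder_gt0_lt R (tortoise M a) (fun r => (r ^+ 2 + a ^+ 2) / (r - M) ^+ 2) r s rs) => t /andP[rt _].
  by apply: tortoise_hasder; exact: lt_le_trans rt.
have Mt : M < t by exact: lt_le_trans rt.
by rewrite divr_gt0 ?d_gt0 // exprn_gt0 // subr_gt0.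
Qed.

Lemma tortoise_surj x : exists r, M < r /\ tortoise M a r = x.
Proof.
pose c := M ^+ 2 + a ^+ 2; have c0 : 0 < c by rewrite ltr_pwDl ?sqr_ge0 // exprn_gt0.
(* At distance [t2 >= 1] from the horizon the logarithm is nonnegative and the pole costs at most
   [c], so the value is at least [M + 1 + |x|]. *)
pose t2 := 1 + `|x| + c; have x1 := ler_norm x; have x2 := ler_norm (- x); rewrite normrN in x2.
have xn := normr_ge0 x.
have h2 : x <= tortoise M a (M + t2).
  have e : M + t2 - M = t2 by rewrite addrC addKr.
  rewrite /tortoise e -/c.
  have l0 : 0 <= 2 * M * ln t2 by rewrite mulr_ge0 ?mulr_ge0 ?(ltW M0) // ln_ge0 // /t2; lra.
  have h : c / t2 <= c by rewrite ler_pdivrMr ?ler_peMr ?(ltW c0) // /t2; lra.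
  have et : t2 = 1 + `|x| + c by [].
  have := M0; lra.
(* At distance [t1 <= 1] the logarithm is nonpositive and the pole contributes
   [- (1 + M + |x| + c)], which outweighs [M + t1]. *)
pose t1 := c / (1 + M + `|x| + c).
have q0 : 0 < 1 + M + `|x| + c by have := M0; lra.
have t10 : 0 < t1 by rewrite divr_gt0.
have t11 : t1 <= 1 by rewrite ler_pdivrMr // mul1r; have := M0; lra.
have h1 : tortoise M a (M + t1) <= x.
  have e : M + t1 - M = t1 by rewrite addrC addKr.
  rewrite /tortoise e -/c.
  have l0 : 2 * M * ln t1 <= 0.
    by rewrite mulr_ge0_le0 ?ln_le0 // mulr_ge0 // ltW.
  have -> : c / t1 = 1 + M + `|x| + c by rewrite /t1 invf_div mulrCA divff ?mulr1 // gt_eqF.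
  lra.
have t12 : M + t1 <= M + t2 by rewrite lerD2l (le_trans t11) // /t2; lra.
have ct : {within `[M + t1, M + t2], continuous (tortoise M a)}.
  apply: hasder_within_continuous => r /andP[r1 _]; apply: tortoise_hasder.
  by apply: lt_le_trans r1; rewrite ltrDl.
have [|r] := @IVT R (tortoise M a) _ _ x t12 ct.
  by rewrite ge_min le_max h1 h2 orbT.
rewrite in_itv /= => /andP[r1 _] <-; exists r; split=> //.
by apply: lt_le_trans r1; rewrite ltrDl.
Qed.

Notation rr := (inv_tortoise M a).

Lemma rr_gtM x : M < rr x.
Proof. by have [] := @xgetPex _ 0 [set r | M < r /\ tortoise M a r = x] (tortoise_surj x). Qed.

Lemma tort_rr x : tortoise M a (rr x) = x.
Proof. by have [] := @xgetPex _ 0 [set r | M < r /\ tortoise M a r = x] (tortoise_surj x). Qed.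

Lemma rr_tort r : M < r -> rr (tortoise M a r) = r.
Proof.
move=> Mr; case: (ltgtP (rr (tortoise M a r)) r) => //.
  by move=> /(tortoise_lt (rr_gtM _)); rewrite tort_rr ltxx.
by move=> /(tortoise_lt Mr); rewrite tort_rr ltxx.
Qed.

Lemma rr_hasder x : hasder rr x ((rr x - M) ^+ 2 / (rr x ^+ 2 + a ^+ 2)).
Proof.
have p : 0 < rr x - M by rewrite subr_gt0 rr_gtM.
have := @is_derive_inverse R (tortoise M a) rr ((rr x ^+ 2 + a ^+ 2) / (rr x - M) ^+ 2) (rr x).
rewrite tort_rr invf_div; apply.
- by near=> r; apply: rr_tort; near: r; apply: lt_nbhsr; exact: rr_gtM.
- near=> r; apply: hasder_continuous; apply: tortoise_hasder; near: r; apply: lt_nbhsr; exact: rr_gtM.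
- by apply: tortoise_hasder; exact: rr_gtM.
- by rewrite gt_eqF // divr_gt0 ?exprn_gt0 // d_gt0 // rr_gtM.
Unshelve. all: end_near. Qed.

Lemma rr_le x y : x <= y -> rr x <= rr y.
Proof.
move=> xy; rewrite leNgt; apply/negP => /(tortoise_lt (rr_gtM _)).
by rewrite !tort_rr ltNge xy.
Qed.

Lemma rr_small e : 0 < e -> exists A, forall x, x <= A -> rr x <= M + e.
Proof.
move=> e0; exists (tortoise M a (M + e)) => x /rr_le; rewrite rr_tort //.
by rewrite ltrDl.
Qed.

Lemma rr_large B : exists A, forall x, A <= x -> B <= rr x.
Proof.
have [MB|BM] := ltP M B; last by exists 0 => x _; apply: le_trans BM _; exact: ltW (rr_gtM x).
by exists (tortoise M a B) => x /rr_le; rewrite rr_tort.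
Qed.

End Tortoise.

(** * The radial operator as a Dirac operator with bounded coefficients *)

Section RadialReduction.
Variable R : realType.
Variables (M a Q e kappa m lambda : R).
Hypothesis M0 : 0 < M.
Hypothesis extreme : M ^+ 2 = a ^+ 2 + Q ^+ 2.
Notation rr := (inv_tortoise M a).
Implicit Types x om : R.

Definition dd x := rr x ^+ 2 + a ^+ 2.
Definition rV x := (a * kappa + e * Q * rr x) / dd x.
Definition rB11 x := m * rr x * (rr x - M) / dd x - rV x.
Definition rB12 x := lambda * (rr x - M) / dd x.
Definition rB22 x := - (m * rr x * (rr x - M) / dd x) - rV x.

Lemma dd_gt0 x : 0 < dd x.
Proof. exact: (@d_gt0 R M a M0 _ (rr_gtM a M0 x)). Qed.

Lemma sqrt_Delta x : Num.sqrt (Delta M a Q (rr x)) = rr x - M.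
Proof.
have -> : Delta M a Q (rr x) = (rr x - M) ^+ 2.
  rewrite /Delta; have : a ^+ 2 + Q ^+ 2 = M ^+ 2 by [].
  by move=> h; rewrite -addrA h; ring.
by rewrite sqrtr_sqr ger0_norm // subr_ge0 ltW // rr_gtM.
Qed.

Lemma radial_dirac : radial_expr M a Q e kappa m lambda = dirac_op rB11 rB12 rB22.
Proof.
by apply/funext => u; apply/funext => x; rewrite /radial_expr /dirac_op sqrt_Delta.
Qed.

Lemma rr_cont : continuous (rr : R -> R).
Proof. by move=> x; exact: (hasder_continuous (rr_hasder a M0 x)). Qed.

Lemma cont_div_dd (f : R -> R) : continuous f -> continuous (fun x => f (rr x) / dd x).
Proof.
move=> cf x; apply: cvgM.
  by apply: (@continuous_comp _ _ _ rr f); [exact: rr_cont|exact: cf].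
apply: cvgV; first by rewrite gt_eqF // dd_gt0.
by apply: cvgD; [rewrite expr2; apply: cvgM; exact: rr_cont|exact: cvg_cst].
Qed.

Lemma quad_over_dd (p q s : R) : exists2 K, 0 <= K & forall x, `|(p * rr x ^+ 2 + q * rr x + s) / dd x| <= K.
Proof.
exists (`|p| + `|q| / M + `|s| / M ^+ 2).
  by rewrite !addr_ge0 // divr_ge0 // ?exprn_ge0 // ltW.
move=> x; have d0 := dd_gt0 x; have rM := rr_gtM a M0 x; have r0 : 0 < rr x by exact: lt_trans rM.
rewrite normrM normfV (gtr0_norm d0) ler_pdivrMr //.
apply: le_trans (_ : `|p| * rr x ^+ 2 + `|q| * rr x + `|s| <= _).
  apply: le_trans (ler_normD _ _) _; rewrite lerD2r; apply: le_trans (ler_normD _ _) _.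
  by rewrite normrM normrX [`|q * _|]normrM (gtr0_norm r0).
have rd : rr x ^+ 2 <= dd x by rewrite /dd lerDl sqr_ge0.
have h1 : `|p| * rr x ^+ 2 <= `|p| * dd x by apply: ler_wpM2l.
have h2 : `|q| * rr x <= `|q| / M * dd x.
  rewrite -mulrA; apply: ler_wpM2l => //; rewrite ler_pdivlMl //.
  by apply: le_trans rd; rewrite expr2; apply: ler_wpM2r; rewrite ltW.
have h3 : `|s| <= `|s| / M ^+ 2 * dd x.
  rewrite -[X in X <= _]mulr1 -mulrA; apply: ler_wpM2l => //; rewrite ler_pdivlMl ?exprn_gt0 // mulr1.
  by apply: le_trans rd; rewrite !expr2; apply: ler_pM; rewrite ltW.
lra.
Qed.

(** Every coefficient of the radial system is a quadratic polynomial in r over r^2 + a^2; since r >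
    M > 0, such a quotient is bounded up to both ends. *)
Lemma coef_form (f : R -> R) (p q s : R) :
  (forall x, f x = (p * rr x ^+ 2 + q * rr x + s) / dd x) ->
  continuous f /\ exists2 K, 0 <= K & forall x, `|f x| <= K.
Proof.
move=> h; have -> : f = (fun x => (p * rr x ^+ 2 + q * rr x + s) / dd x) by apply/funext.
split; last exact: quad_over_dd.
apply: (@cont_div_dd (fun r => p * r ^+ 2 + q * r + s)) => r.
apply: cvgD; last exact: cvg_cst.
apply: cvgD; last by apply: cvgM; [exact: cvg_cst|exact: cvg_id].
by apply: cvgM; [exact: cvg_cst|rewrite expr2; apply: cvgM; exact: cvg_id].
Qed.

Lemma rB_regular : exists K, [/\ continuous rB11, continuous rB12, continuous rB22 &
  [/\ forall x, `|rB11 x| <= K, forall x, `|rB12 x| <= K & forall x, `|rB22 x| <= K]].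
Proof.
have [c1 [K1 K10 h1]] : continuous rB11 /\ exists2 K, 0 <= K & forall x, `|rB11 x| <= K.
  apply: (@coef_form _ m (- m * M - e * Q) (- (a * kappa))) => x.
  rewrite /rB11 /rV -mulrBl; congr (_ / _); ring.
have [c2 [K2 K20 h2]] : continuous rB12 /\ exists2 K, 0 <= K & forall x, `|rB12 x| <= K.
  apply: (@coef_form _ 0 lambda (- lambda * M)) => x; rewrite /rB12; congr (_ / _); ring.
have [c3 [K3 K30 h3]] : continuous rB22 /\ exists2 K, 0 <= K & forall x, `|rB22 x| <= K.
  apply: (@coef_form _ (- m) (m * M - e * Q) (- (a * kappa))) => x.
  rewrite /rB22 /rV -mulNr -mulrBl; congr (_ / _); ring.
exists (K1 + K2 + K3); split=> //; split=> x.
- by apply: le_trans (h1 x) _; lra.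
- by apply: le_trans (h2 x) _; lra.
- by apply: le_trans (h3 x) _; lra.
Qed.

Lemma radial_operatorE : radial_operator M a Q e kappa m lambda =
  adjoint [set: R] (fun=> 1) (minimal_operator [set: R] (dirac_op rB11 rB12 rB22)).
Proof.
have [K [c1 c2 c3 [h1 h2 h3]]] := rB_regular.
by rewrite /radial_operator radial_dirac; exact: dirac_selfadjoint.
Qed.

End RadialReduction.

(** * Absence of radial eigenfunctions *)

Section MonotoneForms.
Variable R : realType.
Notation T := [set: R].
Implicit Types (q dq n : R -> R) (K x : R).

Lemma mono_zero q dq n K : (forall x, hasder q x (dq x)) -> (forall x, 0 <= dq x) ->
  (forall x, `|q x| <= K * n x) -> rint T n -> forall x, q x = 0.
Proof.
move=> hq dq0 hK ni x.
have Kn : rint T (fun x => K * n x) by exact: rintZ.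
have le y z : y <= z -> q y <= q z by move=> yz; apply: (@hasder_ge0_le _ q dq).
case: (ltgtP (q x) 0) => // qx.
- have q0 : 0 < - q x by rewrite oppr_gt0.
  have [y yx hy] := rint_small_left x Kn q0.
  have := le_lt_trans (le_trans (hK y) (ler_norm _)) hy; have := le _ _ yx.
  by rewrite ltr_norml; lra.
- have [y yx hy] := rint_small_right x Kn qx.
  have := le_lt_trans (le_trans (hK y) (ler_norm _)) hy; have := le _ _ yx.
  by rewrite ltr_norml; lra.
Qed.

Lemma mono_zero_deriv q dq n K : (forall x, hasder q x (dq x)) -> (forall x, 0 <= dq x) ->
  (forall x, `|q x| <= K * n x) -> rint T n -> forall x, dq x = 0.
Proof.
move=> hq dq0 hK ni x; have q0 : q = fun=> 0 by apply/funext => y; exact: (mono_zero hq dq0 hK ni).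
by move: hq; rewrite q0 => hq; exact: hasder_uniq (hq x) (hasder_cst _ _).
Qed.

Lemma quad_form_bound (p q r f g : R) :
  `|p * f ^+ 2 + q * (f * g) + r * g ^+ 2| <= (`|p| + `|q| + `|r|) * (f ^+ 2 + g ^+ 2).
Proof.
have h1 : `|p * f ^+ 2| = `|p| * f ^+ 2 by rewrite normrM [`|_ ^+ 2|]ger0_norm // sqr_ge0.
have h2 : `|r * g ^+ 2| = `|r| * g ^+ 2 by rewrite normrM [`|_ ^+ 2|]ger0_norm // sqr_ge0.
have h3 : `|q * (f * g)| <= `|q| * (f ^+ 2 + g ^+ 2).
  by rewrite normrM; apply: ler_wpM2l => //; exact: sq_prod_le.
apply: le_trans (ler_normD _ _) _.
have := ler_normD (p * f ^+ 2) (q * (f * g)); rewrite h1 h2.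
have := normr_ge0 p; have := normr_ge0 r; have := sqr_ge0 f; have := sqr_ge0 g => G F N1 N2 H.
have A1 : 0 <= `|p| * g ^+ 2 by rewrite mulr_ge0.
have A2 : 0 <= `|r| * f ^+ 2 by rewrite mulr_ge0.
lra.
Qed.

(** The discriminant forces [al] and [ep] to share a strict sign, the sum makes that sign positive,
    and completing the square finishes. *)
Lemma pos_form (al ga ep f g : R) : 0 <= al + ep -> 0 < 4 * al * ep - ga ^+ 2 ->
  0 < f ^+ 2 + g ^+ 2 -> 0 < al * f ^+ 2 + ga * (f * g) + ep * g ^+ 2.
Proof.
move=> h1 h2 h3; have g2 := sqr_ge0 ga.
have ale : 0 < al * ep by lra.
have al0 : 0 < al.
  rewrite ltNge; apply/negP => al0.
  have : ep <= 0 by rewrite leNgt; apply/negP => e0; move: ale; rewrite ltNge; apply/negP/negPn; rewrite mulr_le0_ge0 // ltW.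
  move=> ep0; have : al = 0 by lra. move=> z; move: ale; by rewrite z mul0r ltxx.
rewrite -(pmulr_rgt0 _ (_ : 0 < 4 * al)); last by rewrite mulr_gt0.
have -> : 4 * al * (al * f ^+ 2 + ga * (f * g) + ep * g ^+ 2) =
  (2 * al * f + ga * g) ^+ 2 + (4 * al * ep - ga ^+ 2) * g ^+ 2 by ring.
have [g0|gn0] := eqVneq g 0.
  move: h3; rewrite g0 expr0n /= !mulr0 !addr0 => f0.
  by rewrite exprMn mulr_gt0 // exprn_gt0 // mulr_gt0.
by rewrite ltr_wpDl ?sqr_ge0 // mulr_gt0 // lt_neqAle eq_sym sqrf_eq0 gn0 sqr_ge0.
Qed.

End MonotoneForms.

(** * The radial system at the critical energy *)

Section CriticalSystem.
Variable R : realType.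
Notation T := [set: R].
Variables (M a : R).
Hypothesis M0 : 0 < M.
Notation rr := (inv_tortoise M a).
Notation rho := (fun x => rr x - M).
Notation w := (fun x => (rr x - M) / dd M a x).
Variables (f g : R -> R) (la b c p q : R).
Hypothesis hf : forall x, hasder f x (w x * (- la * f x + (b + p * rho x) * g x)).
Hypothesis hg : forall x, hasder g x (w x * ((c + q * rho x) * f x + la * g x)).
Hypothesis ni : rint T (fun x => f x ^+ 2 + g x ^+ 2).
Hypothesis n0 : forall x, 0 < f x ^+ 2 + g x ^+ 2.

Lemma rho_gt0 x : 0 < rho x.
Proof. by rewrite subr_gt0 rr_gtM. Qed.

Lemma w_gt0 x : 0 < w x.
Proof. by rewrite divr_gt0 ?rho_gt0 ?dd_gt0. Qed.

Lemma form_hasder (A B C : R) x :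
  hasder (fun x => A * f x ^+ 2 + B * (f x * g x) + C * g x ^+ 2) x
  (w x * ((2 * A * - la + B * (c + q * rho x)) * f x ^+ 2 +
    (2 * A * (b + p * rho x) + 2 * C * (c + q * rho x)) * (f x * g x) +
    (B * (b + p * rho x) + 2 * C * la) * g x ^+ 2)).
Proof.
apply: hasder_eq (hasderD (hasderD (hasderM (hasder_cst A x) (hasderX 2 (hf x)))
  (hasderM (hasder_cst B x) (hasderM (hf x) (hg x)))) (hasderM (hasder_cst C x) (hasderX 2 (hg x)))) _.
by rewrite /= !expr1; ring.
Qed.

Lemma form_le (A B C : R) x : `|A * f x ^+ 2 + B * (f x * g x) + C * g x ^+ 2| <=
  (`|A| + `|B| + `|C|) * (f x ^+ 2 + g x ^+ 2).
Proof. exact: quad_form_bound. Qed.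

Lemma form_mono_zero (A B C : R) :
  (forall x, 0 <= (2 * A * - la + B * (c + q * rho x)) * f x ^+ 2 +
    (2 * A * (b + p * rho x) + 2 * C * (c + q * rho x)) * (f x * g x) +
    (B * (b + p * rho x) + 2 * C * la) * g x ^+ 2) ->
  forall x, A * f x ^+ 2 + B * (f x * g x) + C * g x ^+ 2 = 0 /\
   (2 * A * - la + B * (c + q * rho x)) * f x ^+ 2 +
    (2 * A * (b + p * rho x) + 2 * C * (c + q * rho x)) * (f x * g x) +
    (B * (b + p * rho x) + 2 * C * la) * g x ^+ 2 = 0.
Proof.
move=> h x.
have hd := form_hasder A B C.
have d0 y : 0 <= w y * ((2 * A * - la + B * (c + q * rho y)) * f y ^+ 2 +
    (2 * A * (b + p * rho y) + 2 * C * (c + q * rho y)) * (f y * g y) +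
    (B * (b + p * rho y) + 2 * C * la) * g y ^+ 2) by rewrite mulr_ge0 ?(ltW (w_gt0 _)).
split; first exact: (mono_zero hd d0 (fun x => form_le A B C x) ni).
have := mono_zero_deriv hd d0 (fun x => form_le A B C x) ni x.
by move/eqP; rewrite mulf_eq0 gt_eqF ?w_gt0 //= => /eqP.
Qed.

(** The monotone form is P f g + (la / 2) (p g^2 - q f^2), where [P] is half the trace of [A0 A1].
    The derivative of f g supplies the diagonal terms, among them rho P (q f^2 + p g^2); in the
    derivative of p g^2 - q f^2 the terms linear in rho cancel. With these weights the part free of
    rho has discriminant (la^2 + b c) ((p c + q b)^2 + 4 la^2 p q), which is positive. *)
Lemma critical_large : 0 <= p -> 0 <= q -> 0 <= b + c -> 0 <= p * c + q * b ->
  0 < la ^+ 2 + b * c -> 0 < (p * c + q * b) ^+ 2 + la ^+ 2 * (p * q) -> False.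
Proof.
move=> p0 q0 bc0 P0 s0 k0.
pose P := (p * c + q * b) / 2.
pose al := P * c + la ^+ 2 * q; pose ep := P * b + la ^+ 2 * p; pose ga := - la * (q * b - p * c).
have PE : p * c + q * b = 2 * P by rewrite /P; field.
have Pge : 0 <= P by rewrite divr_ge0.
have pf x : 0 < al * f x ^+ 2 + ga * (f x * g x) + ep * g x ^+ 2.
  apply: pos_form => //.
  - rewrite /al /ep; have -> : P * c + la ^+ 2 * q + (P * b + la ^+ 2 * p) = P * (b + c) + la ^+ 2 * (p + q) by ring.
    by rewrite addr_ge0 // mulr_ge0 // ?sqr_ge0 // addr_ge0.
  - have -> : 4 * al * ep - ga ^+ 2 = (la ^+ 2 + b * c) * ((p * c + q * b) ^+ 2 + 4 * (la ^+ 2 * (p * q))).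
      by rewrite /al /ep /ga /P; field.
    rewrite mulr_gt0 //; have : 0 <= la ^+ 2 * (p * q) by rewrite mulr_ge0 ?sqr_ge0 // mulr_ge0.
    lra.
have e x : (2 * (- la * q / 2) * - la + P * (c + q * rho x)) * f x ^+ 2 +
    (2 * (- la * q / 2) * (b + p * rho x) + 2 * (la * p / 2) * (c + q * rho x)) * (f x * g x) +
    (P * (b + p * rho x) + 2 * (la * p / 2) * la) * g x ^+ 2 =
   (al * f x ^+ 2 + ga * (f x * g x) + ep * g x ^+ 2) + rho x * P * (q * f x ^+ 2 + p * g x ^+ 2).
  by rewrite /al /ep /ga; field.
have pos x : 0 < (al * f x ^+ 2 + ga * (f x * g x) + ep * g x ^+ 2) + rho x * P * (q * f x ^+ 2 + p * g x ^+ 2).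
  by rewrite ltr_pwDl ?pf // mulr_ge0 ?mulr_ge0 ?(ltW (rho_gt0 _)) // addr_ge0 // mulr_ge0 // sqr_ge0.
have h x : 0 <= (2 * (- la * q / 2) * - la + P * (c + q * rho x)) * f x ^+ 2 +
    (2 * (- la * q / 2) * (b + p * rho x) + 2 * (la * p / 2) * (c + q * rho x)) * (f x * g x) +
    (P * (b + p * rho x) + 2 * (la * p / 2) * la) * g x ^+ 2 by rewrite e ltW.
have [_ z] := form_mono_zero h 0.
by move: (pos 0); rewrite -e z ltxx.
Qed.

(** The system is triangular: [la * g ^+ 2] is monotone and so vanishes, after which [- la * f ^+ 2]
    is monotone as well. *)
Lemma critical_c0q0 : c = 0 -> q = 0 -> la != 0 -> False.
Proof.
move=> c0 q0 l0.
have h x : 0 <= (2 * 0 * - la + 0 * (c + q * rho x)) * f x ^+ 2 +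
    (2 * 0 * (b + p * rho x) + 2 * la * (c + q * rho x)) * (f x * g x) +
    (0 * (b + p * rho x) + 2 * la * la) * g x ^+ 2.
  rewrite c0 q0; have -> : forall z t s : R, (2 * 0 * - la + 0 * (0 + 0 * z)) * t ^+ 2 +
    (2 * 0 * (b + p * z) + 2 * la * (0 + 0 * z)) * (t * s) +
    (0 * (b + p * z) + 2 * la * la) * s ^+ 2 = 2 * (la * s) ^+ 2 by move=> *; ring.
  by rewrite mulr_ge0 // sqr_ge0.
have g0 x : g x = 0.
  have [+ _] := form_mono_zero h x; rewrite !mul0r !add0r => /eqP.
  by rewrite mulf_eq0 (negbTE l0) /= sqrf_eq0 => /eqP.
have h' x : 0 <= (2 * - la * - la + 0 * (c + q * rho x)) * f x ^+ 2 +
    (2 * - la * (b + p * rho x) + 2 * 0 * (c + q * rho x)) * (f x * g x) +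
    (0 * (b + p * rho x) + 2 * 0 * la) * g x ^+ 2.
  rewrite g0; have -> : forall z t : R, (2 * - la * - la + 0 * (c + q * z)) * t ^+ 2 +
    (2 * - la * (b + p * z) + 2 * 0 * (c + q * z)) * (t * 0) +
    (0 * (b + p * z) + 2 * 0 * la) * 0 ^+ 2 = 2 * (la * t) ^+ 2 by move=> *; ring.
  by rewrite mulr_ge0 // sqr_ge0.
have [+ _] := form_mono_zero h' 0; rewrite g0 expr0n /= !mulr0 !addr0 => /eqP.
rewrite mulf_eq0 oppr_eq0 (negbTE l0) /= => /eqP f0.
by have := n0 0; rewrite f0 g0 expr0n addr0 ltxx.
Qed.

(** With [A0 = 0] the form la (g^2 - f^2) takes over; its derivative has discriminant proportional
    to la^2 (la^2 - b^2), positive by the last hypothesis. *)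
Lemma critical_massless : p = 0 -> q = 0 -> c = - b -> 0 < la ^+ 2 + b * c -> False.
Proof.
move=> p0 q0 cb s0.
have e x : (2 * - la * - la + 0 * (c + q * rho x)) * f x ^+ 2 +
    (2 * - la * (b + p * rho x) + 2 * la * (c + q * rho x)) * (f x * g x) +
    (0 * (b + p * rho x) + 2 * la * la) * g x ^+ 2 =
    2 * la ^+ 2 * f x ^+ 2 + - (4 * la * b) * (f x * g x) + 2 * la ^+ 2 * g x ^+ 2.
  by rewrite p0 q0 cb; ring.
have pos x : 0 < 2 * la ^+ 2 * f x ^+ 2 + - (4 * la * b) * (f x * g x) + 2 * la ^+ 2 * g x ^+ 2.
  apply: pos_form => //; first by rewrite -mulrDl mulr_ge0 ?sqr_ge0 //; lra.
  have -> : 4 * (2 * la ^+ 2) * (2 * la ^+ 2) - (- (4 * la * b)) ^+ 2 = 16 * la ^+ 2 * (la ^+ 2 + b * c).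
    by rewrite cb; ring.
  rewrite mulr_gt0 // mulr_gt0 //; move: s0; rewrite cb mulrN -expr2 => s0.
  have := sqr_ge0 b; lra.
have h x : 0 <= (2 * - la * - la + 0 * (c + q * rho x)) * f x ^+ 2 +
    (2 * - la * (b + p * rho x) + 2 * la * (c + q * rho x)) * (f x * g x) +
    (0 * (b + p * rho x) + 2 * la * la) * g x ^+ 2 by rewrite e ltW.
have [_ z] := form_mono_zero h 0.
by move: (pos 0); rewrite -e z ltxx.
Qed.

Lemma rho_hasder x : hasder rho x (w x * rho x).
Proof.
apply: hasder_eq (hasderD (rr_hasder a M0 x) (hasder_cst (- M) x)) _.
by rewrite addr0 /dd expr2 mulrAC.
Qed.

Lemma ln_rho_hasder x : hasder (fun x => ln (rho x)) x (w x).
Proof.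
have r0 := rho_gt0 x.
apply: hasder_eq (@hasder_comp _ (@ln R) rho x _ _ (is_derive1_ln r0) (rho_hasder x)) _.
by rewrite mulrCA mulVf ?mulr1 // gt_eqF.
Qed.

Lemma dd_geM2 x : M ^+ 2 <= dd M a x.
Proof.
rewrite /dd; have rM := ltW (rr_gtM a M0 x).
apply: le_trans (_ : rr x ^+ 2 <= _); last by rewrite lerDl sqr_ge0.
by rewrite !expr2; apply: ler_pM; rewrite // ltW.
Qed.

(* [rho] decays only like [1 / x] towards the horizon. *)
Lemma rho_not_integrable (k A : R) : 0 < k -> ~ (forall x, x <= A -> k * rho x <= f x ^+ 2 + g x ^+ 2).
Proof.
move=> k0 h.
pose I := RI T (fun x => f x ^+ 2 + g x ^+ 2).
have k1 : 0 < k * M ^+ 2 by rewrite mulr_gt0 // exprn_gt0.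
have bound x : x <= A -> k * M ^+ 2 * (ln (rho A) - ln (rho x)) <= I.
  move=> xA; rewrite -(@RI_FTC _ w (fun x => ln (rho x)) x A xA); last 2 first.
  - by move=> t _; exact: ln_rho_hasder.
  - move=> t _; apply: (@cont_div_dd R M a M0 (fun r => r - M)) => r.
    by apply: cvgB; [exact: cvg_id|exact: cvg_cst].
  have wi : rint `[x, A] w.
    apply: rint_contf => t _; apply: (@cont_div_dd R M a M0 (fun r => r - M)) => r.
    by apply: cvgB; [exact: cvg_id|exact: cvg_cst].
  rewrite -RIZ //.
  apply: le_trans (_ : RI `[x, A] (fun x => f x ^+ 2 + g x ^+ 2) <= _).
    apply: RI_le => //; [exact: rintZ|exact: (rintS measurableT _ _ ni)|].
    move=> t /=; rewrite in_itv /= => /andP[_ tA]; apply: le_trans (h t tA).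
    rewrite -mulrA ler_pM2l // mulrCA ler_piMr ?(ltW (rho_gt0 _)) //.
    by rewrite ler_pdivrMr ?dd_gt0 // mul1r dd_geM2.
  by apply: RI_mono => // t _; exact: ltW.
(* A point left of [A] at which the logarithm of rho has dropped so far that [bound] would give
   [I + 1 <= I]. *)
pose y := tortoise M a (M + Num.min (rho A) (expR (ln (rho A) - (I + 1) / (k * M ^+ 2)))).
have m0 : 0 < Num.min (rho A) (expR (ln (rho A) - (I + 1) / (k * M ^+ 2))).
  by rewrite lt_min rho_gt0 expR_gt0.
have ry : rr y = M + Num.min (rho A) (expR (ln (rho A) - (I + 1) / (k * M ^+ 2))).
  by rewrite rr_tort // ltrDl.
have yA : y <= A.
  have : rr y <= rr A by rewrite ry -lerBrDl ge_min lexx.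
  rewrite le_eqVlt => /orP[/eqP e|e]; first by rewrite -(tort_rr a M0 y) e tort_rr.
  by have := ltW (tortoise_lt a M0 (rr_gtM a M0 y) e); rewrite !tort_rr.
have := bound y yA.
have : ln (rho y) <= ln (rho A) - (I + 1) / (k * M ^+ 2).
  rewrite -[leRHS]expRK ler_ln ?posrE ?rho_gt0 ?expR_gt0 //.
  by rewrite ry addrAC subrr add0r ge_min lexx orbT.
move=> h1; have : (I + 1) / (k * M ^+ 2) <= ln (rho A) - ln (rho y) by lra.
by rewrite ler_pdivrMr // mulrC; lra.
Qed.

(* The Lyapunov form [E = (1/4 - s^2) |u|^2 + |(A1 + 1/2) u|^2] satisfies
   [dE/drho <= (1 / rho + O(1)) E], whence [|u|^2 >= c * rho] near the horizon. *)
Lemma critical_small : la ^+ 2 + b * c < 1 / 4 -> False.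
Proof.
move=> sm.
pose de := 1 / 4 - (la ^+ 2 + b * c); have de0 : 0 < de by rewrite subr_gt0.
pose A := de + (1 / 2 - la) ^+ 2 + c ^+ 2.
pose B := 2 * (1 / 2 - la) * b + 2 * c * (1 / 2 + la).
pose C := de + b ^+ 2 + (1 / 2 + la) ^+ 2.
pose E x := A * f x ^+ 2 + B * (f x * g x) + C * g x ^+ 2.
have Elow x : de * (f x ^+ 2 + g x ^+ 2) <= E x.
  have -> : E x = de * (f x ^+ 2 + g x ^+ 2) + (((1 / 2 - la) * f x + b * g x) ^+ 2 + (c * f x + (1 / 2 + la) * g x) ^+ 2).
    by rewrite /E /A /B /C; ring.
  by rewrite lerDl addr_ge0 // sqr_ge0.
have E0 x : 0 < E x by apply: lt_le_trans (Elow x); rewrite mulr_gt0.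
pose KK := (`|B * q| + `|2 * A * p + 2 * C * q| + `|B * p|) / de.
have KK0 : 0 <= KK by rewrite divr_ge0 ?(ltW de0) // !addr_ge0.
pose dE x := w x * ((2 * A * - la + B * (c + q * rho x)) * f x ^+ 2 +
    (2 * A * (b + p * rho x) + 2 * C * (c + q * rho x)) * (f x * g x) +
    (B * (b + p * rho x) + 2 * C * la) * g x ^+ 2).
have hE x : hasder E x (dE x) by exact: form_hasder.
have dEle x : dE x <= (w x + KK * (w x * rho x)) * E x.
  have -> : dE x = w x * (E x - 2 * de * (f x ^+ 2 + g x ^+ 2)) +
     w x * rho x * ((B * q) * f x ^+ 2 + (2 * A * p + 2 * C * q) * (f x * g x) + (B * p) * g x ^+ 2).
    by rewrite /dE /E /A /B /C /de; field; rewrite gt_eqF // dd_gt0.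
  have h1 : w x * (E x - 2 * de * (f x ^+ 2 + g x ^+ 2)) <= w x * E x.
    rewrite ler_pM2l ?w_gt0 // gerBl mulr_ge0 ?(ltW (n0 _)) // mulr_ge0 // ltW //.
  have h2 : (B * q) * f x ^+ 2 + (2 * A * p + 2 * C * q) * (f x * g x) + (B * p) * g x ^+ 2 <= KK * E x.
    apply: le_trans (ler_norm _) _; apply: le_trans (quad_form_bound _ _ _ _ _) _.
    have -> : `|B * q| + `|2 * A * p + 2 * C * q| + `|B * p| = KK * de by rewrite /KK divfK ?gt_eqF.
    by rewrite -mulrA; apply: ler_wpM2l.
  have wr : 0 <= w x * rho x by rewrite mulr_ge0 ?(ltW (w_gt0 _)) ?(ltW (rho_gt0 _)).
  have := ler_wpM2l wr h2; lra.
pose k := E 0 * expR (- (ln (rho 0) + KK * rho 0)).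
have k0 : 0 < k by rewrite mulr_gt0 ?expR_gt0.
have Ebig x : x <= 0 -> k * rho x <= E x.
  move=> x0.
  have := @gronwall_le R E (fun x => - (ln (rho x) + KK * rho x)) dE (fun x => - (w x + KK * (w x * rho x))) x 0 x0 (fun t _ => hE t).
  move=> H; have {}H : E 0 * expR (- (ln (rho 0) + KK * rho 0)) <= E x * expR (- (ln (rho x) + KK * rho x)).
    apply: H => t _.
      apply: hasder_eq (hasderN (hasderD (ln_rho_hasder t) (hasderM (hasder_cst KK t) (rho_hasder t)))) _.
      by rewrite mul0r add0r.
    by have := dEle t; rewrite mulNr; lra.
  rewrite -/k opprD expRD expRN lnK ?posrE ?rho_gt0 // in H.
  have e1 : expR (- (KK * rho x)) <= 1.
    by rewrite -expR0 ler_expR oppr_le0 mulr_ge0 // ltW // rho_gt0.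
  rewrite -ler_pdivlMr ?rho_gt0 //; apply: le_trans H _; rewrite mulrA ler_piMr //.
  by rewrite divr_ge0 ?(ltW (E0 _)) ?(ltW (rho_gt0 _)).
pose K2 := `|A| + `|B| + `|C|.
have K20 : 0 < K2.
  have : 0 < K2 * (f 0 ^+ 2 + g 0 ^+ 2).
    apply: lt_le_trans (E0 0) _; apply: le_trans (ler_norm _) _; exact: form_le.
  by rewrite pmulr_lgt0.
apply: (@rho_not_integrable (k / K2) 0); first by rewrite divr_gt0.
move=> x x0; rewrite mulrAC ler_pdivrMr // [leRHS]mulrC.
apply: le_trans (Ebig x x0) _; apply: le_trans (ler_norm _) _; exact: form_le.
Qed.

End CriticalSystem.

(** * Energy estimates at the two ends *)

Section EnergyEstimates.
Variable R : realType.
Notation T := [set: R].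
Variables (M a : R).
Hypothesis M0 : 0 < M.
Notation rr := (inv_tortoise M a).

Definition drr (x : R) : R := (rr x - M) ^+ 2 / dd M a x.

Definition quad_frac (p q s x : R) : R := (p * rr x ^+ 2 + q * rr x + s) / dd M a x.

Lemma rr_gt0 x : 0 < rr x.
Proof. exact: lt_trans M0 (rr_gtM a M0 x). Qed.

Lemma drr_ge0 x : 0 <= drr x.
Proof. by rewrite divr_ge0 ?sqr_ge0 // ltW // dd_gt0. Qed.

Lemma quad_frac_hasder p q s : exists dq K, [/\ 0 <= K,
  forall x, hasder (quad_frac p q s) x (dq x) &
  forall x, `|dq x| <= K * (drr x / rr x ^+ 2)].
Proof.
have [K K0 hK] := @quad_over_dd R M a M0 (- q) (2 * (p * a ^+ 2 - s)) (q * a ^+ 2).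
exists (fun x => (- q * rr x ^+ 2 + 2 * (p * a ^+ 2 - s) * rr x + q * a ^+ 2) / dd M a x * (drr x / dd M a x)), K.
split=> // x.
  have d0 := dd_gt0 a M0 x; have hr := rr_hasder a M0 x.
  have hd : hasder (dd M a) x (2 * rr x * drr x).
    apply: hasder_eq (hasderD (hasderX 2 hr) (hasder_cst (a ^+ 2) x)) _.
    by rewrite /= expr1 addr0.
  apply: hasder_eq (hasderM (hasderD (hasderD (hasderM (hasder_cst p x) (hasderX 2 hr))
    (hasderM (hasder_cst q x) hr)) (hasder_cst s x)) (hasderV hd (lt0r_neq0 d0))) _.
  rewrite /drr /= expr1 -/(dd M a x); move: (lt0r_neq0 d0); rewrite /dd => dn; field; exact: dn.
have d0 := dd_gt0 a M0 x.
rewrite normrM; apply: ler_pM => //.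
rewrite ger0_norm; last by rewrite divr_ge0 ?drr_ge0 // ltW.
apply: ler_wpM2l; first exact: drr_ge0.
by rewrite lef_pV2 ?posrE // ?exprn_gt0 ?rr_gt0 // /dd lerDl sqr_ge0.
Qed.

Variables (f g P N L dP dN dL : R -> R) (K : R).
Hypothesis hf : forall x, hasder f x (- L x * f x + P x * g x).
Hypothesis hg : forall x, hasder g x (N x * f x + L x * g x).
Hypothesis ni : rint T (fun x => f x ^+ 2 + g x ^+ 2).
Hypothesis n0 : forall x, 0 < f x ^+ 2 + g x ^+ 2.
Hypotheses (hP : forall x, hasder P x (dP x)) (hN : forall x, hasder N x (dN x))
  (hL : forall x, hasder L x (dL x)).
Hypotheses (bP : forall x, `|dP x| <= K * (drr x / rr x ^+ 2))
  (bN : forall x, `|dN x| <= K * (drr x / rr x ^+ 2)) (bL : forall x, `|dL x| <= K * (drr x / rr x ^+ 2)).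
Hypotheses (mP : forall x, `|P x| <= K) (mN : forall x, `|N x| <= K) (mL : forall x, `|L x| <= K).

Section Sign.
Variables (sg c : R).
Hypotheses (sg1 : `|sg| = 1) (c0 : 0 < c).

(** This is [- sg] times det(u, Y u) for the coefficient matrix [Y]. Since [Y] commutes with itself,
    differentiation along a solution leaves only the derivatives of [P], [N] and [L]. *)
Definition energy x := - (sg * N x) * f x ^+ 2 + - (2 * sg * L x) * (f x * g x) + sg * P x * g x ^+ 2.

(** The diagonal of the form is at least [c], and the bound on [L] lets the cross term spend at most
    half of it. *)
Definition definite_at x : Prop := [/\ c <= sg * P x, c <= - (sg * N x) & `|L x| <= c / 2].

Lemma energy_hasder x : hasder energy x
  (- (sg * dN x) * f x ^+ 2 + - (2 * sg * dL x) * (f x * g x) + sg * dP x * g x ^+ 2).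
Proof.
apply: hasder_eq (hasderD (hasderD
  (hasderM (hasderN (hasderM (hasder_cst sg x) (hN x))) (hasderX 2 (hf x)))
  (hasderM (hasderN (hasderM (hasder_cst (2 * sg) x) (hL x))) (hasderM (hf x) (hg x))))
  (hasderM (hasderM (hasder_cst sg x) (hP x)) (hasderX 2 (hg x)))) _.
by rewrite /= !expr1; ring.
Qed.

Lemma K_ge0 : 0 <= K.
Proof. exact: le_trans (normr_ge0 _) (mP 0). Qed.

Lemma energy_ub x : energy x <= (4 * K) * (f x ^+ 2 + g x ^+ 2).
Proof.
apply: le_trans (ler_norm _) _; apply: le_trans (quad_form_bound _ _ _ _ _) _.
apply: ler_wpM2r; first exact: ltW.
rewrite !normrN !normrM sg1 !mul1r mulr1 [`|2|]ger0_norm //.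
by have := mP x; have := mN x; have := mL x; lra.
Qed.

Lemma energy_lb x : definite_at x -> c / 2 * (f x ^+ 2 + g x ^+ 2) <= energy x.
Proof.
case=> h1 h2 h3; rewrite /energy.
have a1 : c * f x ^+ 2 <= - (sg * N x) * f x ^+ 2 by apply: ler_wpM2r => //; exact: sqr_ge0.
have a2 : c * g x ^+ 2 <= sg * P x * g x ^+ 2 by apply: ler_wpM2r => //; exact: sqr_ge0.
have fg : `|2 * (f x * g x)| <= f x ^+ 2 + g x ^+ 2.
  have := sqr_ge0 (f x - g x); have := sqr_ge0 (f x + g x).
  by rewrite ler_norml sqrrD sqrrB; lra.
have a3 : `|2 * sg * L x * (f x * g x)| <= c / 2 * (f x ^+ 2 + g x ^+ 2).
  have -> : 2 * sg * L x * (f x * g x) = (sg * L x) * (2 * (f x * g x)) by ring.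
  by rewrite normrM; apply: ler_pM => //; rewrite normrM sg1 mul1r.
by move: a3; rewrite ler_norml => /andP[a3 a4]; lra.
Qed.

Lemma denergy_bound x : definite_at x ->
  `|- (sg * dN x) * f x ^+ 2 + - (2 * sg * dL x) * (f x * g x) + sg * dP x * g x ^+ 2| <=
  (8 * K / c) * (drr x / rr x ^+ 2) * energy x.
Proof.
move=> df; set t := drr x / rr x ^+ 2.
have t0 : 0 <= t by rewrite divr_ge0 ?drr_ge0 // sqr_ge0.
apply: le_trans (quad_form_bound _ _ _ _ _) _.
apply: le_trans (_ : 4 * (K * t) * (f x ^+ 2 + g x ^+ 2) <= _).
  apply: ler_wpM2r; first exact: ltW.
  rewrite !normrN !normrM sg1 !mul1r mulr1 [`|2|]ger0_norm //.
  by have := bP x; have := bN x; have := bL x; rewrite -/t; lra.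
have -> : 4 * (K * t) * (f x ^+ 2 + g x ^+ 2) = (8 * K / c) * t * (c / 2 * (f x ^+ 2 + g x ^+ 2)).
  by field; rewrite gt_eqF.
apply: ler_wpM2l; last exact: energy_lb.
by rewrite mulr_ge0 // divr_ge0 ?(ltW c0) // mulr_ge0 // K_ge0.
Qed.

Lemma energy_gt0 x : definite_at x -> 0 < energy x.
Proof. by move=> /energy_lb; apply: lt_le_trans; rewrite !mulr_gt0 ?invr_gt0. Qed.

Lemma inv_rr_hasder (k : R) x : hasder (fun x => k / rr x) x (- (k * (drr x / rr x ^+ 2))).
Proof.
apply: hasder_eq (hasderM (hasder_cst k x) (hasderV (rr_hasder a M0 x) (lt0r_neq0 (rr_gt0 x)))) _.
by rewrite mul0r add0r mulNr mulrN.
Qed.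

Let KK := 8 * K / c.

Lemma KK_ge0 : 0 <= KK.
Proof. by rewrite divr_ge0 ?(ltW c0) // mulr_ge0 // K_ge0. Qed.

(** The energy is at most [4 * K] times the squared norm, so a positive lower bound on a half-line
    contradicts integrability. *)
Lemma energy_contra k A : 0 < k ->
  ~ (forall x, x <= A -> k <= energy x) /\ ~ (forall x, A <= x -> k <= energy x).
Proof.
move=> k0; have K40 : 0 < 4 * K + 1 by have := K_ge0; lra.
have b x : k <= energy x -> k / (4 * K + 1) <= `|f x ^+ 2 + g x ^+ 2|.
  move=> h; rewrite gtr0_norm // ler_pdivrMr // mulrC; apply: le_trans h _.
  by apply: le_trans (energy_ub x) _; have := n0 x; lra.
have k1 : 0 < k / (4 * K + 1) by rewrite divr_gt0.
split=> h.
  have [x xA] := rint_small_left A ni k1; by rewrite ltNge b // h.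
have [x xA] := rint_small_right A ni k1; by rewrite ltNge b // h.
Qed.

(** The factor exp(KK / rr) makes the energy monotone and lies between 1 and exp(KK / M); the energy
    therefore stays away from 0 towards the horizon. *)
Lemma no_definite_left A : ~ (forall x, x <= A -> definite_at x).
Proof.
move=> df; have k0 : 0 < energy A * expR (- (KK / M)) by rewrite mulr_gt0 ?expR_gt0 // energy_gt0 //; exact: df.
have [h _] := energy_contra A k0; apply: h; move=> x xA.
have : energy A * expR (KK / rr A) <= energy x * expR (KK / rr x).
  apply: (@gronwall_le R energy (fun x => KK / rr x) _ _ x A xA (fun t _ => energy_hasder t) (fun t _ => inv_rr_hasder KK t)).
  move=> t /andP[_ tA]; have := denergy_bound (df t tA).
  by rewrite ler_norml -/KK => /andP[_]; lra.
move=> h; rewrite expRN ler_pdivrMr ?expR_gt0 //.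
apply: le_trans (_ : energy A * expR (KK / rr A) <= _).
  apply: ler_peMr; first by rewrite ltW // energy_gt0 //; exact: df.
  by rewrite -expR0 ler_expR divr_ge0 ?KK_ge0 // ltW ?rr_gt0.
apply: le_trans h _; rewrite ler_pM2l ?energy_gt0 ?ler_expR //; last exact: df.
apply: ler_wpM2l; first exact: KK_ge0.
by rewrite lef_pV2 ?posrE ?rr_gt0 // ltW // rr_gtM.
Qed.

Lemma no_definite_right A : ~ (forall x, A <= x -> definite_at x).
Proof.
move=> df; have k0 : 0 < energy A * expR (- (KK / M)) by rewrite mulr_gt0 ?expR_gt0 // energy_gt0 //; exact: df.
have [_ h] := energy_contra A k0; apply: h; move=> x xA.
have : energy A * expR (- KK / rr A) <= energy x * expR (- KK / rr x).
  apply: (@gronwall_ge R energy (fun x => - KK / rr x) _ _ A x xA (fun t _ => energy_hasder t) (fun t _ => inv_rr_hasder (- KK) t)).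
  move=> t /andP[tA _]; have := denergy_bound (df t tA).
  by rewrite ler_norml -/KK => /andP[]; lra.
move=> h; apply: le_trans (_ : energy A * expR (- KK / rr A) <= _).
  rewrite ler_pM2l ?energy_gt0 ?ler_expR //; last exact: df.
  rewrite mulNr lerN2.
  apply: ler_wpM2l; first exact: KK_ge0.
  by rewrite lef_pV2 ?posrE ?rr_gt0 // ltW // rr_gtM.
apply: le_trans h _; apply: ler_piMr; first by rewrite ltW // energy_gt0 //; exact: df.
by rewrite -expR0 ler_expR mulNr oppr_le0 divr_ge0 ?KK_ge0 // ltW ?rr_gt0.
Qed.

End Sign.
End EnergyEstimates.

(** * Exclusion of radial eigenvalues, energy by energy *)

Section NoRadialEigenvalue.
Variable R : realType.
Notation T := [set: R].
Variables (M a Q e kappa m lambda : R).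
Hypothesis M0 : 0 < M.
Hypothesis extreme : M ^+ 2 = a ^+ 2 + Q ^+ 2.
Hypothesis m0 : 0 <= m.
Notation rr := (inv_tortoise M a).
(** The energy [o] for which [o * (r ^+ 2 + a ^+ 2) + a * kappa + e * Q * r] vanishes at r = M. *)
Definition omega_crit : R := - ((kappa * a + e * Q * M) / (a ^+ 2 + M ^+ 2)).
Notation om := omega_crit.

Lemma aM_gt0 : 0 < a ^+ 2 + M ^+ 2.
Proof. by rewrite ltr_wpDl ?sqr_ge0 // exprn_gt0. Qed.

Lemma omega_critE : om * (a ^+ 2 + M ^+ 2) = - (kappa * a + e * Q * M).
Proof. by rewrite /omega_crit mulNr divfK // gt_eqF // aM_gt0. Qed.

Lemma coefP_quad o x : o - rB22 M a Q e kappa m x =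
  quad_frac M a (o + m) (e * Q - m * M) (o * a ^+ 2 + a * kappa) x.
Proof.
have d0 := lt0r_neq0 (dd_gt0 a M0 x); move: d0.
by rewrite /rB22 /rV /quad_frac /dd => d0; field.
Qed.

Lemma coefN_quad o x : rB11 M a Q e kappa m x - o =
  quad_frac M a (m - o) (- (e * Q) - m * M) (- (o * a ^+ 2) - a * kappa) x.
Proof.
have d0 := lt0r_neq0 (dd_gt0 a M0 x); move: d0.
by rewrite /rB11 /rV /quad_frac /dd => d0; field.
Qed.

Lemma coefL_quad x : rB12 M a lambda x = quad_frac M a 0 lambda (- (lambda * M)) x.
Proof. by rewrite /rB12 /quad_frac; congr (_ / _); ring. Qed.

(** At the critical energy the quadratic numerator has the root r = M; the factor [rr x - M] comes
    out and lowers the order of the singularity at the horizon by one. *)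
Lemma critP x : om - rB22 M a Q e kappa m x =
  (rr x - M) / dd M a x * ((m * M + (e * Q + 2 * om * M)) + (m + om) * (rr x - M)).
Proof.
have d0 := lt0r_neq0 (dd_gt0 a M0 x); rewrite coefP_quad /quad_frac mulrAC; congr (_ / _).
have h := omega_critE.
have -> : a * kappa = - (om * (a ^+ 2 + M ^+ 2)) - e * Q * M by rewrite h; ring.
by ring.
Qed.

Lemma critN x : rB11 M a Q e kappa m x - om =
  (rr x - M) / dd M a x * ((m * M - (e * Q + 2 * om * M)) + (m - om) * (rr x - M)).
Proof.
have d0 := lt0r_neq0 (dd_gt0 a M0 x); rewrite coefN_quad /quad_frac mulrAC; congr (_ / _).
have h := omega_critE.
have -> : a * kappa = - (om * (a ^+ 2 + M ^+ 2)) - e * Q * M by rewrite h; ring.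
by ring.
Qed.

Lemma critL x : rB12 M a lambda x = (rr x - M) / dd M a x * lambda.
Proof. by rewrite /rB12 -mulrA mulrC. Qed.

Lemma quad_frac_lim_left (p q s eps : R) : 0 < eps -> exists A, forall x, x <= A ->
  `|quad_frac M a p q s x - (p * M ^+ 2 + q * M + s) / (a ^+ 2 + M ^+ 2)| <= eps.
Proof.
move=> eps0.
have c : {for M, continuous (fun r : R => (p * r ^+ 2 + q * r + s) / (r ^+ 2 + a ^+ 2))}.
  apply: cvgM.
    apply: cvgD; last exact: cvg_cst.
    apply: cvgD; last by apply: cvgM; [exact: cvg_cst|exact: cvg_id].
    by apply: cvgM; [exact: cvg_cst|rewrite expr2; apply: cvgM; exact: cvg_id].
  apply: cvgV; first by rewrite addrC gt_eqF // aM_gt0.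
  by apply: cvgD; [rewrite expr2; apply: cvgM; exact: cvg_id|exact: cvg_cst].
move: c => /cvgrPdist_le /(_ _ eps0) /nbhs_ballP[d d0 hd].
have d20 : 0 < d / 2 by rewrite divr_gt0.
have [A hA] := rr_small a M0 d20.
exists A => x /hA rx; have rM := rr_gtM a M0 x.
have := hd (rr x); rewrite /ball /= distrC ger0_norm; last by rewrite subr_ge0 ltW.
have : 0 < d by []. move=> dp /(_ _); rewrite distrC addrC [a ^+ 2 + M ^+ 2]addrC; apply; lra.
Qed.

Lemma quad_frac_lim_right (p q s eps : R) : 0 < eps -> exists A, forall x, A <= x ->
  `|quad_frac M a p q s x - p| <= eps.
Proof.
move=> eps0.
pose B := Num.max 1 ((`|q| + `|s - p * a ^+ 2|) / eps).
have [A hA] := rr_large a M0 B.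
exists A => x /hA; rewrite ge_max => /andP[r1 rB].
have d0 := dd_gt0 a M0 x; have r0 := rr_gt0 a M0 x.
have -> : quad_frac M a p q s x - p = (q * rr x + (s - p * a ^+ 2)) / dd M a x.
  by move: (lt0r_neq0 d0); rewrite /quad_frac /dd => dn; field.
rewrite normrM normfV (gtr0_norm d0) ler_pdivrMr //.
move: rB; rewrite ler_pdivrMr // => rB.
apply: le_trans (ler_normD _ _) _; rewrite normrM (gtr0_norm r0).
apply: le_trans (_ : (`|q| + `|s - p * a ^+ 2|) * rr x <= _).
  by rewrite mulrDl lerD2l ler_peMr.
apply: le_trans (_ : rr x * eps * rr x <= _); first by rewrite ler_pM2r.
rewrite /dd; have -> : rr x * eps * rr x = eps * rr x ^+ 2 by ring.
by rewrite ler_pM2l // lerDl sqr_ge0.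
Qed.

Lemma quad_frac_bounded p q s : exists2 K, 0 <= K & forall x, `|quad_frac M a p q s x| <= K.
Proof. exact: quad_over_dd. Qed.

Variables (f g : R -> R) (o : R).
Hypothesis hf : forall x, hasder f x (- rB12 M a lambda x * f x + (o - rB22 M a Q e kappa m x) * g x).
Hypothesis hg : forall x, hasder g x ((rB11 M a Q e kappa m x - o) * f x + rB12 M a lambda x * g x).
Hypothesis ni : rint T (fun x => f x ^+ 2 + g x ^+ 2).
Hypothesis n0 : forall x, 0 < f x ^+ 2 + g x ^+ 2.

Lemma no_definite_end sg c A : `|sg| = 1 -> 0 < c ->
  let df x := definite_at (fun x => o - rB22 M a Q e kappa m x)
     (fun x => rB11 M a Q e kappa m x - o) (rB12 M a lambda) sg c x in
  ~ (forall x, x <= A -> df x) /\ ~ (forall x, A <= x -> df x).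
Proof.
move=> sg1 c0 df.
have [dP [K1 [K10 hP bP]]] := quad_frac_hasder a M0 (o + m) (e * Q - m * M) (o * a ^+ 2 + a * kappa).
have [dN [K2 [K20 hN bN]]] := quad_frac_hasder a M0 (m - o) (- (e * Q) - m * M) (- (o * a ^+ 2) - a * kappa).
have [dL [K3 [K30 hL bL]]] := quad_frac_hasder a M0 0 lambda (- (lambda * M)).
have [K4 K40 mP] := quad_frac_bounded (o + m) (e * Q - m * M) (o * a ^+ 2 + a * kappa).
have [K5 K50 mN] := quad_frac_bounded (m - o) (- (e * Q) - m * M) (- (o * a ^+ 2) - a * kappa).
have [K6 K60 mL] := quad_frac_bounded 0 lambda (- (lambda * M)).
pose K := K1 + K2 + K3 + K4 + K5 + K6.
have t0 x : 0 <= drr M a x / rr x ^+ 2 by rewrite divr_ge0 ?sqr_ge0 // drr_ge0.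
have eP : (fun x => o - rB22 M a Q e kappa m x) = quad_frac M a (o + m) (e * Q - m * M) (o * a ^+ 2 + a * kappa).
  by apply/funext => x; exact: coefP_quad.
have eN : (fun x => rB11 M a Q e kappa m x - o) = quad_frac M a (m - o) (- (e * Q) - m * M) (- (o * a ^+ 2) - a * kappa).
  by apply/funext => x; exact: coefN_quad.
have eL : rB12 M a lambda = quad_frac M a 0 lambda (- (lambda * M)).
  by apply/funext => x; exact: coefL_quad.
have hf' x := hf x; have hg' x := hg x.
have wk (k t : R) : k <= K -> 0 <= t -> k * t <= K * t by move=> kK tt; apply: ler_wpM2r.
rewrite /df eP eN eL.
split.
- apply: (@no_definite_left R M a M0 f g _ _ _ dP dN dL K) => //.
  + by move=> x; have := hf x; rewrite coefP_quad coefL_quad.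
  + by move=> x; have := hg x; rewrite coefN_quad coefL_quad.
  + by move=> x; apply: le_trans (bP x) _; apply: wk => //; rewrite /K; lra.
  + by move=> x; apply: le_trans (bN x) _; apply: wk => //; rewrite /K; lra.
  + by move=> x; apply: le_trans (bL x) _; apply: wk => //; rewrite /K; lra.
  + by move=> x; apply: le_trans (mP x) _; rewrite /K; lra.
  + by move=> x; apply: le_trans (mN x) _; rewrite /K; lra.
  + by move=> x; apply: le_trans (mL x) _; rewrite /K; lra.
- apply: (@no_definite_right R M a M0 f g _ _ _ dP dN dL K) => //.
  + by move=> x; have := hf x; rewrite coefP_quad coefL_quad.
  + by move=> x; have := hg x; rewrite coefN_quad coefL_quad.
  + by move=> x; apply: le_trans (bP x) _; apply: wk => //; rewrite /K; lra.
  + by move=> x; apply: le_trans (bN x) _; apply: wk => //; rewrite /K; lra.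
  + by move=> x; apply: le_trans (bL x) _; apply: wk => //; rewrite /K; lra.
  + by move=> x; apply: le_trans (mP x) _; rewrite /K; lra.
  + by move=> x; apply: le_trans (mN x) _; rewrite /K; lra.
  + by move=> x; apply: le_trans (mL x) _; rewrite /K; lra.
Qed.

Lemma sign_ex (t : R) : t != 0 -> exists sg : R, `|sg| = 1 /\ sg * t = `|t|.
Proof.
move=> t0; case: (ltrP 0 t) => h; first by exists 1; rewrite normr1 mul1r gtr0_norm.
by exists (-1); rewrite normrN normr1 mulN1r ler0_norm.
Qed.

(** At the horizon the off-diagonal coefficients tend to [o - om] and [- (o - om)] and the diagonal
    one to 0, so the energy form is definite there with the sign of [o - om]. *)
Lemma no_solution_noncritical : o != om -> False.
Proof.
move=> oom; have t0 : o - om != 0 by rewrite subr_eq0.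
have [sg [sg1 sgt]] := sign_ex t0.
have c0 : 0 < `|o - om| / 2 by rewrite divr_gt0 // normr_gt0.
have c1 : 0 < `|o - om| / 4 by rewrite divr_gt0 // normr_gt0.
have [A1 h1] := quad_frac_lim_left (o + m) (e * Q - m * M) (o * a ^+ 2 + a * kappa) c0.
have [A2 h2] := quad_frac_lim_left (m - o) (- (e * Q) - m * M) (- (o * a ^+ 2) - a * kappa) c0.
have [A3 h3] := quad_frac_lim_left 0 lambda (- (lambda * M)) c1.
pose A := Num.min A1 (Num.min A2 A3).
have [h _] := @no_definite_end sg (`|o - om| / 2) A sg1 c0; apply: h => x.
rewrite !le_min => /andP[/h1 x1 /andP[/h2 x2 /h3 x3]].
have aM := lt0r_neq0 aM_gt0.
have E1 : ((o + m) * M ^+ 2 + (e * Q - m * M) * M + (o * a ^+ 2 + a * kappa)) / (a ^+ 2 + M ^+ 2) = o - om.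
  by rewrite /om; field.
have E2 : ((m - o) * M ^+ 2 + (- (e * Q) - m * M) * M + (- (o * a ^+ 2) - a * kappa)) / (a ^+ 2 + M ^+ 2) = - (o - om).
  by rewrite /om; field.
have E3 : (0 * M ^+ 2 + lambda * M + - (lambda * M)) / (a ^+ 2 + M ^+ 2) = 0 by field.
rewrite E1 in x1; rewrite E2 in x2; rewrite E3 subr0 in x3.
have sgle (t v k : R) : `|t - v| <= k -> sg * v - k <= sg * t <= sg * v + k.
  move=> tv; have : `|sg * t - sg * v| <= k by rewrite -mulrBr normrM sg1 mul1r.
  by rewrite ler_distl.
have := sgle _ _ _ x1; have := sgle _ _ _ x2.
rewrite mulrN sgt -coefP_quad -coefN_quad => /andP[y1 y2] /andP[y3 y4].
rewrite -coefL_quad in x3; clear -y1 y2 y3 y4 x3 c0.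
by split; lra.
Qed.

(** At infinity the off-diagonal coefficients tend to [om + m] and [m - om]. For [m < |om|] both
    [om + m] and [om - m] carry the sign of [om], with margin [|om| - m], while the diagonal
    coefficient tends to 0. *)
Lemma no_solution_light : o = om -> m < `|om| -> False.
Proof.
move=> oom mo; have o0 : om != 0 by rewrite -normr_gt0 (le_lt_trans m0).
have [sg [sg1 sgt]] := sign_ex o0.
have c0 : 0 < (`|om| - m) / 2 by rewrite divr_gt0 // subr_gt0.
have c1 : 0 < (`|om| - m) / 4 by rewrite divr_gt0 // subr_gt0.
have [A1 h1] := quad_frac_lim_right (o + m) (e * Q - m * M) (o * a ^+ 2 + a * kappa) c0.
have [A2 h2] := quad_frac_lim_right (m - o) (- (e * Q) - m * M) (- (o * a ^+ 2) - a * kappa) c0.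
have [A3 h3] := quad_frac_lim_right 0 lambda (- (lambda * M)) c1.
pose A := Num.max A1 (Num.max A2 A3).
have [_ h] := @no_definite_end sg ((`|om| - m) / 2) A sg1 c0; apply: h => x.
rewrite !ge_max => /andP[/h1 x1 /andP[/h2 x2 /h3 x3]].
rewrite subr0 in x3.
have sgle (t v k : R) : `|t - v| <= k -> sg * v - k <= sg * t <= sg * v + k.
  move=> tv; have : `|sg * t - sg * v| <= k by rewrite -mulrBr normrM sg1 mul1r.
  by rewrite ler_distl.
have sgm : - m <= sg * m <= m by rewrite -ler_norml normrM sg1 mul1r ger0_norm.
have := sgle _ _ _ x1; have := sgle _ _ _ x2.
rewrite -coefP_quad -coefN_quad [sg * (m - o)]mulrBr [sg * (o + m)]mulrDr oom sgt => /andP[y1 y2] /andP[y3 y4].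
move/andP: sgm => [y5 y6]; rewrite -coefL_quad in x3; clear -y1 y2 y3 y4 y5 y6 x3 c0 mo.
by split; lra.
Qed.

Lemma no_solution_heavy : o = om -> `|om| <= m -> om * (e * Q + M * om) <= 0 -> False.
Proof.
move=> oom mo sgn; have := mo; rewrite ler_norml => /andP[om1 om2].
pose be := e * Q + 2 * om * M.
have cf x : hasder f x ((rr x - M) / dd M a x * (- lambda * f x + ((m * M + be) + (m + om) * (rr x - M)) * g x)).
  by apply: hasder_eq (hf x) _; rewrite oom critP critL /be; ring.
have cg x : hasder g x ((rr x - M) / dd M a x * (((m * M - be) + (m - om) * (rr x - M)) * f x + lambda * g x)).
  by apply: hasder_eq (hg x) _; rewrite oom critN critL /be; ring.
(* Below 1/4 the behaviour at the horizon excludes the solution; above, s^2 is positive and the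
   monotone forms apply. *)
have [s1|s1] := ltP (lambda ^+ 2 + (m * M + be) * (m * M - be)) (1 / 4).
  exact: (critical_small M0 cf cg ni n0 s1).
have s0 : 0 < lambda ^+ 2 + (m * M + be) * (m * M - be) by apply: lt_le_trans s1; rewrite divr_gt0.
have p0 : 0 <= m + om by lra.
have q0 : 0 <= m - om by lra.
have pq0 : 0 <= (m + om) * (m - om) by rewrite mulr_ge0.
(* Here the sign of [om * (e * Q + M * om)] enters: both contributions to the trace are
   nonnegative. *)
have PE : (m + om) * (m * M - be) + (m - om) * (m * M + be) =
  2 * (M * ((m + om) * (m - om)) - om * (e * Q + M * om)) by rewrite /be; ring.
have P1 : 0 <= M * ((m + om) * (m - om)) by rewrite mulr_ge0 // ltW.
have P0 : 0 <= (m + om) * (m * M - be) + (m - om) * (m * M + be) by rewrite PE mulr_ge0 //; lra.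
have b0 : 0 <= m * M + be + (m * M - be) by have : 0 <= m * M by [rewrite mulr_ge0 // ltW]; lra.
have [k0|k0] := ltP 0 (((m + om) * (m * M - be) + (m - om) * (m * M + be)) ^+ 2 + lambda ^+ 2 * ((m + om) * (m - om))).
  exact: (critical_large M0 cf cg ni n0 p0 q0 b0 P0 s0 k0).
(* In the degenerate case the trace vanishes, and with it both of its nonnegative contributions:
   [m = |om|] and [om * (e * Q + M * om) = 0]. *)
have l2 : 0 <= lambda ^+ 2 * ((m + om) * (m - om)) by rewrite mulr_ge0 ?sqr_ge0.
have Pz : (m + om) * (m * M - be) + (m - om) * (m * M + be) = 0.
  apply/eqP; rewrite -sqrf_eq0 eq_le sqr_ge0 andbT; lra.
have kz : M * ((m + om) * (m - om)) = 0 by apply/eqP; rewrite eq_le P1 andbT; lra.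
have oz : om * (e * Q + M * om) = 0 by lra.
have {}kz : (m + om) * (m - om) = 0.
  by move/eqP: kz; rewrite mulf_eq0 (gt_eqF M0) /= => /eqP.
have [om0|omn] := eqVneq om 0.
  have mz : m = 0.
    by move/eqP: kz; rewrite om0 addr0 subr0 mulf_eq0 orbb => /eqP.
  apply: (critical_massless M0 cf cg ni n0) => //.
  - by rewrite om0 mz addr0.
  - by rewrite om0 mz subr0.
  - by rewrite mz mul0r sub0r add0r.
have eta0 : e * Q = - (M * om).
  by move/eqP: oz; rewrite mulf_eq0 (negbTE omn) /= addr_eq0 => /eqP.
have beE : be = om * M by rewrite /be eta0; ring.
have lnz : m * M = om * M \/ m * M = - (om * M) -> lambda != 0.
  move=> h; apply/eqP => l0; move: s0; rewrite l0 beE expr0n /= add0r.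
  by case: h => ->; rewrite ?subrr ?addNr ?mulr0 ?mul0r ltxx.
move/eqP: kz; rewrite mulf_eq0 => /orP[/eqP mz|/eqP mz].
  (* Exchanging the components and replacing [lambda] by [- lambda] reduces this case to the
     triangular system with vanishing [c] and [q]. *)
  have mE : m = - om by lra.
  apply: (@critical_c0q0 R M a M0 g f (- lambda) (m * M - be) (m * M + be) (m - om) (m + om)) => //.
  - by move=> x; apply: hasder_eq (cg x) _; rewrite opprK; ring.
  - by move=> x; apply: hasder_eq (cf x) _; ring.
  - by under eq_fun do rewrite addrC.
  - by move=> x; rewrite addrC.
  - by rewrite beE mE; ring.
  - by rewrite oppr_eq0; apply: lnz; right; rewrite mE mulNr.
have mE : m = om by lra.
apply: (critical_c0q0 M0 cf cg ni n0) => //.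
- by rewrite beE mE; ring.
- by apply: lnz; left; rewrite mE.
Qed.

End NoRadialEigenvalue.

Lemma no_radial_eigenvalue (R : realType) (M a Q e kappa m lambda o : R) : 0 < M ->
  M ^+ 2 = a ^+ 2 + Q ^+ 2 -> 0 <= m ->
  omega_crit M a Q e kappa * (e * Q + M * omega_crit M a Q e kappa) <= 0 ->
  ~ op_eigenvalue [set: R] (radial_operator M a Q e kappa m lambda) o.
Proof.
move=> M0 extreme m0 sgn [u [nz]]; rewrite (radial_operatorE e kappa m lambda M0 extreme) => hu.
have [K [c1 c2 c3 _]] := rB_regular a Q e kappa m lambda M0.
have [K' [_ _ _ [b1 b2 b3]]] := rB_regular a Q e kappa m lambda M0.
have [f [g [hf hg ni n0]]] := dirac_eigenfunction c1 c2 c3 b1 b2 b3 hu nz.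
have [oom|oom] := eqVneq o (omega_crit M a Q e kappa); last exact: (no_solution_noncritical M0 hf hg ni n0 oom).
have [mo|mo] := ltP m `|omega_crit M a Q e kappa|; first exact: (no_solution_light M0 m0 hf hg ni n0 oom mo).
exact: (no_solution_heavy M0 m0 hf hg ni n0 oom mo sgn).
Qed.

(** * Laguerre solutions *)

Section IntegrableByPrimitive.
Variable R : realType.
Notation mu := (@lebesgue_measure R).
Notation T := [set: R].

(** The integral over [-j, j] is at most H(j) - H(-j) <= 2 B; monotone convergence passes to the
    line. *)
Lemma rint_primitive (n h H : R -> R) (B : R) : continuous n -> continuous h ->
  (forall x, 0 <= n x) -> (forall x, n x <= h x) ->
  (forall x, hasder H x (h x)) -> (forall x, `|H x| <= B) -> rint T n.
Proof.
move=> cn ch n0 nh hH bH.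
pose F (j : nat) : set R := `[- j%:R, j%:R]%classic.
have mF j : measurable (F j) by exact: measurable_itv.
have ndF : nondecreasing_seq F.
  move=> i j ij; apply/subsetPset => x; rewrite /F /= !in_itv /= => /andP[x1 x2].
  have ij' : (i%:R : R) <= j%:R by rewrite ler_nat.
  apply/andP; split; last exact: le_trans x2 ij'.
  by apply: le_trans x1; rewrite lerN2.
have UF : \bigcup_j F j = T.
  apply/seteqP; split=> // x _; exists (Num.trunc `|x|).+1 => //.
  have := truncnS_gt `|x|; rewrite /F /= in_itv /= ltr_norml => /andP[h1 h2].
  by rewrite !ltW.
have mn : measurable_fun T n by exact: continuous_measurable_fun.
have ni j : rint (F j) n by apply: rint_contf => x _; exact: cn.
have hi j : rint (F j) h by apply: rint_contf => x _; exact: ch.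
have cv : (\int[mu]_(x in F i) (n x)%:E)%E @[i --> \oo] --> (\int[mu]_(x in \bigcup_i F i) (n x)%:E)%E.
  apply: ge0_nondecreasing_set_cvg_integral => //.
    by move=> j; apply/measurable_EFinP; exact: rint_measurable (ni j).
  by move=> j x _; rewrite lee_fin.
have bd j : (\int[mu]_(x in F j) (n x)%:E <= (2 * B)%:E)%E.
  rewrite -(@fineK _ (\int[mu]_(x in F j) (n x)%:E)%E); last first.
    exact: (@integrable_fin_num _ _ R mu _ (mF j) _ (ni j)).
  rewrite lee_fin; change (RI (F j) n <= 2 * B).
  apply: le_trans (_ : RI (F j) h <= _); first by apply: RI_le.
  have jj : - j%:R <= j%:R :> R by apply: (@le_trans _ _ 0) => //; rewrite oppr_le0.
  rewrite /F (@RI_FTC _ h H (- j%:R) j%:R jj) //; last by move=> x _; exact: ch.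
  have := bH j%:R; have := bH (- j%:R); rewrite !ler_norml; lra.
apply/integrableP; split; first exact/measurable_EFinP.
apply: (@le_lt_trans _ _ (2 * B)%:E); last exact: ltry.
have -> : (\int[mu]_(x in T) `|(EFin \o n) x|)%E = (\int[mu]_(x in \bigcup_i F i) (n x)%:E)%E.
  by rewrite UF; apply: eq_integral => x _; rewrite /= ger0_norm.
rewrite -(cvg_lim _ cv) //; apply: lime_le; first by apply/cvg_ex; eexists; exact: cv.
by near=> j; exact: bd.
Unshelve. all: end_near. Qed.

End IntegrableByPrimitive.

Section LaguerreSolution.
Variable R : realType.
Notation T := [set: R].
Variables (M a : R).
Hypothesis M0 : 0 < M.
Notation rr := (inv_tortoise M a).
Notation rho := (fun x => rr x - M).
Notation w := (fun x => (rr x - M) / dd M a x).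
Variables (la b c p q k s : R) (N : nat).
Hypotheses (k0 : 0 < k) (kpq : k ^+ 2 = p * q) (s1 : 1 <= s) (N0 : (0 < N)%N).
Hypothesis sE : s ^+ 2 = la ^+ 2 + b * c.
Hypothesis quant : p * c + q * b = - (2 * k * (s + N%:R)).

(** Inserting rho^s exp(- k rho) times the sum of v_j rho^j gives (s + j - A1) v_j = (A0 + k)
    v_(j-1). Since k^2 = p q, the range of A0 + k is spanned by (1, q / k); since A1^2 = s^2, the
    inverse of s + j - A1 is (s + j + A1) / ((s + j)^2 - s^2). Hence v_j is [Dc j] times (s + j +
    A1) (1, q / k), with entries [fc j] and [gc j]. *)
Fixpoint Dc (j : nat) : R :=
  if j is i.+1 then Dc i * (2 * k * (i%:R - N%:R)) / ((s + i.+1%:R) ^+ 2 - s ^+ 2) else 1.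

Definition fc (j : nat) : R := Dc j * ((s + j%:R - la) + b * q / k).
Definition gc (j : nat) : R := Dc j * (c + (s + j%:R + la) * q / k).
(** The factor in (A0 + k) v_j = [tc j] times (1, q / k), once [quant] has been inserted; its zero
    at [j = N] terminates the series. *)
Definition tc (j : nat) : R := Dc j * (2 * k * (j%:R - N%:R)).

Lemma tcE j : k * fc j + p * gc j = tc j.
Proof.
have kn := lt0r_neq0 k0; rewrite /fc /gc /tc.
have e : p * (q / k) = k by rewrite mulrA -kpq expr2 mulfK.
have -> : k * (Dc j * (s + j%:R - la + b * q / k)) + p * (Dc j * (c + (s + j%:R + la) * q / k)) =
  Dc j * (k * (s + j%:R - la) + (p * c + q * b) + (s + j%:R + la) * (p * (q / k))) by field.
by rewrite e quant; ring.
Qed.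

Lemma tcE2 j : q * fc j + k * gc j = q / k * tc j.
Proof.
rewrite -tcE; have kn := lt0r_neq0 k0.
have e : q = q / k * k by rewrite divfK.
have e2 : k = q / k * p by rewrite mulrAC [q * p]mulrC -kpq expr2 mulfK.
by rewrite mulrDr !mulrA -e -e2.
Qed.

Lemma fcE j : (s + j%:R + la) * fc j - b * gc j = Dc j * ((s + j%:R) ^+ 2 - s ^+ 2).
Proof.
by have kn := lt0r_neq0 k0; rewrite /fc /gc sE; field.
Qed.

Lemma gcE j : (s + j%:R - la) * gc j - c * fc j = q / k * (Dc j * ((s + j%:R) ^+ 2 - s ^+ 2)).
Proof.
by have kn := lt0r_neq0 k0; rewrite /fc /gc sE; field.
Qed.

Lemma DcS j : Dc j.+1 * ((s + j.+1%:R) ^+ 2 - s ^+ 2) = tc j.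
Proof.
rewrite /= /tc divfK //.
have -> : (s + j.+1%:R) ^+ 2 - s ^+ 2 = j.+1%:R * (2 * s + j.+1%:R) by ring.
rewrite mulf_neq0 ?pnatr_eq0 // gt_eqF // addr_gt0 ?ltr0n // mulr_gt0 //.
by apply: lt_le_trans s1.
Qed.

Definition poly_sum (cf : nat -> R) (r : R) : R := \sum_(j < N.+1) cf j * r ^+ j.

Lemma eq_poly_sum cf cg r : (forall j, cf j = cg j) -> poly_sum cf r = poly_sum cg r.
Proof. by move=> h; apply: eq_bigr => j _; rewrite h. Qed.

(** The shift of the index loses nothing at either end: the term [j = 0] on the left vanishes, and
    so does [tc N] on the right. *)
Lemma tc_shift r : poly_sum (fun j => Dc j * ((s + j%:R) ^+ 2 - s ^+ 2)) r = r * poly_sum tc r.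
Proof.
rewrite /poly_sum big_ord_recl /= addr0 subrr mulr0 mul0r add0r.
rewrite [in RHS]big_ord_recr /= /tc subrr !mulr0 mul0r addr0 mulr_sumr.
apply: eq_bigr => j _; rewrite /bump /= add1n.
by have := DcS j; rewrite /tc => ->; rewrite exprS; ring.
Qed.

Lemma poly_sum_lin (u v : R) cf cg r : u * poly_sum cf r + v * poly_sum cg r =
  poly_sum (fun j => u * cf j + v * cg j) r.
Proof.
rewrite /poly_sum !mulr_sumr -big_split /=; apply: eq_bigr => j _; ring.
Qed.

Lemma ode1 r : poly_sum (fun j => j%:R * fc j) r + (s - k * r) * poly_sum fc r =
  - la * poly_sum fc r + (b + p * r) * poly_sum gc r.
Proof.
have h1 : poly_sum (fun j => (s + j%:R + la) * fc j - b * gc j) r = r * poly_sum (fun j => k * fc j + p * gc j) r.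
  rewrite (eq_poly_sum _ fcE) tc_shift; congr (_ * _).
  by apply: eq_poly_sum => j; rewrite tcE.
have h2 : poly_sum (fun j => (s + j%:R + la) * fc j - b * gc j) r =
   poly_sum (fun j => j%:R * fc j) r + ((s + la) * poly_sum fc r - b * poly_sum gc r).
  rewrite /poly_sum !mulr_sumr -sumrB -big_split /=; apply: eq_bigr => j _; ring.
rewrite -poly_sum_lin in h1; rewrite h2 in h1.
have -> : poly_sum (fun j => j%:R * fc j) r = r * (k * poly_sum fc r + p * poly_sum gc r) -
   ((s + la) * poly_sum fc r - b * poly_sum gc r) by rewrite -h1; ring.
ring.
Qed.

Lemma ode2 r : poly_sum (fun j => j%:R * gc j) r + (s - k * r) * poly_sum gc r =
  (c + q * r) * poly_sum fc r + la * poly_sum gc r.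
Proof.
have h1 : poly_sum (fun j => (s + j%:R - la) * gc j - c * fc j) r = r * poly_sum (fun j => q * fc j + k * gc j) r.
  transitivity (q / k * poly_sum (fun j => Dc j * ((s + j%:R) ^+ 2 - s ^+ 2)) r).
    rewrite (eq_poly_sum _ gcE) /poly_sum mulr_sumr; apply: eq_bigr => j _; exact: esym (mulrA _ _ _).
  rewrite tc_shift mulrCA; congr (_ * _); rewrite (eq_poly_sum _ tcE2) /poly_sum mulr_sumr.
  by apply: eq_bigr => j _; rewrite mulrA.
have h2 : poly_sum (fun j => (s + j%:R - la) * gc j - c * fc j) r =
   poly_sum (fun j => j%:R * gc j) r + ((s - la) * poly_sum gc r - c * poly_sum fc r).
  rewrite /poly_sum !mulr_sumr -sumrB -big_split /=; apply: eq_bigr => j _; ring.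
rewrite -poly_sum_lin in h1; rewrite h2 in h1.
have -> : poly_sum (fun j => j%:R * gc j) r = r * (q * poly_sum fc r + k * poly_sum gc r) -
   ((s - la) * poly_sum gc r - c * poly_sum fc r) by rewrite -h1; ring.
ring.
Qed.

Lemma hasder_sum (n : nat) (F dF : 'I_n -> R -> R) x :
  (forall i, hasder (F i) x (dF i x)) -> hasder (fun y => \sum_(i < n) F i y) x (\sum_(i < n) dF i x).
Proof.
elim: n F dF => [|n IH] F dF h.
  by rewrite big_ord0; under eq_fun do rewrite big_ord0; exact: hasder_cst.
rewrite big_ord_recr; under eq_fun do rewrite big_ord_recr.
by apply: hasderD; [exact: (IH (fun i => F (widen_ord (leqnSn n) i)) (fun i => dF (widen_ord (leqnSn n) i)))|exact: h].
Qed.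

Lemma poly_sum_hasder cf x : hasder (fun x => poly_sum cf (rho x)) x
  (w x * poly_sum (fun j => j%:R * cf j) (rho x)).
Proof.
apply: hasder_eq (hasder_sum (dF := fun j x => cf j * (j%:R * rho x ^+ j.-1 * (w x * rho x))) _) _.
  move=> j; apply: hasder_eq (hasderM (hasder_cst (cf j) x) (hasderX j (rho_hasder a M0 x))) _.
  by rewrite mul0r add0r.
rewrite /poly_sum mulr_sumr; apply: eq_bigr => -[[|j] jN] _ /=; first by rewrite !(mul0r, mulr0).
by rewrite exprS; ring.
Qed.

Definition envelope x : R := expR (s * ln (rho x) - k * rho x).

Lemma envelope_hasder x : hasder envelope x (w x * (s - k * rho x) * envelope x).
Proof.
apply: hasder_eq (@hasder_comp _ (@expR R) (fun x => s * ln (rho x) - k * rho x) x _ _ (hasder_expR _)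
  (hasderD (hasderM (hasder_cst s x) (ln_rho_hasder a M0 x)) (hasderN (hasderM (hasder_cst k x) (rho_hasder a M0 x))))) _.
by rewrite /envelope; ring.
Qed.

Definition sol_f x : R := envelope x * poly_sum fc (rho x).
Definition sol_g x : R := envelope x * poly_sum gc (rho x).

Lemma sol_f_hasder x : hasder sol_f x (w x * (- la * sol_f x + (b + p * rho x) * sol_g x)).
Proof.
apply: hasder_eq (hasderM (envelope_hasder x) (poly_sum_hasder fc x)) _.
have -> : w x * (- la * sol_f x + (b + p * rho x) * sol_g x) = w x * envelope x *
  (- la * poly_sum fc (rho x) + (b + p * rho x) * poly_sum gc (rho x)) by rewrite /sol_f /sol_g; ring.
by rewrite -ode1; ring.
Qed.

Lemma sol_g_hasder x : hasder sol_g x (w x * ((c + q * rho x) * sol_f x + la * sol_g x)).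
Proof.
apply: hasder_eq (hasderM (envelope_hasder x) (poly_sum_hasder gc x)) _.
have -> : w x * ((c + q * rho x) * sol_f x + la * sol_g x) = w x * envelope x *
  ((c + q * rho x) * poly_sum fc (rho x) + la * poly_sum gc (rho x)) by rewrite /sol_f /sol_g; ring.
by rewrite -ode2; ring.
Qed.

End LaguerreSolution.

(** * Square-integrability and nontriviality of the polynomial solutions *)

Section LaguerreIntegrability.
Variable R : realType.
Notation mu := (@lebesgue_measure R).
Notation T := [set: R].
Variables (M a : R).
Hypothesis M0 : 0 < M.
Notation rr := (inv_tortoise M a).
Notation rho := (fun x => rr x - M).
Notation w := (fun x => (rr x - M) / dd M a x).

Lemma poly_sum_bound (N : nat) (cf : nat -> R) : exists2 C, 0 <= C &
  forall r, 0 <= r -> `|poly_sum N cf r| <= C * (1 + r) ^+ N.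
Proof.
exists (\sum_(j < N.+1) `|cf j|); first by apply: sumr_ge0.
move=> r r0; apply: le_trans (ler_norm_sum _ _ _) _; rewrite mulr_suml.
apply: ler_sum => j _; rewrite normrM; apply: ler_wpM2l => //.
rewrite normrX ger0_norm //.
have h : r ^+ j <= (1 + r) ^+ j by rewrite lerXn2r ?nnegrE ?addr_ge0 // lerDr.
apply: le_trans h _; apply: ler_weXn2l; first by rewrite lerDl.
by rewrite -ltnS.
Qed.

Lemma exp_dominates (n : nat) (t k : R) : 0 <= t -> 0 < k -> exists2 B, 0 < B &
  forall r, 0 <= r -> (1 + r) ^+ n * expR (t * ln (1 + r) - k * r) <= B.
Proof.
move=> t0 k0; pose K := n%:R + t + 1.
have K0 : 0 < K by rewrite ltr_wpDl // addr_ge0.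
(* With [K * th = k] the inequality [ln y <= y] at [y = th * (1 + r)] makes the terms linear in [r]
   cancel. *)
pose th := k / K; have th0 : 0 < th by rewrite divr_gt0.
exists (expR (k - K * ln th)); first exact: expR_gt0.
move=> r r0; have r1 : 0 < 1 + r by rewrite ltr_pwDl.
have -> : (1 + r) ^+ n = expR (n%:R * ln (1 + r)).
  by rewrite -[in LHS](@lnK R (1 + r)) ?posrE // -expRM_natl mulr_natl.
rewrite -expRD ler_expR.
have l0 : 0 <= ln (1 + r) by rewrite ln_ge0 // lerDl.
have h : ln (th * (1 + r)) <= th * (1 + r).
  by apply: ltW; apply: ln_sublinear; rewrite mulr_gt0.
rewrite lnM ?posrE // in h.
have : K * (ln th + ln (1 + r)) <= K * (th * (1 + r)) by rewrite ler_pM2l.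
have -> : K * (th * (1 + r)) = k * (1 + r) by rewrite mulrA /th mulrCA divff ?mulr1 // gt_eqF.
rewrite /K => h2.
have : ln (1 + r) * 1 >= 0 by rewrite mulr1.
lra.
Qed.

Variables (la b c p q k s : R) (N : nat).
Hypotheses (k0 : 0 < k) (kpq : k ^+ 2 = p * q) (s1 : 1 <= s) (N0 : (0 < N)%N).
Hypothesis sE : s ^+ 2 = la ^+ 2 + b * c.
Hypothesis quant : p * c + q * b = - (2 * k * (s + N%:R)).

Notation F := (sol_f M a la b q k s N).
Notation G := (sol_g M a la c q k s N).
Notation fC := (fc la b q k s N).
Notation gC := (gc la c q k s N).

Lemma hF x : hasder F x (w x * (- la * F x + (b + p * rho x) * G x)).
Proof. exact: (sol_f_hasder a M0 k0 kpq s1 sE quant x). Qed.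

Lemma hG x : hasder G x (w x * ((c + q * rho x) * F x + la * G x)).
Proof. exact: (sol_g_hasder a M0 k0 kpq s1 sE quant x). Qed.

(** The majorant is the derivative of [- C / (1 + rho)]. As [s >= 1], a factor rho^2 splits off
    rho^(2 s) and matches the numerator of [w * rho]; the rest is a power of [1 + rho] against a
    decaying exponential. *)
Lemma sol_bound : exists C, forall x, F x ^+ 2 + G x ^+ 2 <= C * (w x * rho x / (1 + rho x) ^+ 2).
Proof.
have [C1 C10 h1] := poly_sum_bound N fC; have [C2 C20 h2] := poly_sum_bound N gC.
have t0 : 0 <= 2 * s - 2 by have := s1; lra.
have k20 : 0 < 2 * k by rewrite mulr_gt0.
(* The power collects [2 * N] from the squared polynomials, 2 from the bound on [dd] and 2 from the
   denominator of the majorant. *)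
have [B B0 hB] := exp_dominates (N + N + 4) t0 k20.
pose D := (1 + M) ^+ 2 + a ^+ 2.
have D0 : 0 < D by rewrite ltr_pwDl ?sqr_ge0 // exprn_gt0 // addr_gt0.
exists ((C1 ^+ 2 + C2 ^+ 2) * D * B) => x.
have r0 := rho_gt0 a M0 x; set r := rr x - M in r0 *.
have r1 : 0 < 1 + r by rewrite addr_gt0.
have d0 := dd_gt0 a M0 x.
have dD : dd M a x <= D * (1 + r) ^+ 2.
  have -> : dd M a x = (r + M) ^+ 2 + a ^+ 2 by rewrite /dd /r subrK.
  rewrite /D mulrDl -exprMn lerD //.
    have rM : r + M <= (1 + M) * (1 + r).
      have -> : (1 + M) * (1 + r) = 1 + (r + M) + r * M by ring.
      by have := mulr_gt0 r0 M0; lra.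
    have rM0 : 0 <= r + M by rewrite addr_ge0 // ltW.
    by rewrite lerXn2r ?nnegrE // (le_trans rM0).
  by rewrite ler_peMr ?sqr_ge0 // exprn_ege1 // lerDl ltW.
have En : envelope M a k s x ^+ 2 = r ^+ 2 * expR ((2 * s - 2) * ln r - 2 * k * r).
  have r2 : r ^+ 2 = expR (2%:R * ln r) by rewrite expRM_natl lnK ?posrE.
  by rewrite /envelope -/r r2 expr2 -!expRD; congr (expR _); ring.
have FE : F x ^+ 2 + G x ^+ 2 = envelope M a k s x ^+ 2 * (poly_sum N fC r ^+ 2 + poly_sum N gC r ^+ 2).
  by rewrite /sol_f /sol_g -/r; ring.
have b1 : poly_sum N fC r ^+ 2 + poly_sum N gC r ^+ 2 <= (C1 ^+ 2 + C2 ^+ 2) * (1 + r) ^+ (N + N).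
  have sq (t C : R) : 0 <= C -> `|t| <= C * (1 + r) ^+ N -> t ^+ 2 <= C ^+ 2 * (1 + r) ^+ (N + N).
    move=> C0 h; rewrite exprD -expr2 -exprMn -[t ^+ 2]ger0_norm ?sqr_ge0 // normrX lerXn2r ?nnegrE //.
    by rewrite mulr_ge0 // exprn_ge0 // ltW.
  by rewrite mulrDl lerD // sq // ?h1 ?h2 // ltW.
have b2 : expR ((2 * s - 2) * ln r - 2 * k * r) <= expR ((2 * s - 2) * ln (1 + r) - 2 * k * r).
  rewrite ler_expR lerD2r; apply: ler_wpM2l => //.
  by rewrite ler_ln ?posrE // lerDr.
rewrite FE En.
have -> : w x * r / (1 + r) ^+ 2 = r ^+ 2 / (dd M a x * (1 + r) ^+ 2).
  by rewrite -/r; field; rewrite !gt_eqF.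
rewrite mulrA ler_pdivlMr ?mulr_gt0 ?exprn_gt0 //.
set X := expR _ in b2 *; set Y := expR _ in b2.
have X0 : 0 <= X by exact: expR_ge0.
have n20 : 0 <= poly_sum N fC r ^+ 2 + poly_sum N gC r ^+ 2 by rewrite addr_ge0 // sqr_ge0.
have p20 : 0 <= (1 + r) ^+ 2 by rewrite sqr_ge0.
have e1 : X * (poly_sum N fC r ^+ 2 + poly_sum N gC r ^+ 2) <= Y * ((C1 ^+ 2 + C2 ^+ 2) * (1 + r) ^+ (N + N)).
  exact: ler_pM.
have e2 : dd M a x * (1 + r) ^+ 2 <= D * (1 + r) ^+ 2 * (1 + r) ^+ 2 by apply: ler_wpM2r.
apply: le_trans (_ : r ^+ 2 * (Y * ((C1 ^+ 2 + C2 ^+ 2) * (1 + r) ^+ (N + N)) * (D * (1 + r) ^+ 2 * (1 + r) ^+ 2)) <= _).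
  have -> : r ^+ 2 * X * (poly_sum N fC r ^+ 2 + poly_sum N gC r ^+ 2) * (dd M a x * (1 + r) ^+ 2) =
    r ^+ 2 * (X * (poly_sum N fC r ^+ 2 + poly_sum N gC r ^+ 2) * (dd M a x * (1 + r) ^+ 2)) by ring.
  rewrite ler_pM2l ?exprn_gt0 //; apply: ler_pM => //; first exact: mulr_ge0.
  by rewrite mulr_ge0 // ltW.
have := hB r (ltW r0); rewrite -/Y => hBr.
have -> : r ^+ 2 * (Y * ((C1 ^+ 2 + C2 ^+ 2) * (1 + r) ^+ (N + N)) * (D * (1 + r) ^+ 2 * (1 + r) ^+ 2)) =
  ((C1 ^+ 2 + C2 ^+ 2) * D * r ^+ 2) * ((1 + r) ^+ (N + N + 4) * Y).
  by rewrite (exprD _ (N + N) 4); ring.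
have -> : (C1 ^+ 2 + C2 ^+ 2) * D * B * r ^+ 2 = ((C1 ^+ 2 + C2 ^+ 2) * D * r ^+ 2) * B by ring.
have CC : 0 <= C1 ^+ 2 + C2 ^+ 2 by rewrite addr_ge0 // sqr_ge0.
have rr2 : 0 <= r ^+ 2 by exact: sqr_ge0.
apply: ler_wpM2l => //; apply: mulr_ge0 => //; apply: mulr_ge0 => //; exact: ltW.
Qed.

Lemma rho_continuous : continuous rho.
Proof. by move=> x; exact: hasder_continuous (rho_hasder a M0 x). Qed.

Lemma w_continuous : continuous w.
Proof.
apply: (@cont_div_dd R M a M0 (fun r => r - M)) => r.
by apply: cvgB; [exact: cvg_id|exact: cvg_cst].
Qed.

Lemma F_continuous : continuous F.
Proof. by move=> x; exact: hasder_continuous (hF x). Qed.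

Lemma G_continuous : continuous G.
Proof. by move=> x; exact: hasder_continuous (hG x). Qed.

Lemma sol_rint : rint T (fun x => F x ^+ 2 + G x ^+ 2).
Proof.
have [C hC] := sol_bound.
have h1 x : 1 + rho x != 0 by rewrite gt_eqF // addr_gt0 // rho_gt0.
apply: (@rint_primitive R (fun x => F x ^+ 2 + G x ^+ 2) (fun x => C * (w x * rho x / (1 + rho x) ^+ 2))
  (fun x => - C * (1 + rho x)^-1) `|C|); last 1 first.
- move=> x; rewrite normrM normrN normfV [`|1 + _|]ger0_norm; last by rewrite ltW // addr_gt0 // rho_gt0.
  have r0 := rho_gt0 a M0 x.
  apply: ler_piMr => //; rewrite invf_le1; last by apply: addr_gt0.
  by have h : 0 < rr x - M := r0; lra.
- by move=> x; apply: cvgD; rewrite expr2; apply: cvgM; by [exact: F_continuous|exact: G_continuous].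
- move=> x; apply: cvgM; first exact: cvg_cst.
  apply: cvgM; first by apply: cvgM; [exact: w_continuous|exact: rho_continuous].
  apply: cvgV; first by rewrite expf_neq0.
  have c1 : {for x, continuous (fun x => 1 + rho x)} by apply: cvgD; [exact: cvg_cst|exact: rho_continuous].
  by rewrite expr2; apply: cvgM; exact: c1.
- by move=> x; rewrite addr_ge0 // sqr_ge0.
- exact: hC.
- move=> x; apply: hasder_eq (hasderM (hasder_cst (- C) x) (hasderV (hasderD (hasder_cst 1 x) (rho_hasder a M0 x)) (h1 x))) _.
  by rewrite mul0r !add0r !mulNr mulrN opprK.
Qed.

(** The combination [k * fC + p * gC] has constant coefficient [tc 0], that is -2 k N, which is
    nonzero because [0 < N]; a polynomial with nonzero constant term cannot vanish for all small
    positive arguments. *)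
Lemma sol_nonzero : exists x, 0 < F x ^+ 2 + G x ^+ 2.
Proof.
apply: contrapT => h.
have z x : F x = 0 /\ G x = 0.
  have : F x ^+ 2 + G x ^+ 2 = 0.
    apply/eqP; rewrite eq_le addr_ge0 ?sqr_ge0 // andbT leNgt; apply/negP => hx; apply: h; by exists x.
  by move/eqP; rewrite paddr_eq0 ?sqr_ge0 // !sqrf_eq0 => /andP[/eqP ? /eqP ?].
have tz r : 0 < r -> poly_sum N (tc k s N) r = 0.
  move=> r0; have [z1 z2] := z (tortoise M a (M + r)).
  have er : rr (tortoise M a (M + r)) - M = r by rewrite rr_tort ?ltrDl // addrAC subrr add0r.
  have e0 : envelope M a k s (tortoise M a (M + r)) != 0 by rewrite gt_eqF // expR_gt0.
  move/eqP: z1; rewrite /sol_f er mulf_eq0 (negbTE e0) /= => /eqP z1.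
  move/eqP: z2; rewrite /sol_g er mulf_eq0 (negbTE e0) /= => /eqP z2.
  have <- : poly_sum N (fun j => k * fC j + p * gC j) r = poly_sum N (tc k s N) r.
    by apply: eq_poly_sum => j; exact: tcE.
  by rewrite -poly_sum_lin z1 z2 !mulr0 addr0.
have t0 : tc k s N 0 != 0.
  rewrite /tc /= mul1r sub0r mulf_neq0 //; first by rewrite gt_eqF // mulr_gt0.
  by rewrite oppr_eq0 pnatr_eq0 -lt0n.
pose S r := \sum_(j < N) tc k s N j.+1 * r ^+ j.
have pe r : poly_sum N (tc k s N) r = tc k s N 0 + r * S r.
  rewrite /poly_sum big_ord_recl /= expr0 mulr1 /S mulr_sumr; congr (_ + _).
  by apply: eq_bigr => j _; rewrite /bump /= add1n exprS; ring.
pose B := \sum_(j < N) `|tc k s N j.+1| + 1.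
have B0 : 0 < B by rewrite ltr_wpDl // sumr_ge0.
have SB r : 0 < r -> r <= 1 -> `|S r| <= B.
  move=> r0 r1; apply: le_trans (ler_norm_sum _ _ _) _.
  apply: le_trans (_ : \sum_(j < N) `|tc k s N j.+1| <= _); last by rewrite lerDl.
  apply: ler_sum => j _; rewrite normrM ler_piMr // normrX ger0_norm ?(ltW r0) //.
  by rewrite exprn_ile1 // ltW.
have tp : 0 < `|tc k s N 0| by rewrite normr_gt0.
(* At this radius all higher terms together are at most half of the constant one. *)
pose r := Num.min 1 (`|tc k s N 0| / (2 * B)).
have r0 : 0 < r by rewrite lt_min ltr01 divr_gt0 // mulr_gt0.
have r1 : r <= 1 by rewrite ge_min lexx.
have r2 : r * (2 * B) <= `|tc k s N 0|.
  by rewrite -ler_pdivlMr ?mulr_gt0 // ge_min lexx orbT.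
have := tz r r0; rewrite pe => /eqP; rewrite addr_eq0 => /eqP e.
have := tp; rewrite e normrN normrM (gtr0_norm r0) in r2 *.
have : r * `|S r| <= r * B by rewrite ler_pM2l // SB.
by nra.
Qed.

End LaguerreIntegrability.

Lemma continuous_not_ae0 (R : realType) (n : R -> R) : continuous n -> (exists x, 0 < n x) ->
  ~ {ae (@lebesgue_measure R), forall x, n x = 0}.
Proof.
move=> cn [x0 nx0] hae.
have /nbhs_ballP[d d0 hd] : \forall y \near x0, 0 < n y by apply: (cvgr_gt _ (cn x0)).
have dp : 0 < d by [].
have xd : x0 < x0 + d by rewrite ltrDl.
have [y /andP[y1 y2] ny] := ae_exists xd hae.
have : 0 < n y by apply: hd; rewrite /ball /= ltr_norml; apply/andP; split; lra.
by rewrite ny ltxx.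
Qed.

Lemma radial_eigenvalue (R : realType) (M a Q e kappa m lambda k s : R) (N : nat) : 0 < M ->
  M ^+ 2 = a ^+ 2 + Q ^+ 2 -> let om := omega_crit M a Q e kappa in
  let be := e * Q + 2 * om * M in
  0 < k -> k ^+ 2 = (m + om) * (m - om) -> 1 <= s -> (0 < N)%N ->
  s ^+ 2 = lambda ^+ 2 + (m * M + be) * (m * M - be) ->
  (m + om) * (m * M - be) + (m - om) * (m * M + be) = - (2 * k * (s + N%:R)) ->
  op_eigenvalue [set: R] (radial_operator M a Q e kappa m lambda) om.
Proof.
move=> M0 extreme om be k0 kpq s1 N0 sE quant.
pose F := sol_f M a lambda (m * M + be) (m - om) k s N.
pose G := sol_g M a lambda (m * M - be) (m - om) k s N.
pose w x := (inv_tortoise M a x - M) / dd M a x.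
pose dF x := w x * (- lambda * F x + (m * M + be + (m + om) * (inv_tortoise M a x - M)) * G x).
pose dG x := w x * ((m * M - be + (m - om) * (inv_tortoise M a x - M)) * F x + lambda * G x).
have hF x : hasder F x (dF x) by exact: (sol_f_hasder a M0 k0 kpq s1 sE quant x).
have hG x : hasder G x (dG x) by exact: (sol_g_hasder a M0 k0 kpq s1 sE quant x).
have cF : continuous F by move=> x; exact: hasder_continuous (hF x).
have cG : continuous G by move=> x; exact: hasder_continuous (hG x).
have nint : rint [set: R] (fun x => F x ^+ 2 + G x ^+ 2) by exact: (sol_rint a M0 k0 kpq s1 sE quant).
have cn : continuous (fun x => F x ^+ 2 + G x ^+ 2).
  by move=> x; apply: cvgD; rewrite expr2; apply: cvgM; by [exact: cF|exact: cG].
pose u : spinor R := fun x => (F x +i* 0, G x +i* 0).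
have cu1 b : comp1 b u = if b then (fun=> 0) else F by case: b.
have cu2 b : comp2 b u = if b then (fun=> 0) else G by case: b.
have mF := continuous_measurable_fun cF; have mG := continuous_measurable_fun cG.
have F2 : rint [set: R] (fun x => F x ^+ 2).
  apply: rint_le nint => //; first exact: measurable_funX.
  by move=> x _; rewrite ger0_norm ?sqr_ge0 // lerDl sqr_ge0.
have G2 : rint [set: R] (fun x => G x ^+ 2).
  apply: rint_le nint => //; first exact: measurable_funX.
  by move=> x _; rewrite ger0_norm ?sqr_ge0 // lerDr sqr_ge0.
have L2u (t : R) : L2 [set: R] (fun=> 1) (fun x => (t%:C * (u x).1, t%:C * (u x).2)).
  apply: L2_intro; [exact: measurableT|exact: measurable_cst|by move=> *; exact: ler01|].
  move=> b.
  have e1 : comp1 b (fun x => (t%:C * (u x).1, t%:C * (u x).2)) = (fun x => t * comp1 b u x).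
    by apply/funext => x; rewrite /comp1 partZ.
  have e2 : comp2 b (fun x => (t%:C * (u x).1, t%:C * (u x).2)) = (fun x => t * comp2 b u x).
    by apply/funext => x; rewrite /comp2 partZ.
  rewrite e1 e2 cu1 cu2; case: b {e1 e2}.
    have z : rint [set: R] (fun=> 1 * (t * 0) ^+ 2) by rewrite mulr0 expr0n mulr0; exact: rint0.
    by split=> //; exact: measurable_cst.
  have i (H : R -> R) : rint [set: R] (fun x => H x ^+ 2) -> rint [set: R] (fun x => 1 * (t * H x) ^+ 2).
    by move=> h; apply: rint_ext (rintZ (t ^+ 2) measurableT h) => // x _; rewrite mul1r exprMn.
  by split; [exact: measurable_funM|exact: measurable_funM|exact: i|exact: i].
have [K [c1 c2 c3 [b1 b2 b3]]] := rB_regular a Q e kappa m lambda M0.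
have cw : continuous w by exact: w_continuous.
have cr : continuous (fun x => inv_tortoise M a x - M) by exact: rho_continuous.
exists u; split.
  move=> h; have nz : exists x, 0 < F x ^+ 2 + G x ^+ 2 by exact: (sol_nonzero a M0 lambda k0 kpq N0 quant).
  apply: (continuous_not_ae0 cn nz).
  by apply: aeS h => x hx; have [-> ->] := hx I; rewrite expr0n addr0.
rewrite (radial_operatorE e kappa m lambda M0 extreme).
apply: C1_adjoint => //.
  have := L2u 1; congr (L2 _ _ _); apply/funext => x; rewrite [RHS]surjective_pairing.
  by rewrite !mul1r.
move=> b; rewrite cu1 cu2; case: b.
  exists (fun=> 0), (fun=> 0); split; [by move=> x; exact: hasder_cst|by move=> x; exact: hasder_cst| | |].
  - by move=> x; exact: cvg_cst.
  - by move=> x; exact: cvg_cst.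
  - by move=> x; rewrite /comp1 /comp2 !partZ /= !mulr0 oppr0 !addr0.
exists dF, dG; split=> //.
- move=> x; apply: cvgM; first exact: cw.
  apply: cvgD; first by apply: cvgM; [exact: cvg_cst|exact: cF].
  apply: cvgM; last exact: cG.
  by apply: cvgD; [exact: cvg_cst|apply: cvgM; [exact: cvg_cst|exact: cr]].
- move=> x; apply: cvgM; first exact: cw.
  apply: cvgD; last by apply: cvgM; [exact: cvg_cst|exact: cG].
  apply: cvgM; last exact: cF.
  by apply: cvgD; [exact: cvg_cst|apply: cvgM; [exact: cvg_cst|exact: cr]].
- move=> x; rewrite /comp1 /comp2 !partZ /=.
  have hP := critP a Q e kappa m M0 x; have hN := critN a Q e kappa m M0 x.
  have hL := critL M a lambda x.
  rewrite -/om -/be -/(w x) in hP hN hL.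
  have -> : dG x = (rB11 M a Q e kappa m x - om) * F x + rB12 M a lambda x * G x by rewrite hN hL /dG; ring.
  have -> : dF x = - rB12 M a lambda x * F x + (om - rB22 M a Q e kappa m x) * G x by rewrite hP hL /dF; ring.
  by split; ring.
Qed.

(** * The angular operator *)

Section AngularEigenfunctions.
Variable R : realType.
Notation mu := (@lebesgue_measure R).
Notation D := (@angular_domain R).
Variables (m a omega kappa l : R).
Implicit Types (u : spinor R) (b : bool) (f z ce : R -> R) (x : R).

Definition qang x : R := a * omega * sin x + kappa / sin x.

Lemma D_itv : D = `]0, pi[%classic.
Proof. by apply/seteqP; split=> x /=; rewrite in_itv. Qed.

Lemma open_angD : open D.
Proof. by rewrite D_itv; exact: interval_open. Qed.

Lemma measurable_angD : measurable D.
Proof. by rewrite D_itv; exact: measurable_itv. Qed.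

Lemma segment_closedD : segment_closed D.
Proof.
move=> x z /andP[x0 xp] /andP[z0 zp] t /=; rewrite in_itv /= => /andP[xt tz].
by apply/andP; split; [exact: lt_le_trans xt|exact: le_lt_trans tz _].
Qed.

Lemma finD : (mu D < +oo)%E.
Proof. by rewrite D_itv lebesgue_measure_itv /=; case: ifP => _ //; rewrite -EFinB ltry. Qed.

Lemma sin_gt0D x : D x -> 0 < sin x.
Proof. exact: sin_gt0_pi. Qed.

Lemma continuous_onD_measurable f : (forall x, D x -> {for x, continuous f}) -> measurable_fun D f.
Proof.
by move=> h; apply: open_continuous_measurable_fun; [exact: open_angD|move=> x; rewrite inE; exact: h].
Qed.

Lemma cot_continuous x : D x -> {for x, continuous (@cot R)}.
Proof.
move=> Dx; apply: cvgM; first exact: continuous_cos.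
by apply: cvgV; [rewrite gt_eqF // sin_gt0D|exact: continuous_sin].
Qed.

Lemma qang_continuous x : D x -> {for x, continuous qang}.
Proof.
move=> Dx; apply: cvgD; first by apply: cvgM; [exact: cvg_cst|exact: continuous_sin].
apply: cvgM; first exact: cvg_cst.
by apply: cvgV; [rewrite gt_eqF // sin_gt0D|exact: continuous_sin].
Qed.

Definition cA x : R := cot x / 2 + qang x.
Definition cB x : R := cot x / 2 - qang x.
Definition cC x : R := a * m * cos x - l.
Definition cE x : R := a * m * cos x + l.

Lemma coef_continuous x : D x -> [/\ {for x, continuous cA}, {for x, continuous cB},
  {for x, continuous cC} & {for x, continuous cE}].
Proof.
move=> Dx; have c1 : {for x, continuous (fun x => cot x / 2)}.
  by apply: cvgM; [exact: cot_continuous|exact: cvg_cst].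
have c2 : {for x, continuous (fun x => a * m * cos x)}.
  by apply: cvgM; [exact: cvg_cst|exact: continuous_cos].
split; [apply: cvgD|apply: cvgB|apply: cvgB|apply: cvgD] => //; by [exact: qang_continuous|exact: cvg_cst].
Qed.

(** The coefficients are singular at 0 and pi, but they are bounded on the compact subset of [D]
    outside which the test function vanishes. *)
Lemma test_coef_rint f ce z : testfn D f -> (forall x, D x -> {for x, continuous ce}) -> rint D z ->
  rint D (fun x => f x * ce x * z x).
Proof.
move=> tf cce zi; have [df [hf _ _ _]] := testfn_hasder tf.
have cf x : {for x, continuous f} := hasder_continuous (hf x).
have cfc x : D x -> {for x, continuous (fun x => f x * ce x)}.
  by move=> Dx; apply: cvgM; [exact: cf|exact: cce].
have [K hK] : exists K, forall x, D x -> `|f x * ce x| <= K.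
  case: tf => _ [A [cA AD f0]].
  have cw : {within A, continuous (fun x => f x * ce x)}.
    by apply: continuous_in_subspaceT => x; rewrite inE => /AD; exact: cfc.
  have /compact_bounded[K [_ hK]] := continuous_compact cw cA.
  exists (`|K| + 1) => x Dx.
  have [Ax|nA] := pselect (A x); last by rewrite f0 // mul0r normr0 addr_ge0.
  apply: (hK (`|K| + 1)); last by exists x.
  by apply: le_lt_trans (ler_norm K) _; rewrite ltrDl.
apply: (@rint_bounded R D z (fun x => f x * ce x) K) => //; first exact: measurable_angD.
exact: continuous_onD_measurable.
Qed.

Lemma coef_seg_rint ce z x y : (forall x, D x -> {for x, continuous ce}) -> rint D z -> D x -> D y ->
  rint `[x, y] (fun t => ce t * z t).
Proof.
move=> cce zi Dx Dy; apply: rint_contM.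
  by move=> t h; apply: cce; exact: (segment_closedD Dx Dy).
by apply: rintS zi => //; [exact: measurable_angD|exact: segment_closedD].
Qed.

Lemma locint_patch z : rint D z -> locally_integrable [set: R] (z \_ D).
Proof.
move=> zi; apply: open_integrable_locally; first exact: openT.
by have := rint_patch measurable_angD zi.
Qed.

(** [Z1] and [Z2] stand for [sin x] times a real coordinate of the two components. Absorbing the
    weight turns the tested identity into a weak derivative for Lebesgue measure, and the weighted
    square norm becomes [Z x ^+ 2 / sin x]. *)
Definition zsol (Z1 Z2 : R -> R) : Prop :=
  [/\ forall x, D x -> hasder Z1 x (cA x * Z1 x + cC x * Z2 x),
     forall x, D x -> hasder Z2 x (cE x * Z1 x + cB x * Z2 x),
     rint D (fun x => Z1 x ^+ 2 / sin x) /\ rint D (fun x => Z2 x ^+ 2 / sin x) &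
     exists x, D x /\ (Z1 x != 0 \/ Z2 x != 0)].

Notation T0 := (minimal_operator D (angular_expr m a omega kappa)).

Lemma angular_expr1 b f x (d : R) : hasder f x d ->
  angular_expr m a omega kappa (fun x => (cpart b (f x), 0)) x =
  (cpart b (- (a * m * cos x) * f x), cpart b (- (d + cot x / 2 * f x - qang x * f x))).
Proof.
move=> hf; rewrite /angular_expr /Lang /= cderive0 (cderive_cpart b hf) /qang.
by congr pair; apply: part_inj => -[]; case: b => /=; ring.
Qed.

Lemma angular_expr2 b f x (d : R) : hasder f x d ->
  angular_expr m a omega kappa (fun x => (0, cpart b (f x))) x =
  (cpart b (d + cot x / 2 * f x + qang x * f x), cpart b (a * m * cos x * f x)).
Proof.
move=> hf; rewrite /angular_expr /Lang /= cderive0 (cderive_cpart b hf) /qang.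
by congr pair; apply: part_inj => -[]; case: b => /=; ring.
Qed.

Lemma adjoint_zsol u : adjoint D (@sin R) T0 (u, fun x => (l%:C * (u x).1, l%:C * (u x).2)) ->
  ~ {ae mu, forall x, D x -> u x = (0, 0)} -> exists Z1 Z2, zsol Z1 Z2.
Proof.
case=> /= Lu _ hadj nz.
have sm : measurable_fun D (@sin R).
  by apply: continuous_onD_measurable => x _; exact: continuous_sin.
have s0 x : D x -> 0 <= sin x by move=> /sin_gt0D; exact: ltW.
have Lc := L2_comp measurable_angD sm s0 Lu.
pose z1 b x := sin x * comp1 b u x; pose z2 b x := sin x * comp2 b u x.
have zi (v : R -> R) : measurable_fun D v -> rint D (fun x => sin x * v x ^+ 2) -> rint D (fun x => sin x * v x).
  move=> mv v2; apply: (@rint_le _ _ _ (fun x => 1 + sin x * v x ^+ 2)); first exact: measurable_angD.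
  - exact: measurable_funM.
  - move=> x Dx; have s1 := s0 x Dx; have s2 := sin_le1 x.
    rewrite normrM (ger0_norm s1); have : `|v x| <= 1 + v x ^+ 2.
      by rewrite ler_norml; apply/andP; split; nra.
    move=> h; have := ler_wpM2l s1 h; lra.
  - by apply: rintD => //; [exact: measurable_angD|apply: rint_cst; [exact: measurable_angD|exact: finD]].
have zi1 b : rint D (z1 b) by have [m1 m2 i1 i2] := Lc b; exact: zi.
have zi2 b : rint D (z2 b) by have [m1 m2 i1 i2] := Lc b; exact: zi.
have CA x : D x -> {for x, continuous cA} by move=> /coef_continuous[].
have CB x : D x -> {for x, continuous cB} by move=> /coef_continuous[].
have CC x : D x -> {for x, continuous cC} by move=> /coef_continuous[].
have CE x : D x -> {for x, continuous cE} by move=> /coef_continuous[].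
have mD := measurable_angD.
have ex2 b : exists Z2, abscont D Z2 (fun x => cE x * z1 b x + cB x * z2 b x) /\
    (\forall x \ae mu, D x -> Z2 x = z2 b x).
  apply: abscont_exists => //.
  - exact: open_angD.
  - by exists (pi / 2); rewrite /D /= ; have := pi_gt0 R => h; apply/andP; split; lra.
  - exact: segment_closedD.
  - exact: locint_patch.
  - by move=> x z Dx Dz; apply: rintD => //; exact: coef_seg_rint.
  move=> f df tf hf; have [df' [hf' _ _ tdf]] := testfn_hasder tf.
  have edf : df' = df by apply/funext => x; exact: hasder_uniq (hf' x) (hf x).
  rewrite {df' hf'}edf in tdf.
  have := hadj (fun x => (cpart b (f x), 0)) (angular_expr m a omega kappa (fun x => (cpart b (f x), 0))) (conj (test_spinor1 b tf) erefl).
  move=> /(congr1 (@complex.Re R)) /= eq1.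
  have e1 : RI D (fun x => sin x * ((- (a * m * cos x) * f x) * comp1 b u x + (- (df x + cot x / 2 * f x - qang x * f x)) * comp2 b u x))
     = RI D (fun x => sin x * (f x * (l * comp1 b u x))).
    pose v : spinor R := (fun x => (cpart b (f x), 0)).
    pose tv := angular_expr m a omega kappa v.
    transitivity (RI D (fun x => complex.Re ((sin x)%:C * ((tv x).1 * conjc (u x).1 + (tv x).2 * conjc (u x).2)))).
      by apply: RI_ext => x _; rewrite /tv /v (angular_expr1 b (hf x)) Re_cpart /comp1 /comp2.
    transitivity (RI D (fun x => complex.Re ((sin x)%:C * ((v x).1 * conjc (l%:C * (u x).1) + (v x).2 * conjc (l%:C * (u x).2))))); first exact: eq1.
    apply: RI_ext => x _; have -> : v x = (cpart b (f x), cpart b 0) by rewrite /v; congr pair; case: (b).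
    rewrite Re_cpart !partZ /comp1 /comp2 /=; ring.
  have i0 := test_coef_rint tdf (fun x _ => @cst_continuous R R 1 x) (zi2 b).
  have i1 := test_coef_rint tf CE (zi1 b).
  have i2 := test_coef_rint tf CB (zi2 b).
  have i3 := test_coef_rint tf (fun x _ => @cst_continuous R R l x) (zi1 b).
  have iG : rint D (fun x => df x * 1 * z2 b x + (f x * cE x * z1 b x + f x * cB x * z2 b x)).
    by apply: rintD => //; exact: rintD.
  move: e1; rewrite (_ : RI D _ = RI D (fun x => f x * l * z1 b x) -
     RI D (fun x => df x * 1 * z2 b x + (f x * cE x * z1 b x + f x * cB x * z2 b x))); last first.
    by rewrite -RIB //; apply: RI_ext => x _; rewrite /cE /cB /z1 /z2; ring.
  rewrite (_ : RI D (fun x => sin x * (f x * (l * comp1 b u x))) = RI D (fun x => f x * l * z1 b x)); last first.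
    by apply: RI_ext => x _; rewrite /z1; ring.
  rewrite RID //; last exact: rintD.
  rewrite (_ : RI D (fun x => df x * 1 * z2 b x) = RI D (fun x => df x * z2 b x)); last first.
    by apply: RI_ext => x _; rewrite mulr1.
  rewrite (_ : RI D (fun x => f x * cE x * z1 b x + f x * cB x * z2 b x) =
     RI D (fun x => f x * (cE x * z1 b x + cB x * z2 b x))); last first.
    by apply: RI_ext => x _; ring.
  lra.
have ex1 b : exists Z1, abscont D Z1 (fun x => cA x * z1 b x + cC x * z2 b x) /\
    (\forall x \ae mu, D x -> Z1 x = z1 b x).
  apply: abscont_exists => //.
  - exact: open_angD.
  - by exists (pi / 2); rewrite /D /= ; have := pi_gt0 R => h; apply/andP; split; lra.
  - exact: segment_closedD.
  - exact: locint_patch.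
  - by move=> x z Dx Dz; apply: rintD => //; exact: coef_seg_rint.
  move=> f df tf hf; have [df' [hf' _ _ tdf]] := testfn_hasder tf.
  have edf : df' = df by apply/funext => x; exact: hasder_uniq (hf' x) (hf x).
  rewrite {df' hf'}edf in tdf.
  have := hadj (fun x => (0, cpart b (f x))) (angular_expr m a omega kappa (fun x => (0, cpart b (f x)))) (conj (test_spinor2 b tf) erefl).
  move=> /(congr1 (@complex.Re R)) /= eq1.
  have e1 : RI D (fun x => sin x * ((df x + cot x / 2 * f x + qang x * f x) * comp1 b u x + (a * m * cos x * f x) * comp2 b u x))
     = RI D (fun x => sin x * (f x * (l * comp2 b u x))).
    pose v : spinor R := (fun x => (0, cpart b (f x))).
    pose tv := angular_expr m a omega kappa v.
    transitivity (RI D (fun x => complex.Re ((sin x)%:C * ((tv x).1 * conjc (u x).1 + (tv x).2 * conjc (u x).2)))).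
      by apply: RI_ext => x _; rewrite /tv /v (angular_expr2 b (hf x)) Re_cpart /comp1 /comp2.
    transitivity (RI D (fun x => complex.Re ((sin x)%:C * ((v x).1 * conjc (l%:C * (u x).1) + (v x).2 * conjc (l%:C * (u x).2))))); first exact: eq1.
    apply: RI_ext => x _; have -> : v x = (cpart b 0, cpart b (f x)) by rewrite /v; congr pair; case: (b).
    rewrite Re_cpart !partZ /comp1 /comp2 /=; ring.
  have i0 := test_coef_rint tdf (fun x _ => @cst_continuous R R 1 x) (zi1 b).
  have i1 := test_coef_rint tf CA (zi1 b).
  have i2 := test_coef_rint tf CC (zi2 b).
  have i3 := test_coef_rint tf (fun x _ => @cst_continuous R R l x) (zi2 b).
  have iG : rint D (fun x => df x * 1 * z1 b x + (f x * cA x * z1 b x + f x * cC x * z2 b x)).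
    by apply: rintD => //; exact: rintD.
  move: e1; rewrite (_ : RI D _ = RI D (fun x => f x * l * z2 b x) +
     RI D (fun x => df x * 1 * z1 b x + (f x * cA x * z1 b x + f x * cC x * z2 b x))); last first.
    by rewrite -RID //; apply: RI_ext => x _; rewrite /cA /cC /z1 /z2; ring.
  rewrite (_ : RI D (fun x => sin x * (f x * (l * comp2 b u x))) = RI D (fun x => f x * l * z2 b x)); last first.
    by apply: RI_ext => x _; rewrite /z2; ring.
  rewrite RID //; last exact: rintD.
  rewrite (_ : RI D (fun x => df x * 1 * z1 b x) = RI D (fun x => df x * z1 b x)); last first.
    by apply: RI_ext => x _; rewrite mulr1.
  rewrite (_ : RI D (fun x => f x * cA x * z1 b x + f x * cC x * z2 b x) =
     RI D (fun x => f x * (cA x * z1 b x + cC x * z2 b x))); last first.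
    by apply: RI_ext => x _; ring.
  lra.
have [b nzb] : exists b, ~ (\forall x \ae mu, D x -> comp1 b u x = 0 /\ comp2 b u x = 0).
  apply: contrapT => h; apply: nz.
  have hh b : \forall x \ae mu, D x -> comp1 b u x = 0 /\ comp2 b u x = 0.
    by apply: contrapT => h2; apply: h; exists b.
  apply: aeS (aeI (hh false) (hh true)) => x [h1 h2] Dx.
  have [h11 h12] := h1 Dx; have [h21 h22] := h2 Dx.
  rewrite [u x]surjective_pairing; congr pair; apply: part_inj => -[].
  - exact: h21.
  - exact: h11.
  - exact: h22.
  - exact: h12.
have [Z1 [a1 e1]] := ex1 b; have [Z2 [a2 e2]] := ex2 b.
have C1 x : D x -> {for x, continuous Z1} by exact: abscont_continuous open_angD a1 x.
have C2 x : D x -> {for x, continuous Z2} by exact: abscont_continuous open_angD a2 x.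
have cc1 x : D x -> {for x, continuous (fun x => cA x * Z1 x + cC x * Z2 x)}.
  by move=> Dx; apply: cvgD; apply: cvgM; [exact: CA|exact: C1|exact: CC|exact: C2].
have cc2 x : D x -> {for x, continuous (fun x => cE x * Z1 x + cB x * Z2 x)}.
  by move=> Dx; apply: cvgD; apply: cvgM; [exact: CE|exact: C1|exact: CB|exact: C2].
have a1' : abscont D Z1 (fun x => cA x * Z1 x + cC x * Z2 x).
  apply: (abscont_ae segment_closedD a1).
    move=> x z Dx Dz; apply: (measurable_funS mD) (continuous_onD_measurable cc1).
    exact: segment_closedD.
  by apply: aeS (aeI e1 e2) => x [h1 h2] Dx; rewrite h1 // h2.
have a2' : abscont D Z2 (fun x => cE x * Z1 x + cB x * Z2 x).
  apply: (abscont_ae segment_closedD a2).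
    move=> x z Dx Dz; apply: (measurable_funS mD) (continuous_onD_measurable cc2).
    exact: segment_closedD.
  by apply: aeS (aeI e1 e2) => x [h1 h2] Dx; rewrite h1 // h2.
have msq (Z : R -> R) : (forall x, D x -> {for x, continuous Z}) -> measurable_fun D (fun x => Z x ^+ 2 / sin x).
  move=> cZ; apply: continuous_onD_measurable => x Dx; apply: cvgM.
    by rewrite expr2; apply: cvgM; exact: cZ.
  by apply: cvgV; [rewrite gt_eqF // sin_gt0D|exact: continuous_sin].
have [m1 m2 i1 i2] := Lc b.
exists Z1, Z2; split.
- by move=> x Dx; exact: (abscont_hasder open_angD a1' Dx (cc1 x Dx)).
- by move=> x Dx; exact: (abscont_hasder open_angD a2' Dx (cc2 x Dx)).
- split.
    apply: (rint_ae mD (msq _ C1)) i1; apply: aeS e1 => x h Dx; rewrite h // /z1.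
    by field; rewrite gt_eqF // sin_gt0D.
  apply: (rint_ae mD (msq _ C2)) i2; apply: aeS e2 => x h Dx; rewrite h // /z2.
  by field; rewrite gt_eqF // sin_gt0D.
- apply: contrapT => hn; apply: nzb; apply: aeS (aeI e1 e2) => x [h1 h2] Dx.
  have sx := lt0r_neq0 (sin_gt0D Dx).
  have Z0 : Z1 x = 0 /\ Z2 x = 0.
    by split; apply/eqP; apply: contrapT => /negP h; apply: hn; exists x; split=> //; [left|right].
  case: Z0; rewrite h1 // h2 // /z1 /z2 => /eqP + /eqP.
  by rewrite !mulf_eq0 (negbTE sx) /= => /eqP -> /eqP ->.
Qed.

Lemma minimal_zsol u : T0 (u, fun x => (l%:C * (u x).1, l%:C * (u x).2)) ->
  ~ {ae mu, forall x, D x -> u x = (0, 0)} -> exists Z1 Z2, zsol Z1 Z2.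
Proof.
case=> /= tu eqn nz.
have [s1 s2 [A [cptA AD u0]]] := tu.
have t1 b : testfn D (comp1 b u).
  split; first by case: b; [exact: s1.2|exact: s1.1].
  by exists A; split=> // x /u0 e; rewrite /comp1 e; case: b.
have t2 b : testfn D (comp2 b u).
  split; first by case: b; [exact: s2.2|exact: s2.1].
  by exists A; split=> // x /u0 e; rewrite /comp2 e; case: b.
have [b [x [Dx nzx]]] : exists b x, D x /\ (comp1 b u x != 0 \/ comp2 b u x != 0).
  apply: contrapT => h; apply: nz; apply: aeW => x Dx.
  have hh b : comp1 b u x = 0 /\ comp2 b u x = 0.
    by split; apply/eqP; apply: contrapT => /negP hn; apply: h; exists b, x; split=> //; [left|right].
  have [h11 h12] := hh false; have [h21 h22] := hh true.
  rewrite [u x]surjective_pairing; congr pair; apply: part_inj => -[].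
  - exact: h21.
  - exact: h11.
  - exact: h22.
  - exact: h12.
have [d1 [h1 cd1 _ _]] := testfn_hasder (t1 b); have [d2 [h2 cd2 _ _]] := testfn_hasder (t2 b).
have e1 y : D y -> d2 y = l * comp1 b u y + a * m * cos y * comp1 b u y - (cot y / 2 + qang y) * comp2 b u y.
  move=> Dy; have := congr1 (fun f : spinor R => part b (f y).1) eqn; rewrite /= /Lang.
  rewrite partZ !(partD, partN, partZ) part_cderive (hasder_derive (h2 y)).2 -/(comp1 b u y) -/(comp2 b u y).
  by rewrite /qang => h; lra.
have e2 y : D y -> d1 y = a * m * cos y * comp2 b u y - l * comp2 b u y - (cot y / 2 - qang y) * comp1 b u y.
  move=> Dy; have := congr1 (fun f : spinor R => part b (f y).2) eqn; rewrite /= /Lang.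
  rewrite partZ !(partD, partN, partZ) part_cderive (hasder_derive (h1 y)).2 -/(comp1 b u y) -/(comp2 b u y).
  by rewrite /qang => h; lra.
have csq (f : R -> R) : (forall y, {for y, continuous f}) -> rint D (fun y => (sin y * f y) ^+ 2 / sin y).
  move=> cf.
  have h : rint `[0, pi] (fun y => sin y * f y ^+ 2).
    apply: rint_contf => y _; apply: cvgM; first exact: continuous_sin.
    by rewrite expr2; apply: cvgM; exact: cf.
  have sub : D `<=` `[0, pi]%classic by rewrite D_itv; exact: subset_itv_oo_cc.
  apply: (rint_ext measurable_angD _ (rintS _ measurable_angD sub h)) => // y Dy.
  by field; rewrite gt_eqF // sin_gt0D.
exists (fun y => sin y * comp1 b u y), (fun y => sin y * comp2 b u y); split.
- move=> y Dy; have sy := lt0r_neq0 (sin_gt0D Dy).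
  apply: hasder_eq (hasderM (is_derive_sin y : hasder _ _ _) (h1 y)) _.
  by rewrite e2 // /cA /cC /cot; cbv beta; field.
- move=> y Dy; have sy := lt0r_neq0 (sin_gt0D Dy).
  apply: hasder_eq (hasderM (is_derive_sin y : hasder _ _ _) (h2 y)) _.
  by rewrite e1 // /cB /cE /cot; cbv beta; field.
- by split; apply: csq => y; [exact: hasder_continuous (h1 y)|exact: hasder_continuous (h2 y)].
- exists x; split=> //; have sx := lt0r_neq0 (sin_gt0D Dx).
  by rewrite !mulf_eq0 !negb_or sx.
Qed.

(** Both outcomes of the choice operator are covered: a self-adjoint extension is contained in the
    adjoint of the minimal operator, and the default value is the minimal operator itself. *)
Lemma operator_zsol u : angular_operator m a omega kappa (u, fun x => (l%:C * (u x).1, l%:C * (u x).2)) ->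
  ~ {ae mu, forall x, D x -> u x = (0, 0)} -> exists Z1 Z2, zsol Z1 Z2.
Proof.
rewrite /angular_operator /the_selfadjoint_extension => hu nz.
have [[S hS]|nS] := pselect (exists S, selfadjoint_extension D (@sin R) T0 S).
  have [h1 h2] := @xgetPex _ T0 [set S | selfadjoint_extension D (@sin R) T0 S] (ex_intro _ S hS).
  apply: (adjoint_zsol _ nz); apply: (adjointS h1); rewrite -h2; exact: hu.
rewrite xgetPN in hu; last by move=> S hS; apply: nS; exists S.
exact: minimal_zsol hu nz.
Qed.

End AngularEigenfunctions.

(** * The integrating factor of the angular equation *)

Section AngularKernels.
Variable R : realType.
Notation mu := (@lebesgue_measure R).
Notation D := (@angular_domain R).
Variables (w kap : R).
Hypothesis kap_ge : 1 / 2 <= kap.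
Implicit Types (x y c B e : R) (f g h phi psi : R -> R).

Definition qw x : R := w * sin x + kap / sin x.
(** ln tan(x/2), the primitive of 1 / sin x that is odd about pi/2. *)
Definition lntan x : R := (ln (1 - cos x) - ln (1 + cos x)) / 2.
(** The integrating factor tan(x/2)^kap exp(- w cos x), whose logarithmic derivative is [qw]. *)
Definition Pw x : R := expR (kap * lntan x - w * cos x).
(** Bounds the quotient of any two values of exp(- w cos x). *)
Definition eW : R := expR (2 * `|w|).

Lemma cos_bound x : D x -> 0 < 1 - cos x /\ 0 < 1 + cos x.
Proof.
move=> Dx; have s0 := sin_gt0D Dx; have := cos2Dsin2 x; have : 0 < sin x ^+ 2 by rewrite exprn_gt0.
have -> : cos x ^+ 2 = 1 - (1 - cos x) * (1 + cos x) by ring.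
have := cos_le1 x; have := cos_geN1 x => h1 h2 h3 h4.
have h5 : 0 < (1 - cos x) * (1 + cos x) by lra.
split; rewrite lt_neqAle eq_sym; apply/andP; split; try lra.
- by apply/eqP => z; move: h5; rewrite z mul0r ltxx.
- by apply/eqP => z; move: h5; rewrite z mulr0 ltxx.
Qed.

Lemma lntan_hasder x : D x -> hasder lntan x (sin x)^-1.
Proof.
move=> Dx; have [c1 c2] := cos_bound Dx; have s0 := lt0r_neq0 (sin_gt0D Dx).
have hc : hasder (@cos R) x (- sin x) := is_derive_cos x.
have h1 : hasder (fun x => 1 - cos x) x (sin x).
  by apply: hasder_eq (hasderD (hasder_cst 1 x) (hasderN hc)) _; rewrite add0r opprK.
have h2 : hasder (fun x => 1 + cos x) x (- sin x).
  by apply: hasder_eq (hasderD (hasder_cst 1 x) hc) _; rewrite add0r.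
apply: hasder_eq (hasderM (hasderD (@hasder_comp _ (@ln R) _ x _ _ (is_derive1_ln c1) h1)
  (hasderN (@hasder_comp _ (@ln R) _ x _ _ (is_derive1_ln c2) h2))) (hasder_cst (2^-1) x)) _.
have e2 : (1 - cos x) * (1 + cos x) = sin x ^+ 2.
  by have h := cos2Dsin2 x; rewrite (_ : sin x ^+ 2 = 1 - cos x ^+ 2); [ring|lra].
rewrite mulr0 addr0 mulrN opprK -mulrDl.
have -> : (1 - cos x)^-1 + (1 + cos x)^-1 = 2 / ((1 - cos x) * (1 + cos x)).
  by field; rewrite !gt_eqF.
by rewrite e2; field.
Qed.

Lemma lntan_le x y : D x -> D y -> x <= y -> lntan x <= lntan y.
Proof.
move=> Dx Dy xy; apply: (@hasder_ge0_le _ lntan (fun x => (sin x)^-1)) => // t h.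
  by apply: lntan_hasder; exact: (segment_closedD Dx Dy).
by rewrite invr_ge0 ltW // sin_gt0D //; exact: (segment_closedD Dx Dy).
Qed.

Lemma lntan_reflect x : lntan (pi - x) = - lntan x.
Proof.
have e : cos (pi - x) = - cos x by rewrite cosB cospi sinpi mul0r addr0 mulN1r.
by rewrite /lntan e opprK; field.
Qed.

Lemma lntan_small B : exists x, D x /\ lntan x <= B.
Proof.
pose t := Num.min 1 (expR (2 * B)).
have t0 : 0 < t by rewrite lt_min ltr01 expR_gt0.
have t1 : t <= 1 by rewrite ge_min lexx.
have it : -1 <= 1 - t <= 1 by apply/andP; split; lra.
have ca : cos (acos (1 - t)) = 1 - t by have [] := acos_def it.
exists (acos (1 - t)); split.
  by rewrite /D /= acos_gt0 ?acos_ltpi //; apply/andP; split; lra.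
rewrite /lntan ca subKr.
have : ln t <= 2 * B.
  by rewrite -[leRHS]expRK ler_ln ?posrE ?expR_gt0 // ge_min lexx orbT.
have : 0 <= ln (1 + (1 - t)) by rewrite ln_ge0 // lerDl subr_ge0.
lra.
Qed.

Lemma D_reflect x : D x -> D (pi - x).
Proof. by move=> /andP[x1 x2]; apply/andP; split; lra. Qed.

Lemma lntan_large B : exists x, D x /\ B <= lntan x.
Proof.
have [x [Dx h]] := lntan_small (- B); exists (pi - x); split; first exact: D_reflect.
by rewrite lntan_reflect lerNr.
Qed.

(** The square of tan(x/2) is (1 - cos x) / (1 + cos x), at most (1 - cos x) (1 + cos x) when the
    cosine is nonnegative. *)
Lemma expR_lt x : D x -> 0 <= cos x -> expR (lntan x) <= sin x.
Proof.
move=> Dx c0; have [c1 c2] := cos_bound Dx; have s0 := sin_gt0D Dx.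
rewrite -ler_sqr ?nnegrE ?expR_ge0 ?(ltW s0) //.
have -> : expR (lntan x) ^+ 2 = (1 - cos x) / (1 + cos x).
  by rewrite -expRM_natl /lntan mulrC divfK ?pnatr_eq0 // expRB !lnK ?posrE.
have -> : sin x ^+ 2 = (1 - cos x) * (1 + cos x).
  by have h := cos2Dsin2 x; rewrite (_ : sin x ^+ 2 = 1 - cos x ^+ 2); [ring|lra].
apply: ler_wpM2l; first exact: ltW.
by apply: (@le_trans _ _ 1); [rewrite invf_le1 //; lra|lra].
Qed.

Lemma expR_ltN x : D x -> cos x <= 0 -> expR (- lntan x) <= sin x.
Proof.
move=> Dx c0; rewrite -lntan_reflect.
have -> : sin x = sin (pi - x) by rewrite sinB cospi sinpi mul0r sub0r mulN1r opprK.
apply: expR_lt; first exact: D_reflect.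
by rewrite cosB cospi sinpi mul0r addr0 mulN1r oppr_ge0.
Qed.

Lemma Pw_gt0 x : 0 < Pw x. Proof. exact: expR_gt0. Qed.

Lemma Pw_hasder x : D x -> hasder Pw x (qw x * Pw x).
Proof.
move=> Dx; have hc : hasder (@cos R) x (- sin x) := is_derive_cos x.
apply: hasder_eq (@hasder_comp _ (@expR R) (fun x => kap * lntan x - w * cos x) x _ _ (hasder_expR _)
  (hasderD (hasderM (hasder_cst kap x) (lntan_hasder Dx)) (hasderN (hasderM (hasder_cst w x) hc)))) _.
by rewrite /Pw /qw; ring.
Qed.

Lemma wcos_bound x : - `|w| <= w * cos x <= `|w|.
Proof. by rewrite -ler_norml normrM ler_piMr // ler_norml cos_le1 cos_geN1. Qed.

(** The power of the tangent increases and the other factor varies by at most [eW]; this bounds the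
    variation-of-constants kernel [Pw x / Pw y]. *)
Lemma Pw_le x y : D x -> D y -> x <= y -> Pw x <= eW * Pw y.
Proof.
move=> Dx Dy xy; rewrite /eW /Pw -expRD ler_expR.
have k0 : 0 <= kap by have := kap_ge; lra.
have := ler_wpM2l k0 (lntan_le Dx Dy xy).
have /andP[? ?] := wcos_bound x; have /andP[? ?] := wcos_bound y; lra.
Qed.

(** This is where [kap >= 1/2] is decisive: for tan(x/2) <= 1 it gives tan(x/2)^(2 kap) <= tan(x/2)
    <= sin x. *)
Lemma Pw_sq x : D x -> 0 <= cos x -> lntan x <= 0 -> Pw x ^+ 2 <= eW * sin x.
Proof.
move=> Dx c0 l0; apply: le_trans (_ : eW * expR (lntan x) <= _); last first.
  by rewrite ler_pM2l ?expR_gt0 // expR_lt.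
rewrite /eW /Pw -expRM_natl -expRD ler_expR.
have : 2 * kap * lntan x <= lntan x by have := kap_ge; nra.
have /andP[? ?] := wcos_bound x; lra.
Qed.

Lemma Pw_sqV x : D x -> cos x <= 0 -> 0 <= lntan x -> (Pw x)^-1 ^+ 2 <= eW * sin x.
Proof.
move=> Dx c0 l0; apply: le_trans (_ : eW * expR (- lntan x) <= _); last first.
  by rewrite ler_pM2l ?expR_gt0 // expR_ltN.
rewrite /eW /Pw -expRN -expRM_natl -expRD ler_expR.
have : lntan x <= 2 * kap * lntan x by have := kap_ge; nra.
have /andP[? ?] := wcos_bound x; lra.
Qed.

Lemma inv_sin_continuous x : D x -> {for x, continuous (fun x => (sin x)^-1)}.
Proof. by move=> Dx; apply: cvgV; [rewrite gt_eqF // sin_gt0D|exact: continuous_sin]. Qed.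

Lemma RI_inv_sin x y : D x -> D y -> x <= y -> RI `[x, y] (fun t => (sin t)^-1) = lntan y - lntan x.
Proof.
move=> Dx Dy xy; apply: RI_FTC => // t h.
  by apply: lntan_hasder; exact: (segment_closedD Dx Dy).
by apply: inv_sin_continuous; exact: (segment_closedD Dx Dy).
Qed.

Lemma D_seg x y : D x -> D y -> `[x, y]%classic `<=` `[0, pi]%classic.
Proof.
move=> /andP[x0 _] /andP[_ yp] t /=; rewrite !in_itv /= => /andP[t1 t2].
by rewrite (ltW (lt_le_trans x0 t1)) (ltW (le_lt_trans t2 yp)).
Qed.

Lemma not_integrable_inv_sin h c x y : rint `[0, pi] h -> (forall t, 0 <= h t) -> 0 < c ->
  D x -> D y -> x <= y -> (forall t, x <= t <= y -> c / sin t <= h t) ->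
  c * (lntan y - lntan x) <= RI `[0, pi] h.
Proof.
move=> hi h0 c0 Dx Dy xy hh.
have si : rint `[x, y] (fun t => (sin t)^-1).
  by apply: rint_contf => t ht; apply: inv_sin_continuous; exact: (segment_closedD Dx Dy).
rewrite -(RI_inv_sin Dx Dy xy) -RIZ //.
apply: le_trans (_ : RI `[x, y] h <= _).
  apply: RI_le => //; [exact: rintZ|exact: (rintS _ _ (D_seg Dx Dy) hi)].
by apply: RI_mono => //; exact: D_seg.
Qed.

(** [1 / sin] has the primitive [lntan], which is unbounded at 0, so no integrable function
    dominates a multiple of it there. *)
Lemma not_bounded_below_left h c y : rint `[0, pi] h -> (forall t, 0 <= h t) -> 0 < c -> D y ->
  ~ (forall t, D t -> t <= y -> c / sin t <= h t).
Proof.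
move=> hi h0 c0 Dy hh.
have [x [Dx hx]] := lntan_small (lntan y - (RI `[0, pi] h + 1) / c).
have I0 : 0 <= RI `[0, pi] h by apply: RI_ge0 => *; exact: h0.
have q0 : 0 < (RI `[0, pi] h + 1) / c by rewrite divr_gt0 // ltr_wpDl.
have xy : x <= y.
  rewrite leNgt; apply/negP => /ltW yx; have := lntan_le Dy Dx yx; lra.
have h2 : c * (lntan y - lntan x) <= RI `[0, pi] h.
  apply: (not_integrable_inv_sin hi h0 c0 Dx Dy xy) => t ht.
  by apply: hh; [exact: (segment_closedD Dx Dy)|case/andP: ht].
have : (RI `[0, pi] h + 1) / c <= lntan y - lntan x by lra.
rewrite ler_pdivrMr // mulrC; lra.
Qed.

Lemma not_bounded_below_right h c x : rint `[0, pi] h -> (forall t, 0 <= h t) -> 0 < c -> D x ->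
  ~ (forall t, D t -> x <= t -> c / sin t <= h t).
Proof.
move=> hi h0 c0 Dx hh.
have [y [Dy hy]] := lntan_large (lntan x + (RI `[0, pi] h + 1) / c).
have I0 : 0 <= RI `[0, pi] h by apply: RI_ge0 => *; exact: h0.
have q0 : 0 < (RI `[0, pi] h + 1) / c by rewrite divr_gt0 // ltr_wpDl.
have xy : x <= y.
  rewrite leNgt; apply/negP => /ltW yx; have := lntan_le Dy Dx yx; lra.
have h2 : c * (lntan y - lntan x) <= RI `[0, pi] h.
  apply: (not_integrable_inv_sin hi h0 c0 Dx Dy xy) => t ht.
  by apply: hh; [exact: (segment_closedD Dx Dy)|case/andP: ht].
have : (RI `[0, pi] h + 1) / c <= lntan y - lntan x by lra.
rewrite ler_pdivrMr // mulrC; lra.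
Qed.

End AngularKernels.

(** * Variation of constants on the angular interval *)

Section AngularEstimates.
Variable R : realType.
Notation mu := (@lebesgue_measure R).
Notation D := (@angular_domain R).
Variables (w kap : R).
Hypothesis kap_ge : 1 / 2 <= kap.
Notation q := (qw w kap).
Notation P := (Pw w kap).
Notation C := (eW w).
Notation I0pi := (`[0, pi]%classic : set R).
Implicit Types (x y t th e : R) (f g h phi psi : R -> R).

Lemma subD : D `<=` I0pi.
Proof. by rewrite D_itv; exact: subset_itv_oo_cc. Qed.

Lemma D_pihalf : D (pi / 2).
Proof. by have h := pi_gt0 R; apply/andP; split; lra. Qed.

Lemma C_gt0 : 0 < C. Proof. exact: expR_gt0. Qed.

Lemma cos_ge0_le x : D x -> x <= pi / 2 -> 0 <= cos x /\ lntan x <= 0.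
Proof.
move=> Dx xp; have c0 : 0 <= cos x.
  case: (ltgtP x (pi / 2)) xp => // [h _|-> _]; last by rewrite cos_pihalf.
  by case/andP: Dx => x0 _; rewrite ltW // cos_gt0_pihalf // h andbT; have := pi_gt0 R; lra.
split=> //; have := lntan_le Dx D_pihalf xp.
by rewrite [X in _ <= X]/lntan cos_pihalf subr0 addr0 subrr mul0r.
Qed.

Lemma cos_le0_ge x : D x -> pi / 2 <= x -> cos x <= 0 /\ 0 <= lntan x.
Proof.
move=> Dx xp; have h : pi - x <= pi / 2 by lra.
by have := cos_ge0_le (D_reflect Dx) h; rewrite lntan_reflect cosB cospi sinpi mul0r addr0 mulN1r oppr_ge0 oppr_le0.
Qed.

(** If [|phi * P|] stayed above [e] near 0, then [Pw_sq] would put [phi ^+ 2] above e^2 / (C sin),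
    which is not integrable. *)
Lemma small_left phi y e : rint I0pi (fun t => phi t ^+ 2) -> D y -> 0 < e ->
  exists x, [/\ D x, x <= y & `|phi x * P x| < e].
Proof.
move=> phi2 Dy e0; apply: contrapT => hn.
pose y' := Num.min y (pi / 2); have y'p : y' <= pi / 2 by rewrite ge_min lexx orbT.
have Dy' : D y' by rewrite /y'; case: (leP y (pi / 2)) => _ //; exact: D_pihalf.
have c0 : 0 < e ^+ 2 / C by rewrite divr_gt0 ?exprn_gt0 // C_gt0.
apply: (not_bounded_below_left phi2 (fun t => sqr_ge0 _) c0 Dy') => t Dt ty.
have [ct lt0] := cos_ge0_le Dt (le_trans ty y'p).
have big : e <= `|phi t * P t|.
  rewrite leNgt; apply/negP => h; apply: hn; exists t; split=> //.
  by apply: le_trans ty _; rewrite ge_min lexx.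
have s0 := sin_gt0D Dt; have hP := Pw_sq w kap_ge Dt ct lt0.
have : e ^+ 2 <= phi t ^+ 2 * P t ^+ 2.
  by rewrite -exprMn -[X in _ <= X]ger0_norm ?sqr_ge0 // normrX lerXn2r ?nnegrE // ltW.
move=> h; rewrite ler_pdivrMr // ler_pdivrMr ?C_gt0 //.
apply: le_trans h _; rewrite -mulrA; apply: ler_wpM2l; first exact: sqr_ge0.
by rewrite mulrC.
Qed.

Lemma small_right phi y e : rint I0pi (fun t => phi t ^+ 2) -> D y -> 0 < e ->
  exists x, [/\ D x, y <= x & `|phi x * (P x)^-1| < e].
Proof.
move=> phi2 Dy e0; apply: contrapT => hn.
pose y' := Num.max y (pi / 2).
have Dy' : D y' by rewrite /y'; case: (leP y (pi / 2)) => _ //; exact: D_pihalf.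
have c0 : 0 < e ^+ 2 / C by rewrite divr_gt0 ?exprn_gt0 // C_gt0.
apply: (not_bounded_below_right phi2 (fun t => sqr_ge0 _) c0 Dy') => t Dt.
rewrite ge_max => /andP[yt pt].
have [ct lt0] := cos_le0_ge Dt pt.
have big : e <= `|phi t * (P t)^-1|.
  by rewrite leNgt; apply/negP => h; apply: hn; exists t.
have s0 := sin_gt0D Dt; have hP := Pw_sqV w kap_ge Dt ct lt0.
have : e ^+ 2 <= phi t ^+ 2 * (P t)^-1 ^+ 2.
  by rewrite -exprMn -[X in _ <= X]ger0_norm ?sqr_ge0 // normrX lerXn2r ?nnegrE // ltW.
move=> h; rewrite ler_pdivrMr // ler_pdivrMr ?C_gt0 //.
apply: le_trans h _; rewrite -mulrA; apply: ler_wpM2l; first exact: sqr_ge0.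
by rewrite mulrC.
Qed.

Lemma seg0 y : D y -> `[0, y]%classic `<=` I0pi.
Proof. by move=> /andP[_ yp] t /=; rewrite !in_itv /= => /andP[-> t2]; rewrite (le_trans t2) // ltW. Qed.

Lemma segpi y : D y -> `[y, pi]%classic `<=` I0pi.
Proof. by move=> /andP[y0 _] t /=; rewrite !in_itv /= => /andP[t2 ->]; rewrite andbT (le_trans _ t2) // ltW. Qed.

(** The derivative of [phi * P] is [psi * P]. Integrating from points near 0 where [phi * P] is
    arbitrarily small removes the boundary term, and [P t <= C * P th] bounds the kernel. *)
Lemma kernel_left phi psi : (forall x, D x -> hasder phi x (- q x * phi x + psi x)) ->
  rint I0pi (fun t => phi t ^+ 2) -> rint I0pi psi -> (forall x, D x -> {for x, continuous psi}) ->
  forall th, D th -> `|phi th| <= C * RI `[0, th] (fun t => `|psi t|).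
Proof.
move=> hphi phi2 psii cpsi th Dth.
have P0 := Pw_gt0 w kap th; have C0 := C_gt0.
have nn : rint I0pi (fun t => `|psi t|) by exact: rint_norm.
rewrite -(ler_pM2r P0); apply/ler_addgt0Pl => e e0.
have [x [Dx xt hx]] := small_left phi2 Dth e0.
have hin t : x <= t <= th -> D t by exact: (segment_closedD Dx Dth).
have cP t : D t -> {for t, continuous P} by move=> Dt; exact: hasder_continuous (Pw_hasder w kap Dt).
have ftc : RI `[x, th] (fun t => psi t * P t) = phi th * P th - phi x * P x.
  apply: (@RI_FTC R (fun t => psi t * P t) (fun t => phi t * P t)) => // t ht; last first.
    by apply: cvgM; [apply: cpsi|apply: cP]; exact: hin.
  by apply: hasder_eq (hasderM (hphi t (hin t ht)) (Pw_hasder w kap (hin t ht))) _; ring.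
have nx : rint `[x, th] (fun t => `|psi t|) by exact: (rintS _ _ (D_seg Dx Dth) nn).
have b : `|RI `[x, th] (fun t => psi t * P t)| <= C * P th * RI `[x, th] (fun t => `|psi t|).
  rewrite -RIZ //; apply: RI_norm_le => //.
  - by apply: rint_contf => t ht; apply: cvgM; [apply: cpsi|apply: cP]; exact: hin.
  - exact: rintZ.
  - move=> t /=; rewrite in_itv /= => ht; rewrite normrM mulrC; apply: ler_wpM2r => //.
    rewrite ger0_norm ?(ltW (Pw_gt0 _ _ _)) //; apply: Pw_le => //; first exact: hin.
    by case/andP: ht.
have m : RI `[x, th] (fun t => `|psi t|) <= RI `[0, th] (fun t => `|psi t|).
  apply: RI_mono => //; last exact: (rintS _ _ (seg0 Dth) nn).
  by move=> t /=; rewrite !in_itv /= => /andP[t1 ->]; case/andP: Dx => x0 _; rewrite (le_trans (ltW x0)).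
have := ler_wpM2l (ltW (mulr_gt0 C0 P0)) m => m2.
have -> : `|phi th| * P th = `|phi th * P th| by rewrite normrM (gtr0_norm P0).
have -> : phi th * P th = phi x * P x + RI `[x, th] (fun t => psi t * P t) by rewrite ftc addrC subrK.
apply: le_trans (ler_normD _ _) _.
have -> : C * RI `[0, th] (fun t => `|psi t|) * P th = C * P th * RI `[0, th] (fun t => `|psi t|) by ring.
by apply: lerD; [exact: ltW|exact: le_trans b m2].
Qed.

Lemma PwV_hasder x : D x -> hasder (fun x => (P x)^-1) x (- (q x) * (P x)^-1).
Proof.
move=> Dx; apply: hasder_eq (hasderV (Pw_hasder w kap Dx) (lt0r_neq0 (Pw_gt0 _ _ _))) _.
by field; rewrite gt_eqF // Pw_gt0.
Qed.

(** The mirror argument, with the integrating factor [1 / P] and boundary terms vanishing at pi. *)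
Lemma kernel_right phi psi : (forall x, D x -> hasder phi x (q x * phi x + psi x)) ->
  rint I0pi (fun t => phi t ^+ 2) -> rint I0pi psi -> (forall x, D x -> {for x, continuous psi}) ->
  forall th, D th -> `|phi th| <= C * RI `[th, pi] (fun t => `|psi t|).
Proof.
move=> hphi phi2 psii cpsi th Dth.
have P0 : 0 < (P th)^-1 by rewrite invr_gt0 Pw_gt0.
have C0 := C_gt0.
have nn : rint I0pi (fun t => `|psi t|) by exact: rint_norm.
rewrite -(ler_pM2r P0); apply/ler_addgt0Pl => e e0.
have [x [Dx xt hx]] := small_right phi2 Dth e0.
have hin t : th <= t <= x -> D t by exact: (segment_closedD Dth Dx).
have cP t : D t -> {for t, continuous (fun x => (P x)^-1)} by move=> Dt; exact: hasder_continuous (PwV_hasder Dt).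
have ftc : RI `[th, x] (fun t => psi t * (P t)^-1) = phi x * (P x)^-1 - phi th * (P th)^-1.
  apply: (@RI_FTC R (fun t => psi t * (P t)^-1) (fun t => phi t * (P t)^-1)) => // t ht; last first.
    by apply: cvgM; [apply: cpsi|apply: cP]; exact: hin.
  by apply: hasder_eq (hasderM (hphi t (hin t ht)) (PwV_hasder (hin t ht))) _; ring.
have nx : rint `[th, x] (fun t => `|psi t|) by exact: (rintS _ _ (D_seg Dth Dx) nn).
have b : `|RI `[th, x] (fun t => psi t * (P t)^-1)| <= C * (P th)^-1 * RI `[th, x] (fun t => `|psi t|).
  rewrite -RIZ //; apply: RI_norm_le => //.
  - by apply: rint_contf => t ht; apply: cvgM; [apply: cpsi|apply: cP]; exact: hin.
  - exact: rintZ.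
  - move=> t /=; rewrite in_itv /= => ht; rewrite normrM mulrC; apply: ler_wpM2r => //.
    have Pt := Pw_gt0 w kap t; rewrite ger0_norm ?invr_ge0 ?(ltW Pt) //.
    have Pth := Pw_gt0 w kap th.
    rewrite (ler_pdivlMr _ _ Pth) mulrC (ler_pdivrMr _ _ Pt); apply: Pw_le => //; first exact: hin.
    by case/andP: ht.
have m : RI `[th, x] (fun t => `|psi t|) <= RI `[th, pi] (fun t => `|psi t|).
  apply: RI_mono => //; last exact: (rintS _ _ (segpi Dth) nn).
  by move=> t /=; rewrite !in_itv /= => /andP[-> t1]; case/andP: Dx => _ xp; rewrite (le_trans t1) // ltW.
have := ler_wpM2l (ltW (mulr_gt0 C0 P0)) m => m2.
have -> : `|phi th| * (P th)^-1 = `|phi th * (P th)^-1| by rewrite normrM (gtr0_norm P0).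
have -> : phi th * (P th)^-1 = phi x * (P x)^-1 - RI `[th, x] (fun t => psi t * (P t)^-1) by rewrite ftc opprB addrC subrK.
apply: le_trans (ler_normB _ _) _.
have -> : C * RI `[th, pi] (fun t => `|psi t|) * (P th)^-1 = C * (P th)^-1 * RI `[th, pi] (fun t => `|psi t|) by ring.
by apply: lerD; [exact: ltW|exact: le_trans b m2].
Qed.

End AngularEstimates.

(** * Bounds and orthogonality of angular eigenfunctions *)

Section AngularSolutions.
Variable R : realType.
Notation mu := (@lebesgue_measure R).
Notation D := (@angular_domain R).
Notation I0pi := (`[0, pi]%classic : set R).
Implicit Types (w kap am l x y e : R) (f g : R -> R).

(** The system for the spinor times the square root of sin x, which removes both the weight and the
    [cot / 2] terms. The equations hold on the open interval; global measurability lets the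
    integrals run over the closed one. *)
Definition asol w kap am l f1 f2 : Prop :=
  [/\ forall x, D x -> hasder f1 x (qw w kap x * f1 x + (am * cos x - l) * f2 x),
     forall x, D x -> hasder f2 x (- qw w kap x * f2 x + (am * cos x + l) * f1 x),
     rint I0pi (fun x => f1 x ^+ 2) /\ rint I0pi (fun x => f2 x ^+ 2),
     measurable_fun [set: R] f1 /\ measurable_fun [set: R] f2 &
     exists x, D x /\ (f1 x != 0 \/ f2 x != 0)].

(** Reduces [kap <= -1/2] to [1/2 <= kap]. *)
Lemma asol_swap w kap am l f1 f2 : asol w kap am l f1 f2 -> asol (- w) (- kap) am (- l) f2 f1.
Proof.
have q x : qw (- w) (- kap) x = - qw w kap x by rewrite /qw !mulNr opprD.
case=> h1 h2 [i1 i2] [m1 m2] [x [Dx nz]]; split=> //.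
- by move=> y Dy; rewrite q opprK; exact: h2.
- by move=> y Dy; rewrite q opprK; exact: h1.
- by exists x; split=> //; case: nz; [right|left].
Qed.

Lemma zsol_asol m a omega kap l Z1 Z2 : zsol m a omega kap l Z1 Z2 ->
  exists f1 f2, asol (a * omega) kap (a * m) l f1 f2.
Proof.
case=> h1 h2 [i1 i2] [x [Dx nz]].
have mD := @measurable_angD R.
pose k Z := (fun x : R => Z x / Num.sqrt (sin x)) \_ D.
have kE (Z : R -> R) y : D y -> k Z y = Z y / Num.sqrt (sin y) by move=> Dy; rewrite /k patchE mem_set.
have sq0 y : D y -> 0 < Num.sqrt (sin y) by move=> Dy; rewrite sqrtr_gt0 sin_gt0D.
have sqd y : D y -> hasder (fun y : R => Num.sqrt (sin y)) y (cos y / (2 * Num.sqrt (sin y))).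
  move=> Dy; have hs : hasder (@sin R) y (cos y) := is_derive_sin y.
  apply: hasder_eq (@hasder_comp _ (@Num.sqrt R) (@sin R) y _ _ (is_derive1_sqrt (sin_gt0D Dy)) hs) _.
  exact: mulrC.
have hk (Z : R -> R) y d : D y -> hasder Z y d -> hasder (k Z) y (d / Num.sqrt (sin y) - cot y / 2 * k Z y).
  move=> Dy hZ; apply: (@hasder_near _ (fun y => Z y / Num.sqrt (sin y))).
    have := open_nbhs_nbhs (conj (@open_angD R) Dy); apply: filterS => t Dt; by rewrite kE.
  apply: hasder_eq (hasderM hZ (hasderV (sqd y Dy) (lt0r_neq0 (sq0 y Dy)))) _.
  rewrite kE // /cot; have s2 : Num.sqrt (sin y) ^+ 2 = sin y by rewrite sqr_sqrtr // ltW // sin_gt0D.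
  by move: (Num.sqrt _) s2 (lt0r_neq0 (sq0 y Dy)) => s <- s0; field.
have ki (Z : R -> R) : (forall x, D x -> {for x, continuous Z}) -> rint D (fun x => Z x ^+ 2 / sin x) ->
    rint I0pi (fun x => k Z x ^+ 2) /\ measurable_fun [set: R] (k Z).
  move=> cZ iZ; split.
    have -> : (fun x => k Z x ^+ 2) = (fun x => Z x ^+ 2 / sin x) \_ D.
      apply/funext => y; rewrite /k !patchE; case: ifPn => [/set_mem Dy|_]; last by rewrite expr0n.
      by rewrite expr_div_n sqr_sqrtr // ltW // sin_gt0D.
    exact: (rintS _ _ (@subsetT _ _) (rint_patch mD iZ)).
  apply/(measurable_restrictT _ mD); apply: continuous_onD_measurable => y Dy.
  apply: cvgM; first exact: cZ.
  exact: hasder_continuous (hasderV (sqd y Dy) (lt0r_neq0 (sq0 y Dy))).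
have c1 y : D y -> {for y, continuous Z1} by move=> Dy; exact: hasder_continuous (h1 y Dy).
have c2 y : D y -> {for y, continuous Z2} by move=> Dy; exact: hasder_continuous (h2 y Dy).
have [k1 m1] := ki Z1 c1 i1; have [k2 m2] := ki Z2 c2 i2.
exists (k Z1), (k Z2); split=> //.
- move=> y Dy; apply: hasder_eq (hk Z1 y _ Dy (h1 y Dy)) _.
  by rewrite !kE // /cA /cC /qang /qw; move: (Num.sqrt _) (sin y)^-1 => s t; ring.
- move=> y Dy; apply: hasder_eq (hk Z2 y _ Dy (h2 y Dy)) _.
  by rewrite !kE // /cB /cE /qang /qw; move: (Num.sqrt _) (sin y)^-1 => s t; ring.
- exists x; split=> //; rewrite !kE //.
  by case: nz => nz; [left|right]; rewrite mulf_neq0 // invr_neq0 // gt_eqF // sq0.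
Qed.

Section Bounds.
Variables (w kap am : R).
Hypothesis kap_ge : 1 / 2 <= kap.
Notation C := (eW w).

Lemma asol_rint l f1 f2 : asol w kap am l f1 f2 -> rint I0pi f1 /\ rint I0pi f2.
Proof.
case=> _ _ [i1 i2] [m1 m2] _.
by split; apply: rint_L1loc => //; try exact: itv_fin; exact: measurable_funS m1 || exact: measurable_funS m2.
Qed.

Lemma coef_rint (k : R) f : rint I0pi f -> rint I0pi (fun x => (am * cos x + k) * f x).
Proof.
apply: rint_contM => x _; apply: cvgD; last exact: cvg_cst.
by apply: cvgM; [exact: cvg_cst|exact: continuous_cos].
Qed.

Lemma coef_cont (k : R) f x : {for x, continuous f} -> {for x, continuous (fun x => (am * cos x + k) * f x)}.
Proof.
move=> cf; apply: cvgM; last exact: cf.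
apply: cvgD; last exact: cvg_cst.
by apply: cvgM; [exact: cvg_cst|exact: continuous_cos].
Qed.

Lemma asol_cont l f1 f2 : asol w kap am l f1 f2 -> (forall x, D x -> {for x, continuous f1}) /\
  (forall x, D x -> {for x, continuous f2}).
Proof.
by case=> h1 h2 _ _ _; split=> x Dx; [exact: hasder_continuous (h1 x Dx)|exact: hasder_continuous (h2 x Dx)].
Qed.

(** Each component is controlled from the endpoint at which it tends to 0: [f2] from 0, [f1] from
    pi. *)
Lemma asol_est l f1 f2 : asol w kap am l f1 f2 ->
  (forall x, D x -> `|f2 x| <= C * RI `[0, x] (fun t => `|(am * cos t + l) * f1 t|)) /\
  (forall x, D x -> `|f1 x| <= C * RI `[x, pi] (fun t => `|(am * cos t - l) * f2 t|)).
Proof.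
move=> sol; have [r1 r2] := asol_rint sol; have [c1 c2] := asol_cont sol.
case: sol => h1 h2 [i1 i2] _ _; split.
  apply: (@kernel_left R w kap kap_ge f2 (fun t => (am * cos t + l) * f1 t)) => //.
    exact: coef_rint.
  by move=> x Dx; apply: coef_cont; exact: c1.
apply: (@kernel_right R w kap kap_ge f1 (fun t => (am * cos t - l) * f2 t)) => //.
  exact: coef_rint.
by move=> x Dx; apply: coef_cont; exact: c2.
Qed.

Lemma asol_bounded l f1 f2 : asol w kap am l f1 f2 -> exists2 B, 0 <= B &
  forall x, D x -> `|f1 x| <= B /\ `|f2 x| <= B.
Proof.
move=> sol; have [r1 r2] := asol_rint sol; have [b2 b1] := asol_est sol.
have C0 := C_gt0 w.
pose B1 := C * RI I0pi (fun t => `|(am * cos t - l) * f2 t|).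
pose B2 := C * RI I0pi (fun t => `|(am * cos t + l) * f1 t|).
have B10 : 0 <= B1 by rewrite mulr_ge0 ?(ltW C0) // RI_ge0.
have B20 : 0 <= B2 by rewrite mulr_ge0 ?(ltW C0) // RI_ge0.
exists (B1 + B2); first exact: addr_ge0.
move=> x Dx; split.
  apply: le_trans (b1 x Dx) _; apply: (@le_trans _ _ B1); last by rewrite lerDl.
  rewrite /B1 ler_pM2l //; apply: RI_mono => //; first exact: segpi.
  by apply: rint_norm => //; exact: coef_rint.
apply: le_trans (b2 x Dx) _; apply: (@le_trans _ _ B2); last by rewrite lerDr.
rewrite /B2 ler_pM2l //; apply: RI_mono => //; first exact: seg0.
by apply: rint_norm => //; exact: coef_rint.
Qed.

Lemma pi_near e : 0 < e -> exists x y, [/\ D x, D y, x <= y, x < e & pi - y < e].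
Proof.
move=> e0; pose d := Num.min e (pi / 2); have p0 := pi_gt0 R.
have d0 : 0 < d by rewrite lt_min e0; lra.
have de : d <= e by rewrite ge_min lexx.
have dp : d <= pi / 2 by rewrite ge_min lexx orbT.
exists (d / 2), (pi - d / 2); split; try lra; apply/andP; split; lra.
Qed.

(** The Wronskian f1 g2 - f2 g1 has derivative (l' - l) (f1 g1 + f2 g2). It vanishes at 0 because
    [f2] and [g2] do while [f1] and [g1] stay bounded, and at pi with the roles exchanged. *)
Lemma asol_ortho l l' f1 f2 g1 g2 : asol w kap am l f1 f2 -> asol w kap am l' g1 g2 -> l != l' ->
  rint I0pi (fun x => f1 x * g1 x + f2 x * g2 x) /\
  RI I0pi (fun x => f1 x * g1 x + f2 x * g2 x) = 0.
Proof.
move=> sf sg ll; have C0 := C_gt0 w.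
have [rf1 rf2] := asol_rint sf; have [rg1 rg2] := asol_rint sg.
have [bf2 bf1] := asol_est sf; have [bg2 bg1] := asol_est sg.
have [cf1 cf2] := asol_cont sf; have [cg1 cg2] := asol_cont sg.
have [Bf Bf0 hBf] := asol_bounded sf; have [Bg Bg0 hBg] := asol_bounded sg.
pose v x := f1 x * g1 x + f2 x * g2 x.
have vi : rint I0pi v.
  case: sf sg => _ _ [i1 i2] [m1 m2] _ [_ _ [j1 j2] [n1 n2] _].
  have ms f : measurable_fun [set: R] f -> measurable_fun I0pi f by exact: measurable_funS.
  by apply: rintD => //; apply: rint_mul => //; exact: ms.
split=> //; change (RI I0pi v = 0).
suff main e : 0 < e -> `|l' - l| * `|RI I0pi v| <= (2 * `|l' - l| + 4 * C * (Bf + Bg)) * e.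
  have l0 : 0 < `|l' - l| by rewrite normr_gt0 subr_eq0 eq_sym.
  have K0 : 0 < 2 * `|l' - l| + 4 * C * (Bf + Bg).
    by rewrite ltr_pwDl ?mulr_gt0 // mulr_ge0 ?addr_ge0 // mulr_ge0 // ltW.
  apply/eqP; rewrite -normr_le0 -(pmulr_rle0 _ l0); apply/ler_addgt0Pr => e e0; rewrite add0r.
  apply: le_trans (main (e / (2 * `|l' - l| + 4 * C * (Bf + Bg))) _) _; first exact: divr_gt0.
  by rewrite mulrCA divff ?mulr1 // gt_eqF.
move=> e0.
have [d1 d10 u1] := RI_unif (coef_rint l rf1) e0.
have [d2 d20 u2] := RI_unif (coef_rint l' rg1) e0.
have [d3 d30 u3] := RI_unif (coef_rint (- l) rf2) e0.
have [d4 d40 u4] := RI_unif (coef_rint (- l') rg2) e0.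
have [d5 d50 u5] := RI_unif vi e0.
(* The first four moduli make the decaying components small at the cut points; the fifth makes the
   two discarded end pieces small. *)
pose d := Num.min (Num.min (Num.min d1 d2) (Num.min d3 d4)) d5.
have d0 : 0 < d by rewrite !lt_min d10 d20 d30 d40 d50.
have [x [y [Dx Dy xy xd yd]]] := pi_near d0.
move: xd yd; rewrite !lt_min => /andP[/andP[/andP[xd1 xd2] /andP[xd3 xd4]] xd5] /andP[/andP[/andP[yd1 yd2] /andP[yd3 yd4]] yd5].
have [x0 xp] : 0 <= x /\ x <= pi by case/andP: Dx => ? ?; rewrite !ltW.
have [y0 yp] : 0 <= y /\ y <= pi by case/andP: Dy => ? ?; rewrite !ltW.
have z0 t : t - 0 = t :> R by rewrite subr0.
have Ff2 : `|f2 x| <= C * e.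
  by apply: le_trans (bf2 x Dx) _; rewrite ler_pM2l //; apply/ltW/u1 => //; rewrite z0.
have Fg2 : `|g2 x| <= C * e.
  by apply: le_trans (bg2 x Dx) _; rewrite ler_pM2l //; apply/ltW/u2 => //; rewrite z0.
have Ff1 : `|f1 y| <= C * e by apply: le_trans (bf1 y Dy) _; rewrite ler_pM2l //; apply/ltW/u3.
have Fg1 : `|g1 y| <= C * e by apply: le_trans (bg1 y Dy) _; rewrite ler_pM2l //; apply/ltW/u4.
pose W t := f1 t * g2 t - f2 t * g1 t.
have hin t : x <= t <= y -> D t by exact: (segment_closedD Dx Dy).
have ftc : RI `[x, y] (fun t => (l' - l) * v t) = W y - W x.
  apply: (@RI_FTC R (fun t => (l' - l) * v t) W) => // t /hin Dt.
    case: sf sg => h1 h2 _ _ _ [k1 k2 _ _ _].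
    apply: hasder_eq (hasderD (hasderM (h1 t Dt) (k2 t Dt)) (hasderN (hasderM (h2 t Dt) (k1 t Dt)))) _.
    by rewrite /v; ring.
  apply: cvgM; first exact: cvg_cst.
  by apply: cvgD; apply: cvgM; [exact: cf1|exact: cg1|exact: cf2|exact: cg2].
have vxy : rint `[x, y] v by exact: (rintS _ _ (D_seg Dx Dy) vi).
have vyp : rint `[y, pi] v by exact: (rintS _ _ (segpi Dy) vi).
have v0x : rint `[0, x] v by exact: (rintS _ _ (seg0 Dx) vi).
have v0y : rint `[0, y] v by exact: (rintS _ _ (seg0 Dy) vi).
rewrite RIZ // in ftc.
have E : RI I0pi v = RI `[0, x] v + RI `[x, y] v + RI `[y, pi] v.
  by rewrite (RI_itv_split y0 yp vi) (RI_itv_split x0 xy v0y).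
have s1 : `|RI `[0, x] v| <= e.
  by apply: le_trans (RI_norm _ v0x) _ => //; apply/ltW/u5 => //; rewrite z0.
have s2 : `|RI `[y, pi] v| <= e by apply: le_trans (RI_norm _ vyp) _ => //; apply/ltW/u5.
have pr (s t k1 k2 : R) : `|s| <= k1 -> `|t| <= k2 -> `|s * t| <= k1 * k2.
  by move=> h1 h2; rewrite normrM; apply: ler_pM.
have [xf1 xf2] := hBf x Dx; have [xg1 xg2] := hBg x Dx.
have [yf1 yf2] := hBf y Dy; have [yg1 yg2] := hBg y Dy.
have Wx : `|W x| <= Bf * (C * e) + C * e * Bg.
  by apply: le_trans (ler_normB _ _) _; apply: lerD; exact: pr.
have Wy : `|W y| <= C * e * Bg + Bf * (C * e).
  by apply: le_trans (ler_normB _ _) _; apply: lerD; exact: pr.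
have s3 : `|(l' - l) * RI `[x, y] v| <= 2 * (C * (Bf + Bg)) * e.
  rewrite ftc; apply: le_trans (ler_normB _ _) _; lra.
rewrite -normrM E !mulrDr; apply: le_trans (ler_normD _ _) _; apply: le_trans (lerD (ler_normD _ _) (lexx _)) _.
rewrite !normrM in s3 *.
have l0 : 0 <= `|l' - l| by [].
have := ler_wpM2l l0 s1; have := ler_wpM2l l0 s2.
have : 0 <= C * (Bf + Bg) * e by rewrite mulr_ge0 ?(ltW e0) // mulr_ge0 ?(ltW C0) // addr_ge0.
lra.
Qed.

End Bounds.
End AngularSolutions.

(** * Counting angular eigenvalues by Bessel's inequality *)

Section AngularCounting.
Variable R : realType.
Notation mu := (@lebesgue_measure R).
Notation D := (@angular_domain R).
Notation I0pi := (`[0, pi]%classic : set R).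

Definition asol_norm (f1 f2 : R -> R) : R := RI I0pi (fun x => f1 x ^+ 2 + f2 x ^+ 2).

Section OneSided.
Variables (w kap am : R).
Hypothesis kap_ge : 1 / 2 <= kap.
Notation C := (eW w).

Lemma asol_norm_gt0 l f1 f2 : asol w kap am l f1 f2 -> 0 < asol_norm f1 f2.
Proof.
move=> sol; have [c1 c2] := asol_cont sol; case: sol => _ _ [i1 i2] _ [x [Dx nz]].
pose v y := f1 y ^+ 2 + f2 y ^+ 2.
have v0 : 0 < v x by case: nz => nz; rewrite /v; [rewrite ltr_pwDl|rewrite ltr_wpDl]; rewrite ?sqr_ge0 // exprn_even_gt0.
have cv : {for x, continuous v} by apply: cvgD; rewrite /= expr2; apply: cvgM; [exact: c1|exact: c1|exact: c2|exact: c2].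
have vi : rint I0pi v by exact: rintD.
have nb : \forall y \near x, v x / 2 <= v y /\ D y.
  near=> y; split; last by near: y; exact: open_nbhs_nbhs (conj (@open_angD R) Dx).
  have : `|v x - v y| < v x / 2 by near: y; apply: (cvgr_dist_lt _ (v x) cv); rewrite divr_gt0.
  by rewrite ltr_norml => /andP[_ h]; lra.
have /nbhs_ballP[d /= d0 hd] := nb.
have d2 : 0 < d / 2 by rewrite divr_gt0.
have hs t : x <= t <= x + d / 2 -> v x / 2 <= v t /\ D t.
  by move=> /andP[t1 t2]; apply: hd; rewrite /ball /= distrC ger0_norm ?subr_ge0 //; lra.
have sub : `[x, x + d / 2]%classic `<=` I0pi by move=> t /=; rewrite in_itv /= => /hs[_ /(@subD R)].
apply: lt_le_trans (RI_mono (measurable_itv _) (measurable_itv _) sub vi _); last first.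
  by move=> t _; rewrite addr_ge0 ?sqr_ge0.
apply: (@lt_le_trans _ _ (RI `[x, x + d / 2] (fun=> v x / 2))).
  by rewrite RI_cst ?lerDl ?ltW // mulr_gt0 ?divr_gt0 //; lra.
apply: RI_le => //; first by apply: rint_cst => //; exact: itv_fin.
  exact: rintS vi.
by move=> t /=; rewrite in_itv /= => /hs[].
Unshelve. all: end_near. Qed.

Variables (Lam : R) (N : nat) (l : 'I_N -> R) (f1 f2 : 'I_N -> R -> R).
Hypothesis l_inj : injective l.
Hypothesis l_le : forall i, `|l i| <= Lam.
Hypothesis sol : forall i, asol w kap am (l i) (f1 i) (f2 i).
Notation n i := (asol_norm (f1 i) (f2 i)).

Let comb (d : 'I_N -> R) (f : 'I_N -> R -> R) x := \sum_i d i * f i x.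

Lemma comb_rint (d : 'I_N -> R) :
  (rint I0pi (comb d f1) /\ rint I0pi (comb d f2)) /\
  (rint I0pi (fun x => comb d f1 x ^+ 2) /\ rint I0pi (fun x => comb d f2 x ^+ 2)).
Proof.
have e (f : 'I_N -> R -> R) : (fun x => comb d f x ^+ 2) = (fun x => \sum_i \sum_j (d i * d j) * (f i x * f j x)).
  apply/funext => x; rewrite /comb expr2 mulr_suml; apply: eq_bigr => i _.
  by rewrite mulr_sumr; apply: eq_bigr => j _; ring.
have ms f : measurable_fun [set: R] f -> measurable_fun I0pi f by exact: measurable_funS.
split; split.
- by apply: rint_sum => // i; apply: rintZ => //; have [] := asol_rint (sol i).
- by apply: rint_sum => // i; apply: rintZ => //; have [] := asol_rint (sol i).
- rewrite e; apply: rint_sum => // i; apply: rint_sum => // j; apply: rintZ => //.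
  by have [_ _ [? ?] [? ?] _] := sol i; have [_ _ [? ?] [? ?] _] := sol j; apply: rint_mul => //; exact: ms.
- rewrite e; apply: rint_sum => // i; apply: rint_sum => // j; apply: rintZ => //.
  by have [_ _ [? ?] [? ?] _] := sol i; have [_ _ [? ?] [? ?] _] := sol j; apply: rint_mul => //; exact: ms.
Qed.

Lemma parseval (d : 'I_N -> R) :
  RI I0pi (fun x => comb d f1 x ^+ 2 + comb d f2 x ^+ 2) = \sum_i d i ^+ 2 * n i.
Proof.
pose v i j x := f1 i x * f1 j x + f2 i x * f2 j x.
have vi i j : rint I0pi (v i j).
  have ms f : measurable_fun [set: R] f -> measurable_fun I0pi f by exact: measurable_funS.
  have [_ _ [? ?] [? ?] _] := sol i; have [_ _ [? ?] [? ?] _] := sol j.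
  by apply: rintD => //; apply: rint_mul => //; exact: ms.
rewrite (@RI_ext _ _ _ (fun x => \sum_i \sum_j (d i * d j) * v i j x)); last first.
  move=> x _; rewrite /comb !expr2 !mulr_suml -big_split; apply: eq_bigr => i _ /=.
  by rewrite !mulr_sumr -big_split; apply: eq_bigr => j _ /=; rewrite /v; ring.
rewrite RI_sum //; last by move=> i; apply: rint_sum => // j; exact: rintZ.
apply: eq_bigr => i _; rewrite RI_sum //; last by move=> j; exact: rintZ.
rewrite (bigD1 i) //= big1 ?addr0 => [|j ji].
  by rewrite RIZ // /asol_norm -expr2; congr (_ * _); apply: RI_ext => x _; rewrite /v -!expr2.
have ll : l i != l j by apply: contra ji => /eqP/l_inj ->.
by rewrite RIZ //; have [_ ->] := asol_ortho kap_ge (sol i) (sol j) ll; rewrite mulr0.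
Qed.

(** The weight in Young's inequality, large enough for the quadratic terms to be absorbed by half of
    the unknown sum. *)
Let t := C * (`|am| + Lam ^+ 2) + 1.
Let K := C * (`|am| + 1) * t * pi.

Lemma t_gt0 : 0 < t.
Proof. by rewrite /t ltr_wpDl // mulr_ge0 ?addr_ge0 ?sqr_ge0 // ltW // C_gt0. Qed.

(** By |y| <= (t + y^2 / t) / 2 the integral on the right becomes a constant plus a multiple of [S],
    and the choice of [t] yields S <= K / 2 + S / 2. *)
Lemma comb_bound (S : R) (G H : R -> R) : rint I0pi G -> rint I0pi H ->
  rint I0pi (fun x => G x ^+ 2) -> rint I0pi (fun x => H x ^+ 2) ->
  RI I0pi (fun x => G x ^+ 2) <= S -> RI I0pi (fun x => H x ^+ 2) <= Lam ^+ 2 * S ->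
  S <= C * RI I0pi (fun x => `|am * cos x * G x + H x|) -> S <= K.
Proof.
move=> Gi Hi G2 H2 GS HS h; have C0 := C_gt0 w; have t0 := t_gt0; have p0 := pi_gt0 R.
have a0 : 0 <= `|am| by [].
have am_rint : rint I0pi (fun x => am * cos x * G x + H x).
  apply: rintD => //; have := coef_rint am 0 Gi.
  by congr (rint _ _); apply/funext => x; rewrite addr0.
have young (y : R) : `|y| <= (t + t^-1 * y ^+ 2) / 2.
  have : t * t^-1 = 1 by rewrite divff // gt_eqF.
  move=> tt; have ti : 0 < t^-1 by rewrite invr_gt0.
  rewrite -(real_normK (num_real y)); have : 0 <= t^-1 * (`|y| - t) ^+ 2 by rewrite mulr_ge0 ?sqr_ge0 // ltW.
  have -> : t^-1 * (`|y| - t) ^+ 2 = t^-1 * `|y| ^+ 2 + (t * t^-1) * t - 2 * (t * t^-1) * `|y| by ring.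
  rewrite tt; lra.
have B : RI I0pi (fun x => `|am * cos x * G x + H x|) <=
    RI I0pi (fun x => (`|am| + 1) * t / 2 + t^-1 / 2 * (`|am| * G x ^+ 2 + H x ^+ 2)).
  apply: RI_le => //; first exact: rint_norm.
    apply: rintD => //; first by apply: rint_cst => //; exact: itv_fin.
    by apply: rintZ => //; apply: rintD => //; exact: rintZ.
  move=> x _; apply: le_trans (ler_normD _ _) _.
  have c1 : `|am * cos x * G x| <= `|am| * `|G x|.
    by rewrite !normrM; apply: ler_wpM2r => //; rewrite ler_piMr // cos_max.
  have := ler_wpM2l a0 (young (G x)); have := young (H x); lra.
move: B; rewrite RID //; last 2 first.
  - by apply: rint_cst => //; exact: itv_fin.
  - by apply: rintZ => //; apply: rintD => //; exact: rintZ.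
rewrite (RI_cst _ (ltW p0)) subr0 RIZ //; last by apply: rintD => //; exact: rintZ.
rewrite RID //; last exact: rintZ.
rewrite RIZ // => B.
have ti : 0 < t^-1 by rewrite invr_gt0.
have S0 : 0 <= S by apply: le_trans GS; apply: RI_ge0 => x _; exact: sqr_ge0.
have B2 : t^-1 / 2 * (`|am| * RI I0pi (fun x => G x ^+ 2) + RI I0pi (fun x => H x ^+ 2)) <= t^-1 / 2 * ((`|am| + Lam ^+ 2) * S).
  apply: ler_wpM2l; first by rewrite ltW ?divr_gt0.
  by have := ler_wpM2l a0 GS; lra.
have B3 : C * (t^-1 / 2 * ((`|am| + Lam ^+ 2) * S)) <= S / 2.
  have : t^-1 * (C * (`|am| + Lam ^+ 2)) <= 1 by rewrite ler_pdivrMl // mulr1 /t lerDl.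
  by move/(ler_wpM2l S0); lra.
have := ler_wpM2l (ltW C0) (le_trans B (lerD (lexx _) B2)); rewrite /K; lra.
Qed.

(** The reproducing-kernel choice of coefficients: the value of the combination at [x] coincides
    with the sum that [parseval] identifies as its squared norm. *)
Lemma norm_sum (d : 'I_N -> R) x (f : 'I_N -> R -> R) : (forall i, d i = f i x / n i) ->
  comb d f x = \sum_i f i x ^+ 2 / n i /\ \sum_i d i ^+ 2 * n i = \sum_i f i x ^+ 2 / n i.
Proof.
move=> dE; split; apply: eq_bigr => i _; rewrite dE; first by rewrite expr2 mulrAC.
by field; rewrite gt_eqF // (asol_norm_gt0 (sol i)).
Qed.

Lemma comb_sq (d : 'I_N -> R) : RI I0pi (fun x => comb d f1 x ^+ 2) <= \sum_i d i ^+ 2 * n i /\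
  RI I0pi (fun x => comb d f2 x ^+ 2) <= \sum_i d i ^+ 2 * n i.
Proof.
rewrite -parseval; have [_ [i1 i2]] := comb_rint d.
split; apply: RI_le => //; try exact: rintD.
  by move=> x _; rewrite lerDl sqr_ge0.
by move=> x _; rewrite lerDr sqr_ge0.
Qed.

Lemma comb_l (d : 'I_N -> R) : \sum_i (d i * l i) ^+ 2 * n i <= Lam ^+ 2 * \sum_i d i ^+ 2 * n i.
Proof.
rewrite mulr_sumr; apply: ler_sum => i _; rewrite exprMn mulrAC mulrC; apply: ler_wpM2r.
  by rewrite mulr_ge0 ?sqr_ge0 // ltW // (asol_norm_gt0 (sol i)).
by rewrite -(real_normK (num_real (l i))) lerXn2r ?nnegrE // (le_trans _ (l_le i)).
Qed.

Lemma comb_hasder (d : 'I_N -> R) (f : 'I_N -> R -> R) (df : 'I_N -> R) x : (forall i, hasder (f i) x (df i)) ->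
  hasder (comb d f) x (\sum_i d i * df i).
Proof.
move=> h; apply: (hasder_sum (F := fun i x => d i * f i x) (dF := fun i _ => d i * df i)) => i.
apply: hasder_eq (hasderM (hasder_cst (d i) x) (h i)) _.
by rewrite mul0r add0r.
Qed.

Lemma sol1 x : D x -> forall i, hasder (f1 i) x (qw w kap x * f1 i x + (am * cos x - l i) * f2 i x).
Proof. by move=> Dx i; have [h _ _ _ _] := sol i; exact: h. Qed.

Lemma sol2 x : D x -> forall i, hasder (f2 i) x (- qw w kap x * f2 i x + (am * cos x + l i) * f1 i x).
Proof. by move=> Dx i; have [_ h _ _ _] := sol i; exact: h. Qed.

Lemma comb_cont (d : 'I_N -> R) x : D x ->
  {for x, continuous (comb d f1)} /\ {for x, continuous (comb d f2)}.
Proof.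
move=> Dx; split.
  exact: hasder_continuous (comb_hasder d (sol1 Dx)).
exact: hasder_continuous (comb_hasder d (sol2 Dx)).
Qed.

Lemma comb_psi (d : 'I_N -> R) (f : 'I_N -> R -> R) x (s : R) :
  \sum_i d i * ((am * cos x + s * l i) * f i x) = am * cos x * comb d f x + comb (fun i => d i * (s * l i)) f x.
Proof. by rewrite /comb mulr_sumr -big_split; apply: eq_bigr => i _ /=; ring. Qed.

(** The sum is at once the value at [x] of a combination of eigenfunctions and its squared norm. The
    kernel estimate bounds the value by an L1 norm, whose ingredients have square norm at most the
    sum itself, up to the factor [Lam ^+ 2]; [comb_bound] closes the loop, uniformly in [x] and
    [N]. *)
Lemma pointwise2 x : D x -> \sum_i f2 i x ^+ 2 / n i <= K.
Proof.
move=> Dx; pose d i := f2 i x / n i.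
have [e1 e2] := norm_sum (fun i => erefl (d i)).
have [[r1 r2] [s1 s2]] := comb_rint d; have [[r3 r4] [s3 s4]] := comb_rint (fun i => d i * (1 * l i)).
have [q1 _] := comb_sq d; have [q2 _] := comb_sq (fun i => d i * (1 * l i)).
apply: (comb_bound r1 r3 s1 s3); first by rewrite -e2.
  by apply: le_trans q2 _; rewrite -e2; under eq_bigr do rewrite mul1r; exact: comb_l.
rewrite -{1}e1; apply: le_trans (ler_norm _) _.
pose psi y := am * cos y * comb d f1 y + comb (fun i => d i * (1 * l i)) f1 y.
have psii : rint I0pi psi.
  apply: rintD => //; have := coef_rint am 0 r1.
  by congr (rint _ _); apply/funext => y; rewrite addr0.
have h : forall th, D th -> `|comb d f2 th| <= C * RI `[0, th] (fun t => `|psi t|).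
  apply: (@kernel_left R w kap kap_ge) => // y Dy.
    have := comb_hasder d (sol2 Dy).
    move=> H; apply: hasder_eq H _; rewrite /psi -comb_psi /comb mulr_sumr -big_split.
    by apply: eq_bigr => i _ /=; ring.
  apply: cvgD; last by have [] := comb_cont (fun i => d i * (1 * l i)) Dy.
  apply: cvgM; last by have [] := comb_cont d Dy.
  by apply: cvgM; [exact: cvg_cst|exact: continuous_cos].
apply: le_trans (h x Dx) _; rewrite ler_pM2l ?C_gt0 //; apply: RI_mono => //; first exact: seg0.
exact: rint_norm.
Qed.

(** The same argument from the endpoint pi; the eigenvalue enters the equation of [f1] with the
    opposite sign, hence the factor [-1]. *)
Lemma pointwise1 x : D x -> \sum_i f1 i x ^+ 2 / n i <= K.
Proof.
move=> Dx; pose d i := f1 i x / n i.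
have [e1 e2] := norm_sum (fun i => erefl (d i)).
have [[r1 r2] [s1 s2]] := comb_rint d; have [[r3 r4] [s3 s4]] := comb_rint (fun i => d i * (-1 * l i)).
have [_ q1] := comb_sq d; have [_ q2] := comb_sq (fun i => d i * (-1 * l i)).
apply: (comb_bound r2 r4 s2 s4); first by rewrite -e2.
  apply: le_trans q2 _; rewrite -e2; under eq_bigr do rewrite mulN1r mulrN sqrrN; exact: comb_l.
rewrite -{1}e1; apply: le_trans (ler_norm _) _.
pose psi y := am * cos y * comb d f2 y + comb (fun i => d i * (-1 * l i)) f2 y.
have psii : rint I0pi psi.
  apply: rintD => //; have := coef_rint am 0 r2.
  by congr (rint _ _); apply/funext => y; rewrite addr0.
have h : forall th, D th -> `|comb d f1 th| <= C * RI `[th, pi] (fun t => `|psi t|).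
  apply: (@kernel_right R w kap kap_ge) => // y Dy.
    have := comb_hasder d (sol1 Dy).
    move=> H; apply: hasder_eq H _; rewrite /psi -comb_psi /comb mulr_sumr -big_split.
    by apply: eq_bigr => i _ /=; ring.
  apply: cvgD; last by have [] := comb_cont (fun i => d i * (-1 * l i)) Dy.
  apply: cvgM; last by have [] := comb_cont d Dy.
  by apply: cvgM; [exact: cvg_cst|exact: continuous_cos].
apply: le_trans (h x Dx) _; rewrite ler_pM2l ?C_gt0 //; apply: RI_mono => //; first exact: segpi.
exact: rint_norm.
Qed.

(** The two pointwise bounds are added and integrated: each normalised eigenfunction contributes 1
    to the left-hand side. *)
Lemma asol_count_le : N%:R <= 2 * K * pi.
Proof.
pose v i x := (n i)^-1 * (f1 i x ^+ 2 + f2 i x ^+ 2).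
have vi i : rint I0pi (v i) by have [_ _ [? ?] _ _] := sol i; apply: rintZ => //; exact: rintD.
have p0 := pi_gt0 R.
have -> : N%:R = RI I0pi (fun x => \sum_i v i x) :> R.
  rewrite RI_sum // (eq_bigr (fun=> 1)) ?sumr_const ?card_ord // => i _.
  rewrite RIZ; [|by []|by have [_ _ [? ?] _ _] := sol i; exact: rintD].
  by rewrite -/(asol_norm _ _) mulVf // gt_eqF // (asol_norm_gt0 (sol i)).
have mi : rint I0pi (fun x => \sum_i v i x) by exact: rint_sum.
have mc : rint I0pi (fun=> 2 * K) by apply: rint_cst => //; exact: itv_fin.
(* The pointwise bounds are available on the open interval, so the endpoints are removed. *)
have oc (f : R -> R) : rint I0pi f -> RI I0pi f = RI `]0, pi[ f.
  move=> fi; rewrite /RI Rintegral_itv_obnd_cbnd ?Rintegral_itv_bndo_bndc //.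
    by apply: (rintS _ _ _ fi) => //; exact: subset_itv_co_cc.
  by apply: (rintS _ _ _ fi) => //; exact: subset_itv_oo_cc.
have <- : RI I0pi (fun=> 2 * K) = 2 * K * pi by rewrite (RI_cst _ (ltW p0)) subr0.
rewrite (oc _ mi) (oc _ mc); apply: RI_le => //.
- by apply: (rintS _ _ _ mi) => //; exact: subset_itv_oo_cc.
- by apply: (rintS _ _ _ mc) => //; exact: subset_itv_oo_cc.
move=> x; rewrite -D_itv => Dx.
have := lerD (pointwise1 Dx) (pointwise2 Dx); rewrite -big_split /=.
have -> : \sum_i (f1 i x ^+ 2 / n i + f2 i x ^+ 2 / n i) = \sum_i v i x.
  by apply: eq_bigr => i _; rewrite /v -mulrDl mulrC.
by move=> h; lra.
Qed.

End OneSided.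
End AngularCounting.

(** * Growth of the angular eigenvalues and choice of the masses *)

Section Unbounded.
Variable R : realType.
Implicit Types (w kap am Lam a m omega kappa : R).

Lemma asol_count w kap am Lam : 1 / 2 <= `|kap| -> exists B : nat, forall (N : nat) (l : 'I_N -> R),
  injective l -> (forall i, `|l i| <= Lam) ->
  (forall i, exists f : (R -> R) * (R -> R), asol w kap am (l i) f.1 f.2) -> (N <= B)%N.
Proof.
have bnd (x : R) : exists B : nat, forall N : nat, N%:R <= x -> (N <= B)%N.
  exists (Num.bound `|x|) => N h; rewrite -(ler_nat R); apply: le_trans h _.
  by apply: le_trans (ler_norm x) _; exact/ltW/archi_boundP.
have [k0|k0] := leP 0 kap; rewrite ?(ger0_norm k0) ?(ltr0_norm k0) => hk.
  have [B hB] := bnd (2 * (eW w * (`|am| + 1) * (eW w * (`|am| + Lam ^+ 2) + 1) * pi) * pi).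
  exists B => N l li lL /choice[f hf]; apply: hB.
  exact: (asol_count_le hk li lL hf).
have [B hB] := bnd (2 * (eW (- w) * (`|am| + 1) * (eW (- w) * (`|am| + Lam ^+ 2) + 1) * pi) * pi).
exists B => N l li lL /choice[f hf]; apply: hB.
apply: (@asol_count_le R (- w) (- kap) am hk Lam N (fun i => - l i) (fun i => (f i).2) (fun i => (f i).1)).
- by move=> i j /oppr_inj /li.
- by move=> i; rewrite normrN.
- by move=> i; exact: asol_swap (hf i).
Qed.

(** The enumeration is increasing, so a small eigenvalue of large index traps all those with smaller
    index of the same sign in a bounded interval, more than [asol_count] allows. *)
Lemma angular_eigenvalues_unbounded kappa (lam : int -> R -> R -> R -> R) m a omega Lam :
  1 / 2 <= `|kappa| -> angular_enumeration kappa lam -> 0 <= m ->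
  exists n0 : nat, forall n : int, n != 0 -> (n0 <= `|n|)%N -> Lam <= `|lam n m a omega|.
Proof.
move=> hk [mono eig _ _] m0.
pose L n := lam n m a omega.
have hL n : n != 0 -> exists f : (R -> R) * (R -> R), asol (a * omega) kappa (a * m) (L n) f.1 f.2.
  move=> n0; have /(eig m a omega m0)[u [nz Tu]] : exists2 n' : int, n' != 0 & L n = lam n' m a omega by exists n.
  have [Z1 [Z2 hz]] := operator_zsol Tu nz.
  by have [f1 [f2 hf]] := zsol_asol hz; exists (f1, f2).
have mL i j : i != 0 -> j != 0 -> (i <= j)%R -> L i <= L j.
  move=> i0 j0; rewrite le_eqVlt => /orP[/eqP->//|ij].
  by rewrite ltW //; exact: mono.
(* Bounds every eigenvalue lying between [L 1] or [L (-1)] and [L n], for either sign of [n]. *)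
pose K := `|Lam| + `|L 1| + `|L (-1)|.
have [B hB] := asol_count (a * omega) (a * m) K hk.
exists B.+1 => n n0 nB; rewrite leNgt; apply/negP => hn.
have {}hn : `|L n| <= `|Lam| by rewrite ltW // (lt_le_trans hn) // ler_norm.
suff : (B.+1 <= B)%N by rewrite ltnn.
have inj (s : int) : s != 0 -> injective (fun i : 'I_B.+1 => L (s * i.+1%:Z)).
  move=> s0 i j; have nzi (k : 'I_B.+1) : s * k.+1%:Z != 0 by rewrite mulf_neq0.
  case: (ltgtP (s * i.+1%:Z) (s * j.+1%:Z)) => [h|h|/(mulfI s0) [] /val_inj //] /= e.
    by have : L _ < L _ := mono m a omega m0 _ _ (nzi i) (nzi j) h; rewrite e ltxx.
  by have : L _ < L _ := mono m a omega m0 _ _ (nzi j) (nzi i) h; rewrite e ltxx.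
have a1 := ler_norm (L 1); have a2 := ler_norm (- L 1).
have b1 := ler_norm (L (-1)); have b2 := ler_norm (- L (-1)).
have c1 := ler_norm (L n); have c2 := ler_norm (- L n).
rewrite !normrN in a2 b2 c2.
have n1 : 0 <= `|L 1| by []. have n2 : 0 <= `|L (-1)| by []. have n3 : 0 <= `|Lam| by [].
case: n n0 nB hn c1 c2 => k n0 nB hn c1 c2.
  apply: (hB _ (fun i => L (1 * i.+1%:Z))); first exact: inj.
    move=> i; rewrite mul1r; have h1 : L 1 <= L i.+1%:Z by exact: mL.
    have h2 : L i.+1%:Z <= L k by apply: mL => //; rewrite lez_nat (leq_trans _ nB).
    by rewrite ler_norml /K; apply/andP; split; lra.
  by move=> i; apply: hL; rewrite mul1r.
apply: (hB _ (fun i => L (-1 * i.+1%:Z))); first exact: inj.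
  move=> i; rewrite mulN1r; have h1 : L (- i.+1%:Z) <= L (-1) by apply: mL => //; rewrite lerN2.
  have h2 : L (Negz k) <= L (- i.+1%:Z).
    by apply: mL => //; rewrite NegzE lerN2 lez_nat (leq_trans (ltn_ord i) nB).
  by rewrite ler_norml /K; apply/andP; split; lra.
by move=> i; apply: hL; rewrite mulN1r.
Qed.

Lemma half_integer_norm kappa : (exists k : int, kappa = k%:~R + 1 / 2) -> 1 / 2 <= `|kappa|.
Proof.
case=> k ->; have [k0|k0] := leP 0 k.
  have h : 0 <= k%:~R :> R by rewrite ler0z.
  by rewrite ger0_norm; lra.
have h : k%:~R <= -1 :> R by rewrite -[-1]/((-1)%:~R) ler_int -[X in _ <= X]add0r lerBrDr lezD1.
by rewrite ler0_norm; lra.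
Qed.

(** The assumed continuity is relative to the closed half-space of nonnegative masses; a positive
    mass is an interior point, where it becomes ordinary continuity. *)
Lemma enumeration_continuous kappa (lam : int -> R -> R -> R -> R) n a omega m : n != 0 ->
  angular_enumeration kappa lam -> 0 < m -> {for m, continuous (fun m => lam n m a omega)}.
Proof.
move=> n0 [_ _ /(_ n n0) cw _] m0.
pose U := [set p : R * R * R | 0 < p.1.1].
have oU : open U.
  have -> : U = (fun p : R * R * R => p.1.1) @^-1` [set x | 0 < x] by [].
  apply: open_comp; last exact: open_gt.
  by move=> p _; apply: (@continuous_comp _ _ _ fst fst); exact: cvg_fst.
have sub : U `<=` [set p : R * R * R | 0 <= p.1.1] by move=> p; exact: ltW.
have := continuous_subspaceW sub cw; rewrite continuous_open_subspace // => cU.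
have h := cU (m, a, omega); rewrite inE in h; have {}h := h m0.
apply: (@continuous_comp _ _ _ (fun m => (m, a, omega)) (fun p : R * R * R => lam n p.1.1 p.1.2 p.2)); last exact: h.
apply: (@cvg_pair _ _ _ (nbhs m) (nbhs (m, a)) (nbhs omega) _ _ _ (fun m => (m, a)) (fun=> omega)); last exact: cvg_cst.
by apply: (@cvg_pair _ _ _ (nbhs m) (nbhs m) (nbhs a) _ _ _ id (fun=> a)); [exact: cvg_id|exact: cvg_cst].
Qed.

End Unbounded.

(** * Construction of the masses *)

Section EigenvalueSequence.
Variables (R : realType) (M a Q e kappa : R).
Variables (lam : int -> R -> R -> R -> R) (n : int).
Hypotheses (M0 : 0 < M) (extreme : M ^+ 2 = a ^+ 2 + Q ^+ 2).
Hypotheses (lam_enum : angular_enumeration kappa lam) (nz : n != 0).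
Notation om := (omega_crit M a Q e kappa).
Notation eta := (e * Q + M * om).
Notation be := (e * Q + 2 * om * M).
Hypothesis om_eta : 0 < om * eta.
Hypothesis lam_big : 2 + `|be| <= `|lam n `|om| a om|.

(** Everything is parametrised by the decay rate [k] at infinity, so that [m] decreasing to [|om|]
    becomes [k] decreasing to 0. In this parameter [G] is s^2 and [F] is the left-hand side of the
    quantisation condition. *)
Let mass (k : R) := Num.sqrt (om ^+ 2 + k ^+ 2).
Let G k := lam n (mass k) a om ^+ 2 + (mass k * M + be) * (mass k * M - be).
Let F k := om * eta / k - M * k - Num.sqrt (G k).

Let om0 : om != 0.
Proof. by apply: contraTneq om_eta => ->; rewrite mul0r ltxx. Qed.

Let mass_gt0 k : 0 < mass k.
Proof. by rewrite sqrtr_gt0 ltr_pwDl ?sqr_ge0 // exprn_even_gt0. Qed.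

Let mass_sq k : mass k ^+ 2 = om ^+ 2 + k ^+ 2.
Proof. by rewrite sqr_sqrtr // addr_ge0 ?sqr_ge0. Qed.

Let mass_gt k : 0 < k -> `|om| < mass k.
Proof. by move=> k0; rewrite -sqrtr_sqr ltr_sqrt ?ltrDl ?exprn_gt0 // ltr_pwDl ?sqr_ge0 // exprn_even_gt0. Qed.

Let mass_le k : 0 < k -> mass k <= `|om| + k.
Proof.
move=> k0; have h : 0 <= `|om| + k by rewrite addr_ge0 // ltW.
rewrite -[leRHS](ger0_norm h) -sqrtr_sqr ler_sqrt ?sqr_ge0 // sqrrD real_normK ?num_real //.
by rewrite lerD2r lerDl mulrn_wge0 // mulr_ge0 // ltW.
Qed.

Let mass_lt k k' : 0 < k -> k < k' -> mass k < mass k'.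
Proof.
move=> k0 kk; have k'0 := lt_trans k0 kk.
rewrite ltr_sqrt ?ltrD2l; last by rewrite ltr_wpDl ?sqr_ge0 // exprn_gt0.
by rewrite ltrXn2r // ?nnegrE // ltW.
Qed.

Let mass_cont k : {for k, continuous mass}.
Proof.
have h : (fun k : R => om ^+ 2 + k ^+ 2) @ k --> om ^+ 2 + k ^+ 2.
  by apply: cvgD; [exact: cvg_cst|apply: exprn_continuous].
exact: cvg_comp h (@sqrt_continuous R _).
Qed.

Let G_cont k : {for k, continuous G}.
Proof.
have c : {for k, continuous (fun k => lam n (mass k) a om)}.
  apply: (@continuous_comp _ _ _ mass (fun m => lam n m a om)); first exact: mass_cont.
  exact: enumeration_continuous nz lam_enum (mass_gt0 k).
have cM : {for k, continuous (fun k => mass k * M)} by apply: cvgM; [exact: mass_cont|exact: cvg_cst].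
apply: cvgD; first by rewrite /= expr2; apply: cvgM.
by apply: cvgM; [apply: cvgD|apply: cvgB] => //; exact: cvg_cst.
Qed.

Let F_cont k : 0 < k -> {for k, continuous F}.
Proof.
move=> k0; apply: cvgB; first apply: cvgB.
- apply: cvgM; first exact: cvg_cst.
  by apply: cvgV; [rewrite gt_eqF|exact: cvg_id].
- by apply: cvgM; [exact: cvg_cst|exact: cvg_id].
- by have h : G @ k --> G k := @G_cont k; exact: cvg_comp h (@sqrt_continuous R _).
Qed.

(** Explains the margin in [lam_big]: (2 + |be|)^2 - be^2 is at least 4, so s^2 > 1 at the limiting
    mass. *)
Let G0 : 1 < G 0.
Proof.
have -> : G 0 = lam n `|om| a om ^+ 2 + (`|om| * M + be) * (`|om| * M - be).
  by rewrite /G /mass expr0n addr0 sqrtr_sqr.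
have h : (2 + `|be|) ^+ 2 <= lam n `|om| a om ^+ 2.
  by rewrite -(real_normK (num_real (lam _ _ _ _))) lerXn2r ?nnegrE // addr_ge0.
have h2 : `|be| ^+ 2 = be ^+ 2 by rewrite real_normK ?num_real.
have h3 : 0 <= (`|om| * M) ^+ 2 by exact: sqr_ge0.
have h4 : 0 <= `|be| by [].
move: h2 h h3 h4; set x := `|be|; set y := `|om| * M; set z := lam _ _ _ _ => h2 h h3 h4.
have -> : (y + be) * (y - be) = y ^+ 2 - be ^+ 2 by ring.
move: h; rewrite -h2 sqrrD; lra.
Qed.

(** The lower bound provides s >= 1 for small [k]; the upper bound keeps the square root from
    competing with the blow-up of [F]. *)
Let G_bound : exists2 d, 0 < d & forall k, 0 < k < d -> 1 < G k < G 0 + 1.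
Proof.
have c : G @ (0 : R) --> G 0 := @G_cont 0.
have h : \forall k \near (0 : R), 1 < G k < G 0 + 1.
  have h1 : \forall k \near (0 : R), 1 < G k by exact: (cvgr_gt _ c).
  have h2 : \forall k \near (0 : R), G k < G 0 + 1 by apply: (cvgr_lt _ c); rewrite ltrDl.
  by apply: filterS2 h1 h2 => k -> ->.
have /nbhs_ballP[d /= d0 hd] := h; exists d => // k /andP[k0 kd].
by apply: hd; rewrite /ball /= sub0r normrN gtr0_norm.
Qed.

Let good k := 0 < k /\ energy_eigenvalue M a Q e kappa (mass k) (lam n (mass k) a om) om.

Let good_of_F (N : nat) k : 0 < k -> 1 < G k -> (0 < N)%N -> F k = N%:R -> good k.
Proof.
move=> k0 Gk N0 hF; split=> //; split; last first.
  by have [_ eig _ _] := lam_enum; apply/(eig _ a om (ltW (mass_gt0 k))); exists n.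
have G0' : 0 <= G k by rewrite (le_trans _ (ltW Gk)).
apply: (@radial_eigenvalue R M a Q e kappa (mass k) _ k (Num.sqrt (G k)) N) => //.
- have -> : (mass k + om) * (mass k - om) = mass k ^+ 2 - om ^+ 2 by ring.
  by rewrite mass_sq addrAC subrr add0r.
- by rewrite -[1]sqrtr1 ler_sqrt ?(ltW Gk) // (lt_trans ltr01).
- by rewrite sqr_sqrtr.
rewrite -hF /F; have h := mass_sq k; set s := Num.sqrt _; set b := be.
have -> : (mass k + om) * (mass k * M - b) + (mass k - om) * (mass k * M + b) = 2 * M * mass k ^+ 2 - 2 * om * b by ring.
by rewrite h /b; field; rewrite gt_eqF.
Qed.

(* [F] blows up at [0], so it takes arbitrarily large integer values there. *)
Let exists_good eps : 0 < eps -> exists k, [/\ 0 < k, k < eps & good k].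
Proof.
move=> eps0; have [d d0 hd] := G_bound.
pose k2 := Num.min eps d / 2.
have md : 0 < Num.min eps d by rewrite lt_min eps0.
have m1 : Num.min eps d <= eps by rewrite ge_min lexx.
have m2 : Num.min eps d <= d by rewrite ge_min lexx orbT.
have k20 : 0 < k2 by rewrite divr_gt0.
have k2e : k2 < eps by rewrite /k2; lra.
have k2d : k2 < d by rewrite /k2; lra.
(* The successor ensures a positive degree, on which nontriviality of the polynomial solution
   rests. *)
pose N := (Num.bound `|F k2|).+1.
have FN : F k2 <= N%:R.
  apply: le_trans (ler_norm _) _; apply: le_trans (ltW (archi_boundP (normr_ge0 _))) _.
  by rewrite ler_nat.
(* [om * eta / k1 >= T] forces [F k1 >= N]: for [k1 <= 1] the term [M * k1] costs at most [M], and
   the square root of [G k1] is at most [G k1], below [G 0 + 1]. *)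
pose T := N%:R + M + (G 0 + 1).
have N0 : 0 <= N%:R :> R by [].
have T0 : 0 < T by have := G0; rewrite /T; have := M0; lra.
pose k1 := Num.min k2 (Num.min 1 (om * eta / T)).
have k10 : 0 < k1 by rewrite !lt_min k20 ltr01 divr_gt0.
have k12 : k1 <= k2 by rewrite ge_min lexx.
have k11 : k1 <= 1 by rewrite !ge_min lexx orbT.
have k1T : k1 <= om * eta / T by rewrite !ge_min lexx !orbT.
have /andP[g1 g2] := hd k1 (introT andP (conj k10 (le_lt_trans k12 k2d))).
have NF : N%:R <= F k1.
  have h1 : T <= om * eta / k1 by rewrite ler_pdivlMr // mulrC -ler_pdivlMr.
  have h2 : M * k1 <= M by rewrite ger_pMr.
  have h3 : Num.sqrt (G k1) <= G k1.
    have G10 : 0 <= G k1 by lra.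
    rewrite -[leRHS](ger0_norm G10) -sqrtr_sqr ler_sqrt ?sqr_ge0 // expr2 ler_pMr //; lra.
  rewrite /F; rewrite /T in h1; lra.
have cF : {within `[k1, k2], continuous F}.
  apply: continuous_in_subspaceT => x; rewrite inE /= in_itv /= => /andP[x1 _].
  by apply: F_cont; exact: lt_le_trans x1.
have [|k] := IVT k12 cF (v := N%:R).
  by rewrite ge_min le_max FN NF orbT.
rewrite in_itv /= => /andP[kk1 kk2] Fk.
have k0 := lt_le_trans k10 kk1.
have /andP[gk _] := hd k (introT andP (conj k0 (le_lt_trans kk2 k2d))).
by exists k; split; [|exact: le_lt_trans k2e|exact: good_of_F gk _ Fk].
Qed.

Lemma eigenvalue_sequence : exists mN : nat -> R,
  [/\ forall N, `|om| < mN N,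
      forall N, energy_eigenvalue M a Q e kappa (mN N) (lam n (mN N) a om) om,
      forall N, mN N.+1 < mN N & mN @ \oo --> `|om|].
Proof.
have /choice[g hg] : forall eps, exists k, 0 < eps -> [/\ 0 < k, k < eps & good k].
  move=> eps; have [eps0|_] := ltP 0 eps; last by exists 0.
  by have [k hk] := exists_good eps0; exists k.
(* Each rate is chosen below its predecessor, for strict monotonicity, and below [1 / (N + 1)], for
   convergence to 0. *)
pose fix K (N : nat) := if N is N'.+1 then g (Num.min (K N') (N.+1%:R^-1)) else g 1.
pose B N := if N is N'.+1 then Num.min (K N') (N.+1%:R^-1) else 1.
have KE N : K N = g (B N) by case: N.
have B0 N : 0 < B N.
  elim: N => [|N IH]; first exact: ltr01.
  by rewrite /B lt_min invr_gt0 ltr0Sn andbT KE; have [] := hg _ IH.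
have hK N : [/\ 0 < K N, K N < B N & good (K N)] by rewrite KE; exact: hg.
have KB N : K N <= N.+1%:R^-1.
  have [_ /ltW h _] := hK N; apply: le_trans h _; case: N => [|N] /=; first by rewrite invr1.
  by rewrite ge_min lexx orbT.
exists (mass \o K); split.
- by move=> N; have [k0 _ _] := hK N; exact: mass_gt.
- by move=> N; have [_ _ []] := hK N.
- move=> N /=; have [k0 kB _] := hK N.+1; apply: mass_lt k0 _.
  by apply: lt_le_trans kB _; rewrite /= ge_min lexx.
apply: (@squeeze_cvgr _ _ _ _ (fun=> `|om|) (fun N => `|om| + harmonic N)).
- near=> N; have [k0 _ _] := hK N; rewrite (ltW (mass_gt k0)) /=.
  by apply: le_trans (mass_le k0) _; rewrite lerD2l; exact: KB.
- exact: cvg_cst.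
- by rewrite -[X in _ --> X]addr0; apply: cvgD; [exact: cvg_cst|exact: cvg_harmonic].
Unshelve. all: end_near. Qed.

End EigenvalueSequence.

Unset Implicit Arguments.
Local Close Scope complex_scope.

Theorem mainTheorem2 (R : realType) (M a Q e kappa : R)
    (lam : int -> R -> R -> R -> R)
    (M_gt0 : 0 < M) (extreme : M ^+ 2 = a ^+ 2 + Q ^+ 2)
    (kappa_half : exists k : int, kappa = k%:~R + 1 / 2)
    (lam_enum : angular_enumeration kappa lam) :
  let omega := - ((kappa * a + e * Q * M) / (a ^+ 2 + M ^+ 2)) in
  exists n0 : nat, forall n : int, n != 0 -> (n0 <= `|n|)%N ->
    (omega * (e * Q + M * omega) <= 0 ->
       forall m : R, 0 <= m -> forall omega' : R,
         ~ energy_eigenvalue M a Q e kappa m (lam n m a omega') omega') /\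
    (0 < omega * (e * Q + M * omega) ->
       exists mN : nat -> R,
         [/\ forall N, `|omega| < mN N,
             forall N,
               energy_eigenvalue M a Q e kappa (mN N)
                 (lam n (mN N) a omega) omega,
             exists N0 : nat, forall N, (N0 <= N)%N -> mN N.+1 < mN N &
             mN @ \oo --> `|omega|]).
Proof.
move=> omega; have hk := half_integer_norm kappa_half.
(* The eigenvalues are made large at the limiting mass [|omega|], so [n0] is fixed before any mass
   of the sequence. *)
have [n0 hn0] := angular_eigenvalues_unbounded a omega (2 + `|e * Q + 2 * omega * M|) hk lam_enum (normr_ge0 omega).
exists n0 => n nz n_big; split.
  by move=> sgn m m0 omega' [ev _]; exact: no_radial_eigenvalue M_gt0 extreme m0 sgn ev.
move=> sgn; have [mN [gtN evN decN cvgN]] :=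
  eigenvalue_sequence M_gt0 extreme lam_enum nz sgn (hn0 n nz n_big).
by exists mN; split=> //; exists 0%N => N _; exact: decN.
Qed.
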